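(* Let $B\ge 1$ be an integer, $\alpha>0$, $\varepsilon>0$, and let $\mathcal{G}$ be a $(B,\alpha)$-partitionable family of graphs of bounded maximum degree. Then there are a constant $K$, a polynomial $p$ and a constant $C$, depending only on $\mathcal{G},B,\alpha,\varepsilon$, such that for every sufficiently large connected graph $G\in\mathcal{G}$ with $n=|V(G)|$ vertices, every integer $$q\ge (1+\varepsilon)\frac{n}{\alpha B},$$ and every $\delta\in(0,1/2]$, the Glauber dynamics $\mathcal{M}$ (the version in which the empty set is counted with multiplicity) on the state space $\Omega^K_{q,B,G}$ has mixing time, to within total variation distance $\delta$ of its stationary distribution $\pi$, $$\le\ p(n)\,2^{C\,\mathrm{band}(G)}\,\log(1/\delta),$$ where $\pi(\omega)$, for a partition $\omega$, is proportional to $\dfrac{q!}{(q-\kappa(\omega))!}$, with $\kappa(\omega)$ the number of nonempty classes of $\omega$.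
   Context: All graphs are finite. The bandwidth of a graph $G$ on $n$ vertices is $\mathrm{band}(G)=\min_{\sigma}\max_{u\sim v}|\sigma(u)-\sigma(v)|$, the minimum over bijections $\sigma:V(G)\to\{1,\dots,n\}$, the maximum over adjacent pairs. A $q$-partition of $G$ is a partition of $V(G)$ into $q$ (not necessarily nonempty) unordered pieces (classes). It is contiguous if every piece induces a connected subgraph of $G$, and a contiguous $q$-partition is $B$-bounded if every piece has size $\le B$. Two partitions agree except on a vertex set $W$ if their classes can be labelled so that each vertex outside $W$ has the same label in both. A family $\mathcal{G}$ of graphs is $(B,\alpha)$-partitionable if for every $\varepsilon>0$ there are $K$ and $\delta_0>0$ such that for every sufficiently large $G\in\mathcal{G}$, with $n=|V(G)|$, and every integer $q>(1+\varepsilon)n/(\alpha B)$: (1) there is a polynomial time algorithm to find a $B$-bounded contiguous $q$-partition of $G$; and (2) for any $B$-bounded contiguous partition $\omega$ of $G$ with exactly $q$ nonempty classes, there are at least $\delta_0|V(G)|$ distinct $B$-bounded contiguous partitions $\omega_i$ of $G$, each using fewer than $q$ nonempty classes, and each agreeing with $\omega$ except on (the vertex set of) a connected subgraph $H_i$ of $G$ with at most $K$ vertices. $\Omega_{q,B,G}$ is the set of all $B$-bounded contiguous $q$-partitions of $G$. $\Omega^K_{q,B,G}$ is the set of all $q$-partitions $\omega$ of $G$ which agree with some $\omega'\in\Omega_{q,B,G}$ on all but at most $K$ vertices. Glauber dynamics $\mathcal{M}$ on $\Omega=\Omega^K_{q,B,G}$: from a state $\omega\in\Omega$, (a) choose a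 uniformly random vertex $v$ of $G$; (b) choose a uniformly random set among all the sets (classes) in $\omega$; (c) remove $v$ from its current class and make it a member of the chosen set, if the resulting $q$-partition belongs to $\Omega$; otherwise remain at $\omega$. In the version used here, the choice in (b) is uniform over the $q$ classes of $\omega$ as a multiset, so the empty set is counted with multiplicity $q-\kappa(\omega)$. The mixing time to within $\delta$ is the least $t$ such that from every starting state the distribution after $t$ steps is within total variation distance $\delta$ of the stationary distribution. *)

(* Defs.v *)
From HB Require Import structures.
From mathcomp Require Import all_boot all_order all_algebra.
From mathcomp Require Import reals exp.
Set Implicit Arguments.
Unset Strict Implicit.
Unset Printing Implicit Defensive.
Import Order.TTheory GRing.Theory Num.Theory.
Local Open Scope ring_scope.

Record sgraph := SGraph {
  vertex :> finType;
  adj : rel vertex;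
  adj_sym : symmetric adj;
  adj_irr : irreflexive adj }.

Definition max_degree_le (G : sgraph) (D : nat) : Prop :=
  forall v : G, (#|[set w | adj v w]| <= D)%N.

Definition connected_in (G : sgraph) (A : {set G}) : bool :=
  [forall u in A, forall v in A,
     connect [rel x y | [&& adj x y, x \in A & y \in A]] u v].

Definition connected_graph (G : sgraph) : bool := connected_in [set: G].

(* The maximal stretch of an edge; an edgeless graph has width 0. *)
Definition width (G : sgraph) (s : {ffun G -> 'I_#|G|}) : nat :=
  (\max_(e : G * G | adj e.1 e.2) `|(s e.1)%:Z - (s e.2)%:Z|)%N.

(* An injection into 'I_#|G| is a bijection. *)
Definition bandwidth (G : sgraph) : nat :=
  width [arg min_(s < [ffun v : G => enum_rank v] | injectiveb s)
           @width G s].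

(* A q-partition with unordered, possibly empty classes is represented by the
   set of its nonempty classes, at most q in number; the remaining q - #|w|
   classes are empty, and #|w| is kappa(w). *)

Definition is_qpartition (G : sgraph) (q : nat) (w : {set {set G}}) : bool :=
  partition w [set: G] && (#|w| <= q)%N.

Definition contiguous (G : sgraph) (w : {set {set G}}) : bool :=
  [forall A in w, connected_in A].

Definition bounded (G : sgraph) (B : nat) (w : {set {set G}}) : bool :=
  [forall A in w, (#|A| <= B)%N].

Definition Omega (G : sgraph) (q B : nat) : {set {set {set G}}} :=
  [set w | [&& is_qpartition q w, contiguous w & bounded B w]].

(* Giving distinct labels to the classes of w amounts to a map on vertices
   whose nonempty fibres are the nonempty classes of w. *)
Definition labels (G : sgraph) (q : nat) (f : {ffun G -> 'I_q})
    (w : {set {set G}}) : bool :=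
  preim_partition f [set: G] == w.

Definition agree_except (G : sgraph) (q : nat) (W : {set G})
    (w w' : {set {set G}}) : bool :=
  [exists f : {ffun G -> 'I_q}, exists g : {ffun G -> 'I_q},
     [&& labels f w, labels g w' & [forall v, (v \notin W) ==> (f v == g v)]]].

Definition OmegaK (G : sgraph) (q B K : nat) : {set {set {set G}}} :=
  [set w | is_qpartition q w &&
     [exists w' in Omega G q B, exists W : {set G},
        (#|W| <= K)%N && agree_except q W w w']].

(* Deterministic one-tape Turing machines with tape alphabet {0, 1, blank},
   where [None] is the blank. *)

Record machine := Machine {
  mstate : finType;
  mstart : mstate;
  mhalt : pred mstate;
  (* new state, symbol written, and head move ([true] is right) *)
  mtrans : mstate -> option bool -> mstate * option bool * bool }.

Record config (M : machine) := Config {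
  cstate : mstate M;
  chead : int;
  ctape : int -> option bool }.

Definition init (M : machine) (u : seq bool) : config M :=
  Config (mstart M) 0 (fun i => if i is Posz k then onth u k else None).

Definition mstep (M : machine) (c : config M) : config M :=
  if mhalt (cstate c) then c else
  let: (s, a, d) := mtrans (cstate c) (ctape c (chead c)) in
  Config s (if d then chead c + 1 else chead c - 1)
    (fun i => if i == chead c then a else ctape c i).

(* The output is written from the head rightwards and followed by blanks. *)
Definition outputs_within (M : machine) (t : nat) (u out : seq bool) : Prop :=
  let c := iter t (@mstep M) (init M u) in
  mhalt (cstate c) /\ forall i : nat, ctape c (chead c + i%:Z) = onth out i.

Definition unary (k : nat) : seq bool := rcons (nseq k true) false.

(* least significant bit first *)
Definition binary (k : nat) : seq bool :=
  [seq odd (k %/ 2 ^ i) | i <- iota 0 (trunc_log 2 k).+1].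

(* The graph is presented by an enumeration s of its vertices: the number of
   vertices in unary, the adjacency matrix row by row, then q in binary. *)
Definition encode_instance (G : sgraph) (s : 'I_#|G| -> G) (q : nat) :
    seq bool :=
  unary #|G| ++ [seq adj (s i) (s j) | i <- enum 'I_#|G|, j <- enum 'I_#|G|]
    ++ binary q.

Definition encode_labelling (G : sgraph) (q : nat) (s : 'I_#|G| -> G)
    (f : {ffun G -> 'I_q}) : seq bool :=
  flatten [seq unary (f (s i)) | i <- enum 'I_#|G|].

(* On every presentation of G, the machine M outputs a B-bounded contiguous
   q-partition, given by class labels, in time polynomial (of degree d) in the
   length of the input. *)
Definition finds_partition (M : machine) (d : nat) (G : sgraph) (q B : nat) :
    Prop :=
  forall s : 'I_#|G| -> G, bijective s ->
  let u := encode_instance s q in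
  exists2 f : {ffun G -> 'I_q},
    preim_partition f [set: G] \in Omega G q B
    & outputs_within M (size u ^ d + d) u (encode_labelling s f).

(* The vertex sets of connected subgraphs are exactly the sets inducing a
   connected subgraph. *)
Definition reductions (G : sgraph) (q B K : nat) (w : {set {set G}}) :
    {set {set {set G}}} :=
  [set w' in Omega G q B | (#|w'| < q)%N &&
     [exists H : {set G},
        [&& connected_in H, (#|H| <= K)%N & agree_except q H w w']]].

(* The algorithm is uniform: one machine and one polynomial serve all large
   graphs of the family and all admissible q. *)
Definition partitionable (R : realType) (F : sgraph -> Prop) (B : nat)
    (alpha : R) : Prop :=
  forall eps : R, 0 < eps ->
  exists (K : nat) (delta0 : R), 0 < delta0 /\
  exists (M : machine) (d N : nat),
  forall G : sgraph, F G -> (N <= #|G|)%N ->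
  forall q : nat, (1 + eps) * (#|G|%:R / (alpha * B%:R)) < q%:R ->
    finds_partition M d G q B /\
    (forall w, w \in Omega G q B -> #|w| = q ->
       delta0 * #|G|%:R <= #|reductions q B K w|%:R).

Definition distribution (R : realType) (S : finType) (mu : S -> R) : Prop :=
  (forall x, 0 <= mu x) /\ \sum_x mu x = 1.

Definition evolve (R : realType) (S : finType) (P : S -> S -> R) (mu : S -> R)
    : S -> R :=
  fun y => \sum_x mu x * P x y.

Definition stationary (R : realType) (S : finType) (P : S -> S -> R)
    (mu : S -> R) : Prop :=
  distribution mu /\ evolve P mu =1 mu.

Definition dist_after (R : realType) (S : finType) (P : S -> S -> R) (x : S)
    (t : nat) : S -> R :=
  iter t (evolve P) (fun y => (y == x)%:R).

Definition tv (R : realType) (S : finType) (mu nu : S -> R) : R :=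
  2^-1 * \sum_x `|mu x - nu x|.

Definition mixed (R : realType) (S : finType) (P : S -> S -> R) (pi : S -> R)
    (delta : R) (t : nat) : Prop :=
  forall x, tv (dist_after P x t) pi <= delta.

Definition is_mixing_time (R : realType) (S : finType) (P : S -> S -> R)
    (pi : S -> R) (delta : R) (t : nat) : Prop :=
  mixed P pi delta t /\ forall s, mixed P pi delta s -> (t <= s)%N.

Definition state (G : sgraph) (q B K : nat) : finType :=
  {w : {set {set G}} | w \in OmegaK G q B K}.

(* The q classes as a multiset, the empty set having multiplicity q - #|w|. *)
Definition classes (G : sgraph) (q : nat) (w : {set {set G}}) :
    seq {set G} :=
  enum w ++ nseq (q - #|w|) set0.

(* Put v in the class A of w (possibly A = set0) and remove it from the other
   classes; classes left empty are dropped from the representation. *)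
Definition move (G : sgraph) (w : {set {set G}}) (v : G) (A : {set G}) :
    {set {set G}} :=
  [set (if C == A then v |: C else C :\ v) | C in set0 |: w] :\ set0.

Definition glauber_step (G : sgraph) (q B K : nat) (w : {set {set G}}) (v : G)
    (A : {set G}) : {set {set G}} :=
  if move w v A \in OmegaK G q B K then move w v A else w.

Definition glauber (R : realType) (G : sgraph) (q B K : nat)
    (x y : state G q B K) : R :=
  \sum_(v : G) \sum_(A <- classes q (val x))
    #|G|%:R^-1 * q%:R^-1 * (glauber_step q B K (val x) v A == val y)%:R.

Definition weight (R : realType) (G : sgraph) (q : nat) (w : {set {set G}}) :
    R :=
  q`!%:R / (q - #|w|)`!%:R.

Definition glauber_pi (R : realType) (G : sgraph) (q B K : nat)
    (x : state G q B K) : R :=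
  weight R q (val x) / \sum_(y : state G q B K) weight R q (val y).

(* Main.v *)
(* Fix a bandwidth ordering of the vertices and write b for the bandwidth.
   Given two contiguous partitions x and y and a set P of vertices, keep the
   edges inside a class of y within P and inside a class of x outside P; the
   components form a hybrid contiguous partition. When P is an interval of the
   ordering only O(b) edges are cut, so the pair (hybrid of x and y, hybrid of
   y and x) determines (x, y) up to 2^O(b) choices. Letting P grow from the
   empty set to the whole vertex set through cyclic intervals gives canonical
   paths from x to y. A mountain-climbing argument chooses these intervals so
   that both hybrids keep at least about as many classes as the smaller of x
   and y, which controls the factorial weights, and uses at most O(b) classes
   in excess of q.

   The excess is removed one class at a time: a function on partitions with at
   most r classes is extended to those with r + 1 classes by averaging over the
   reductions, which are linearly many and mostly disjoint, so that each step
   costs a constant factor in the Dirichlet form. This gives a Poincare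
   inequality on the contiguous partitions with at most q classes, with constant
   poly(n, q) 2^O(b). Local changes are then realised by walks of bounded length
   on labelled partitions within K vertices of a contiguous one, and the
   Poincare inequality becomes a spectral gap.

   The gap bound is polynomial in q, not in n. For q >= 8 n^4 the empty class is
   chosen almost always; the expected number of vertices in classes of size at
   least two then contracts, every state reaches the partition into singletons
   with probability 1/2 in O(n^3) steps, and Doeblin's condition applies. *)

Require Import Defs.
From mathcomp Require Import all_boot all_order all_algebra perm.
From mathcomp Require Import reals sequences exp zify ring lra.
Set Implicit Arguments.
Unset Strict Implicit.
Unset Printing Implicit Defensive.
Import Order.TTheory GRing.Theory Num.Theory.

(** * Mountain climbing *)

(** A partition with kappa classes has exactly q!/(q - kappa)! labellings by q labels, so the chain
    is the image of single-vertex recolouring under the uniform measure on labellings; this is where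
    the multiplicity of the empty set enters.

    The intervals are cyclic because along initial ones the class counts of x and y may drift apart:
    a hybrid with far too few classes would have a far smaller weight than the pair it encodes.
    Balanced hybrids may still exceed q by 1 + 8b classes, which the chain does not allow; the
    reduction hypothesis holds with the same constants for every larger number of classes, so the
    excess can be removed level by level. The exponent of 2 thus has two sources: at most 8bD cut
    edges, recorded for both partitions, and 1 + 8b levels, each costing a constant.

    K is (D + 1)^(K0 + B), a bound on balls of radius K0 + B: a reduction alters labels on a
    connected set of at most K0 vertices, and the classes involved reach at most B further. The
    number of partitions that differ from a given one inside a given ball depends on neither n nor
    q. *)

Lemma odd_sum (I : finType) (P : pred I) (F : I -> nat) :
  odd (\sum_(i | P i) F i) -> exists2 i, P i & odd (F i).
Proof.
move=> h; apply/exists_inP; apply: contraLR h; rewrite negb_exists_in => /forall_inP h.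
by elim/big_ind: _ => //= a b; rewrite oddD => /negbTE-> /negbTE->.
Qed.

(** Swapping coordinates matches the pairs with increasing [enum_rank] with the others, and
    irreflexivity excludes fixed points. *)
Lemma even_card_symmetric (T : finType) (e : rel T) :
  symmetric e -> irreflexive e -> ~~ odd #|[set p : T * T | e p.1 p.2]|.
Proof.
move=> es ei; pose L := [set p : T * T | e p.1 p.2 && (enum_rank p.1 < enum_rank p.2)].
pose sw (p : T * T) := (p.2, p.1).
have -> : [set p : T * T | e p.1 p.2] = L :|: sw @: L.
  apply/setP=> -[a b]; rewrite !inE /=; apply/idP/idP.
    move=> eab; rewrite eab /=; case: (ltngtP (enum_rank a) (enum_rank b)) => //= h.
      by apply/imsetP; exists (b, a) => //; rewrite inE /= es eab h.
    by move/val_inj/enum_rank_inj: h eab => ->; rewrite ei.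
  case/orP=> [/andP[]//|/imsetP[[c d]]]; rewrite inE /= => /andP[h _] [-> ->].
  by rewrite es.
rewrite cardsU card_imset; last by move=> [a b] [c d] [-> ->].
rewrite (_ : L :&: _ = set0) ?cards0 ?subn0 ?addnn ?odd_double //.
apply/setP=> -[a b]; rewrite !inE /=; apply/negbTE/negP => /andP[/andP[_ h]].
case/imsetP=> -[c d]; rewrite inE /= => /andP[_ h2] [e1 e2]; subst.
by move: (ltn_trans h h2); rewrite ltnn.
Qed.

(** The degrees are summed over the component [C] of [v0] only, so the second odd vertex is found
    connected to the first. *)
Lemma handshake (T : finType) (e : rel T) (v0 : T) :
  symmetric e -> irreflexive e -> odd #|[set y | e v0 y]| ->
  exists v, [/\ v != v0, connect e v0 v & odd #|[set y | e v y]|].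
Proof.
move=> es ei h0.
pose C := [set v | connect e v0 v].
pose e' := [rel x y | e x y && (x \in C)].
have es' : symmetric e'.
  move=> x y /=; rewrite es; case eyx : (e y x) => //=; rewrite !inE.
  apply/idP/idP => h; apply: connect_trans h (connect1 _) => //.
  by rewrite es.
have ei' : irreflexive e' by move=> x /=; rewrite ei.
have := even_card_symmetric es' ei'.
have -> : #|[set p | e' p.1 p.2]| = \sum_(x in C) #|[set y | e x y]|.
  rewrite -sum1_card (eq_bigr (fun p => 1%N)) //.
  transitivity (\sum_(x in C) \sum_(y | e x y) 1)%N; last first.
    by apply: eq_bigr => x _; rewrite -sum1_card; apply: eq_bigl => y; rewrite inE.
  rewrite pair_big_dep /=; apply: eq_bigl => p; rewrite inE /= andbC //.
rewrite (bigD1 v0) ?inE ?connect0 //= oddD h0 /= negbK => /odd_sum[v].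
rewrite inE => /andP[cv nv] ov; by exists v; split.
Qed.

Lemma connect_inv (T : finType) (e : rel T) (I : T -> Prop) x y :
  (forall a b, e a b -> I a -> I b) -> connect e x y -> I x -> I y.
Proof.
move=> h /connectP[p pth ->] Ix; elim: p x pth Ix => [|a p IH] x //= /andP[exa pth] Ix.
exact: IH pth (h _ _ exa Ix).
Qed.

Section Climb.
Variables (g : nat -> int) (m : nat).
Hypothesis m_gt0 : 0 < m.
Hypothesis gs : forall i, i < m -> (g i.+1 = g i + 1 \/ g i.+1 = g i - 1)%R.
Hypothesis gm : forall i, i <= m -> (g i <= g 0)%R.
Hypothesis g0m : g m = g 0.

Let near (i j : 'I_m.+1) := (i.+1 == j :> nat) || (j.+1 == i :> nat).
Let U i := [set j : 'I_m.+1 | near i j && (g j == g i + 1)%R].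
Let W i := [set j : 'I_m.+1 | near i j && (g j == g i - 1)%R].

Let nearg i j : near i j -> (g j = g i + 1 \/ g j = g i - 1)%R.
Proof.
have lti := ltn_ord i; have ltj := ltn_ord j.
case/orP=> /eqP h; first by rewrite -h; apply: gs; lia.
by have := gs (i := j); rewrite h => /(_ _) []; lia.
Qed.

Let cardUW i : #|U i| + #|W i| = if (i == 0 :> nat) || (i == m :> nat) then 1 else 2.
Proof.
have -> : #|U i| + #|W i| = #|[set j | near i j]|.
  rewrite -cardsUI (_ : U i :&: W i = set0) ?cards0 ?addn0.
    apply: eq_card => j; rewrite !inE -andb_orr.
    case h : (near i j) => //=; case: (nearg h) => ->; rewrite eqxx ?orbT //.
  apply/setP => j; rewrite !inE; case h : (near i j) => //=.
  by apply/negbTE/negP => /andP[/eqP a /eqP b]; lia.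
have lti := ltn_ord i.
have lo (h : 0 < i) : {k : 'I_m.+1 | k = i.-1 :> nat}.
  have h' : i.-1 < m.+1 by lia.
  by exists (Ordinal h').
have hi (h : i < m) : {k : 'I_m.+1 | k = i.+1 :> nat}.
  have h' : i.+1 < m.+1 by lia.
  by exists (Ordinal h').
case: ifP => h.
  suff [k hk] : exists k, forall j, near i j = (j == k).
    by rewrite -(cards1 k); apply: eq_card => j; rewrite !inE hk.
  case: (posnP i) => [i0|ip].
    have [|k hk] := hi; first by lia.
    exists k => j; rewrite /near -val_eqE /=; have := ltn_ord j; lia.
  have [//|k hk] := lo.
  exists k => j; rewrite /near -val_eqE /=; have := ltn_ord j; lia.
have [|k1 hk1] := lo; first by lia.
have [|k2 hk2] := hi; first by lia.
have n12 : k1 != k2 by rewrite -val_eqE /= ; lia.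
transitivity #|[set k1; k2]|; last by rewrite cards2 n12.
apply: eq_card => j; rewrite !inE /near -!val_eqE /=; lia.
Qed.

Let e : rel ('I_m.+1 * 'I_m.+1) :=
  [rel p q : 'I_m.+1 * 'I_m.+1 | [&& g p.1 == g p.2, g q.1 == g q.2, near p.1 q.1 & near p.2 q.2]].

Let near_sym i j : near i j = near j i.
Proof. by rewrite /near orbC. Qed.

Let es : symmetric e.
Proof.
by move=> p q; rewrite /e /= (near_sym p.1) (near_sym p.2) andbCA.
Qed.

Let ei : irreflexive e.
Proof. by move=> p; rewrite /e /= /near; apply/negbTE; lia. Qed.

(** Two climbers at equal heights stay level only if both go up or both go down. *)
Let deg (i j : 'I_m.+1) : g i = g j -> #|[set q | e (i, j) q]| = #|U i| * #|U j| + #|W i| * #|W j|.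
Proof.
move=> gij; rewrite -!cardsX -cardsUI [X in _ + X](_ : _ = 0).
  rewrite addn0; apply: eq_card => -[a b]; rewrite /e !inE /= gij eqxx /=.
  case ha : (near i a); case hb : (near j b); rewrite ?andbF ?andbT //=.
  case: (nearg ha) => ->; case: (nearg hb) => ->; rewrite gij; lia.
apply/eqP; rewrite cards_eq0; apply/eqP/setP => -[a b]; rewrite !inE /=.
apply/negbTE/negP; lia.
Qed.

Let U_top (i : 'I_m.+1) : g i = g 0 -> #|U i| = 0.
Proof.
move=> h; apply/eqP; rewrite cards_eq0; apply/eqP/setP => j; rewrite !inE.
apply/negbTE/negP => /andP[_ /eqP hj]; have := gm (i := j); have := ltn_ord j; lia.
Qed.

(** An end of the range is at maximal height, so if just one climber is at an end, the other has no
    uphill and two downhill neighbours, and the degree is 2. If neither is at an end, each has as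
    many uphill as downhill neighbours modulo 2, so the two products in [deg] have the same
    parity. *)
Let odd_corner (i j : 'I_m.+1) : g i = g j -> odd #|[set q | e (i, j) q]| ->
  ((i == 0 :> nat) || (i == m :> nat)) && ((j == 0 :> nat) || (j == m :> nat)).
Proof.
move=> gij; rewrite deg //.
have := cardUW i; have := cardUW j.
have top (k : 'I_m.+1) : (k == 0 :> nat) || (k == m :> nat) -> g k = g 0.
  by case/orP => /eqP ->.
case: ifP => hj; case: ifP => hi //= cj ci.
- have Uj := U_top (top _ hj); have Ui := U_top (etrans gij (top _ hj)).
  by move: ci; rewrite Ui Uj add0n => ->; rewrite mul2n odd_double.
- have Ui := U_top (top _ hi); have Uj := U_top (etrans (esym gij) (top _ hi)).
  by move: cj; rewrite Ui Uj add0n => ->; rewrite muln2 odd_double.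
move: (congr1 odd ci) (congr1 odd cj); rewrite !oddD !oddM /=.
by case: (odd _); case: (odd _); case: (odd _); case: (odd _).
Qed.

Let par i : i <= m -> exists z : int, (g i = g 0 + i%:Z + 2 * z)%R.
Proof.
elim: i => [|i IH] h; first by exists 0%R; lia.
have [|z hz] := IH; first by lia.
by case: (gs h) => ->; [exists z | exists (z - 1)%R]; lia.
Qed.

(* In the graph of pairs of positions at equal heights, with both climbers moving
   one step, only the four corners have odd degree. So the corner at which the
   climbers start is joined to another corner, and they meet on the way. *)
Lemma climbers_meet : exists c : 'I_m.+1,
  connect [rel p q : 'I_m.+1 * 'I_m.+1 |
    [&& g p.1 == g p.2, g q.1 == g q.2, (p.1 <= p.2) && (q.1 <= q.2),
        near p.1 q.1 & near p.2 q.2]] (ord0, ord_max) (c, c).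
Proof.
set e' := [rel p q | _].
have es' : symmetric e'.
  move=> p q; rewrite /e' /= (near_sym p.1) (near_sym p.2) andbCA.
  by rewrite [(p.1 <= _) && _]andbC.
case: (pickP (fun c => connect e' (ord0, ord_max) (c, c))) => [c hc|nc]; first by exists c.
exfalso.
have inv p : connect e' (ord0, ord_max) p -> g p.1 = g p.2 /\ p.1 <= p.2.
  move=> h; apply: (connect_inv (I := fun p : 'I_m.+1 * 'I_m.+1 => g p.1 = g p.2 /\ p.1 <= p.2) _ h).
    by move=> x y /and5P[_ /eqP ? /andP[_ ?] _ _] _.
  by rewrite /= g0m.
have strict p : connect e' (ord0, ord_max) p -> p.1 < p.2.
  case: p => a b h; have [_ /= le] := inv _ h.
  rewrite ltn_neqAle le andbT; apply/negP => /eqP/val_inj ab.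
  by move: (nc b); rewrite -{1}ab h.
have ce p : connect e (ord0, ord_max) p -> connect e' (ord0, ord_max) p.
  move=> h; apply: (connect_inv (I := connect e' (ord0, ord_max)) _ h); last exact: connect0.
  move=> [x1 x2] [y1 y2] exy hx; apply: connect_trans (hx) (connect1 _).
  move: exy; rewrite /e /= => /and4P[h1 h2 h3 h4].
  rewrite /e' /= h1 h2 h3 h4 andbT /=; have := strict _ hx; have [gx lx] := inv _ hx => lt.
  (* Equal heights force positions of equal parity, so climbers that have not met are at least 2
     apart and cannot pass each other in one joint step. *)
  have [z1 p1] := par (ltn_ord x1); have [z2 p2] := par (ltn_ord x2).
  rewrite /= in lt lx gx p1 p2 h3 h4 *.
  have lt2 : x1 + 2 <= x2 by rewrite gx p2 in p1; lia.
  rewrite lx andbT; case/orP: h3 => /eqP h3; case/orP: h4 => /eqP h4; lia.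
have od : odd #|[set q | e (ord0, ord_max) q]|.
  rewrite deg ?g0m // U_top // U_top ?g0m //.
  have := cardUW ord0; have := cardUW ord_max; rewrite !U_top ?g0m //= eqxx orbT !add0n.
  by move=> -> ->.
have [[a b] [ne cv ov]] := handshake es ei od.
have cv' := ce _ cv; have lt := strict _ cv'; have [gab _] := inv _ cv'.
move: (odd_corner gab ov) ne lt; rewrite xpair_eqE -!val_eqE /=.
have := ltn_ord a; have := ltn_ord b; lia.
Qed.
End Climb.

(** * Balanced cyclic intervals *)

(* The positions [p] with [2 * p] between [i] and [j] modulo [m], for
   [i <= j <= i + m <= 2 * m]; the factor 2 leaves room to alternate between
   the two families being counted. *)
Definition arc_pos (m i j p : nat) : bool :=
  (2 * p < i) (+) (2 * p + m < i) (+) (2 * p < j) (+) (2 * p + m < j).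

Definition arc_step (N : nat) : rel ('I_N * 'I_N) :=
  [rel s t : 'I_N * 'I_N |
    (s.1 == t.1) && ((s.2.+1 == t.2 :> nat) || (t.2.+1 == s.2 :> nat)) ||
    (s.2 == t.2) && ((s.1.+1 == t.1 :> nat) || (t.1.+1 == s.1 :> nat))].

Section Balanced.
Variables (n : nat) (ya xa : pred nat).
Hypothesis n_gt0 : 0 < n.
Let Ky := \sum_(p < n) ya p.
Let Kx := \sum_(p < n) xa p.
Hypothesis le_xy : Kx <= Ky.

(** Exchanging the marks inside the arc turns the counts [Kx], [Ky] into [Kx - xP + yP] and
    [Ky - yP + xP]; the two inequalities say that both stay at least [Kx - 1]. *)
Definition arc_balanced (m i j : nat) : bool :=
  let yP := \sum_(p < n | arc_pos m i j p) ya p in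
  let xP := \sum_(p < n | arc_pos m i j p) xa p in
  (xP <= yP + 1) && (Kx + yP <= Ky + xP + 1).

Let D := Ky - Kx.
(** The period of the height profile: [2 * n] steps for the marks, which raise it by [2 * D] in
    total, and then [2 * D] descending steps of padding, which close it up. *)
Let m := 2 * n + 2 * D.
Let b2z (b : bool) : int := (nat_of_bool b)%:Z.
Local Open Scope ring_scope.

Let at_ (h : nat -> int) (c t : nat) : int := \sum_(p < n) h p * b2z (2 * p + c == t)%N.
Let below (h : nat -> int) (c t : nat) : int := \sum_(p < n) h p * b2z (2 * p + c < t)%N.

Lemma belowS h c t : below h c t.+1 = below h c t + at_ h c t.
Proof.
rewrite /below /at_ -big_split /=; apply: eq_bigr => p _; rewrite -mulrDr.
by congr (_ * _); rewrite /b2z; lia.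
Qed.

Lemma at_hit h c (p : 'I_n) : at_ h c (2 * p + c) = h p.
Proof.
rewrite /at_ (bigD1 p) //= /b2z eqxx mulr1 big1 ?addr0 // => i ne.
by rewrite eqn_add2r eqn_mul2l /= val_eqE (negbTE ne) mulr0.
Qed.

Lemma at_miss h c t : (forall p, (p < n)%N -> (2 * p + c != t)%N) -> at_ h c t = 0.
Proof.
by move=> ne; apply: big1 => p _; rewrite /b2z (negbTE (ne p (ltn_ord p))) mulr0.
Qed.

Lemma at_cases h c t :
  at_ h c t = 0 \/ exists p : 'I_n, t = (2 * p + c)%N /\ at_ h c t = h p.
Proof.
case: (pickP (fun p : 'I_n => 2 * p + c == t)%N) => [p /eqP <-|ne].
  by right; exists p; rewrite at_hit.
by left; apply: at_miss => p lt; rewrite (ne (Ordinal lt)).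
Qed.

Let sy p : int := if ya p then 1 else -1.
Let sx p : int := if xa p then -1 else 1.
Let dm (t : nat) : nat := minn (t - 2 * n) (2 * D) + (t - (m + 2 * n)).
(** The profile over two periods, the second entering through the offsets [m] and [m.+1]. Position
    [p] contributes a step for [ya] at time [2 * p] and one for [xa] at [2 * p + 1], together
    [2 * (ya p - xa p)]; [dm] counts the padding steps. Splitting each change into two unit steps is
    what makes mountain climbing applicable. *)
Let g (t : nat) : int :=
  below sy 0 t + below sx 1 t + below sy m t + below sx m.+1 t - (dm t)%:Z.

Lemma sy_pm1 p : sy p = 1 \/ sy p = -1.
Proof. by rewrite /sy; case: ifP; [left|right]. Qed.
Lemma sx_pm1 p : sx p = 1 \/ sx p = -1.
Proof. by rewrite /sx; case: ifP; [right|left]. Qed.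

Lemma profile_step t : (t < 2 * m)%N -> g t.+1 = g t + 1 \/ g t.+1 = g t - 1.
Proof.
move=> lt; have two : (2 * n <= m)%N by rewrite /m leq_addr.
have step s0 s1 s2 s3 e : at_ sy 0 t = s0 -> at_ sx 1 t = s1 -> at_ sy m t = s2 ->
    at_ sx m.+1 t = s3 -> dm t.+1 = (dm t + e)%N ->
    s0 + s1 + s2 + s3 - e%:Z = 1 \/ s0 + s1 + s2 + s3 - e%:Z = -1 ->
    g t.+1 = g t + 1 \/ g t.+1 = g t - 1.
  move=> e0 e1 e2 e3 ed; rewrite /g !belowS e0 e1 e2 e3 ed PoszD.
  by move: (below _ 0 t) (below _ 1 t) (below _ m t) (below _ m.+1 t) => *; lia.
have miss h c : (forall p, (p < n)%N -> (2 * p + c != t)%N) -> at_ h c t = 0 by apply: at_miss.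
have dmE e : (e = ((2 * n <= t) && (t < m)) || (m + 2 * n <= t) :> nat)%N -> dm t.+1 = (dm t + e)%N.
  by move=> ->; rewrite /dm /m; lia.
have [h1|h1] := ltnP t (2 * n).
  have [q [eq|eq]] : exists q : 'I_n, t = (2 * q + 0)%N \/ t = (2 * q + 1)%N.
    have h : (t./2 < n)%N by lia.
    by exists (Ordinal h) => /=; lia.
  - apply: (step (sy q) 0 0 0 0%N); rewrite ?eq ?at_hit // -?eq; try by apply: miss; lia.
      by apply: dmE; lia.
    by case: (sy_pm1 q) => ->; [left|right].
  apply: (step 0 (sx q) 0 0 0%N); rewrite ?eq ?at_hit // -?eq; try by apply: miss; lia.
    by apply: dmE; lia.
  by case: (sx_pm1 q) => ->; [left|right].
have [h2|h2] := ltnP t m.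
  apply: (step 0 0 0 0 1%N); try by apply: miss; lia.
    by apply: dmE; lia.
  by right.
have [h3|h3] := ltnP t (m + 2 * n).
  have [q [eq|eq]] : exists q : 'I_n, t = (2 * q + m)%N \/ t = (2 * q + m.+1)%N.
    have h : ((t - m)./2 < n)%N by move: (m) h2 h3 => k; lia.
    by exists (Ordinal h) => /=; move: (m) h2 h3 => k; lia.
  - apply: (step 0 0 (sy q) 0 0%N); rewrite ?eq ?at_hit // -?eq; try by apply: miss; lia.
      by apply: dmE; lia.
    by case: (sy_pm1 q) => ->; [left|right].
  apply: (step 0 0 0 (sx q) 0%N); rewrite ?eq ?at_hit // -?eq; try by apply: miss; lia.
    by apply: dmE; lia.
  by case: (sx_pm1 q) => ->; [left|right].
apply: (step 0 0 0 0 1%N); try by apply: miss; lia.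
  by apply: dmE; lia.
by right.
Qed.

Lemma below_all h c t : (2 * n + c <= t.+1)%N -> below h c t = \sum_(p < n) h p.
Proof.
move=> le1; apply: eq_bigr => p _; have := ltn_ord p => ltp.
rewrite (_ : (2 * p + c < t)%N = true) ?mulr1 //; lia.
Qed.

Lemma below_none h c t : (t <= c)%N -> below h c t = 0.
Proof.
move=> le1; rewrite /below big1 // => p _.
rewrite (_ : (2 * p + c < t)%N = false) ?mulr0 //; lia.
Qed.

Lemma below_shift h c t : below h (c + m) (t + m) = below h c t.
Proof. by apply: eq_bigr => p _; rewrite addnA ltn_add2r. Qed.

Lemma b2z_sum (a : pred nat) : \sum_(p < n) b2z (a p) = (\sum_(p < n) a p)%N%:Z.
Proof. by rewrite (big_morph Posz PoszD (erefl _)). Qed.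

Lemma steps_total : \sum_(p < n) sy p + \sum_(p < n) sx p = (2 * D)%N%:Z.
Proof.
have -> : \sum_(p < n) sy p + \sum_(p < n) sx p =
   2 * (\sum_(p < n) b2z (ya p) - \sum_(p < n) b2z (xa p)).
  rewrite -sumrB -big_split mulr_sumr /=; apply: eq_bigr => p _.
  by rewrite /sy /sx /b2z; case: (ya p); case: (xa p).
by rewrite !b2z_sum -/Ky -/Kx /D; lia.
Qed.

Lemma profile_period t : (t <= m)%N -> g (t + m) = g t.
Proof.
move=> le; rewrite /g.
rewrite [below sy 0 (t + m)]below_all; last by rewrite /m; lia.
rewrite [below sx 1 (t + m)]below_all; last by rewrite /m; lia.
rewrite (below_shift sy 0) (below_shift sx 1).
rewrite [below sy m t]below_none // [below sx m.+1 t]below_none; last by lia.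
have -> : dm (t + m) = (2 * D + dm t)%N by rewrite /dm /m in le *; lia.
rewrite steps_total; lia.
Qed.

Let w p : int := if xa p then 1 else -1.

(** At a time between the two half-steps of a position, the counts on the right already include its
    mark in [xa], but the profile does not; [w] makes up the difference. *)
Lemma profile_count t : g t = 2 * (below (b2z \o ya) 0 t + below (b2z \o ya) m t)
   - 2 * (below (b2z \o xa) 0 t + below (b2z \o xa) m t) - (dm t)%:Z
   + at_ w 1 t + at_ w m.+1 t.
Proof.
rewrite /g.
suff E c : below sy c t + below sx c.+1 t = 2 * below (b2z \o ya) c t
    - 2 * below (b2z \o xa) c t + at_ w c.+1 t.
  have := E 0%N; have := E m; lia.
rewrite /below /at_ !mulr_sumr -sumrB -!big_split /=; apply: eq_bigr => p _.
have -> : (2 * p + c.+1 == t)%N = (2 * p + c < t)%N && ~~ (2 * p + c.+1 < t)%N by lia.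
have : (2 * p + c.+1 < t)%N -> (2 * p + c < t)%N by lia.
rewrite /sy /sx /w /b2z.
by case: (ya p); case: (xa p); case: (2 * p + c < t)%N; case: (2 * p + c.+1 < t)%N => // h;
  have := h isT.
Qed.

Lemma half_step_le t : `|at_ w 1 t + at_ w m.+1 t| <= 1.
Proof.
have w1 p : w p = 1 \/ w p = -1 by rewrite /w; case: ifP; [left|right].
case: (at_cases w 1 t) => [->|[p [ep ->]]]; case: (at_cases w m.+1 t) => [->|[p' [ep' ->]]] //.
- by case: (w1 p') => ->.
- by case: (w1 p) => ->.
by have := ltn_ord p; rewrite /m in ep'; lia.
Qed.

Let A (a : pred nat) (t : nat) : int := below (b2z \o a) 0 t + below (b2z \o a) m t.

Lemma count_arc (a : pred nat) i j : (i <= j)%N -> (j <= i + m)%N -> (j <= 2 * m)%N ->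
  (\sum_(p < n | arc_pos m i j p) a p)%N%:Z = A a j - A a i.
Proof.
move=> ij ji j2; rewrite (big_morph Posz PoszD (erefl _)) /A /below -!big_split -sumrB /=.
rewrite big_mkcond /=; apply: eq_bigr => p _; have := ltn_ord p => ltp.
rewrite /arc_pos !addn0.
have h1 : (2 * p < i)%N -> (2 * p < j)%N by lia.
have h2 : (2 * p + m < i)%N -> (2 * p + m < j)%N by lia.
have h3 : (2 * p + m < i)%N -> (2 * p < i)%N by lia.
have h4 : (2 * p + m < j)%N -> (2 * p < j)%N by lia.
have h5 : (2 * p + m < j)%N -> (2 * p < i)%N by lia.
move: h1 h2 h3 h4 h5; rewrite /b2z.
case: (2 * p < i)%N; case: (2 * p + m < i)%N; case: (2 * p < j)%N; case: (2 * p + m < j)%N;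
  case: (a p) => //= h1 h2 h3 h4 h5.
all: try by [have := h1 isT | have := h2 isT | have := h3 isT| have := h4 isT | have := h5 isT].
Qed.

(** By [profile_count], [2 * (yP - xP)] is the difference of heights, plus the padding met on the
    way, which lies between 0 and [2 * D], plus two half-step corrections. The errors add up to at
    most 3, and halving leaves the slack 1 in [arc_balanced]. *)
Lemma balanced_arc i j : (i <= j)%N -> (j <= i + m)%N -> (j <= 2 * m)%N ->
  `|g i - g j| <= 1 -> arc_balanced m i j.
Proof.
move=> ij ji j2 gij; rewrite /arc_balanced.
set yP := (\sum_(p < n | _) ya p)%N; set xP := (\sum_(p < n | _) xa p)%N.
have hy : yP%:Z = A ya j - A ya i by apply: count_arc.
have hx : xP%:Z = A xa j - A xa i by apply: count_arc.
move: gij; rewrite !profile_count -/(A ya i) -/(A ya j) -/(A xa i) -/(A xa j).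
have ei := half_step_le i; have ej := half_step_le j.
have hd : (dm i <= dm j <= dm i + 2 * D)%N by rewrite /dm /m in ji j2 *; lia.
move: hd hy hx ei ej; rewrite /D; lia.
Qed.

(** End points of arcs run up to [2 * m], which is at most [8 * n] because [D <= n]. *)
Notation N := (8 * n).+1.

(** The climbers start one period apart at a maximum [r] of the profile, as [climbers_meet]
    requires. Read backwards, their walk opens an empty arc at the meeting point and widens it to a
    full turn. *)
Lemma balanced_arcs : exists (M : 'I_N) (s t : 'I_N * 'I_N),
  [/\ (2 * n <= M)%N, forall p, (p < n)%N -> ~~ arc_pos M s.1 s.2 p,
      forall p, (p < n)%N -> arc_pos M t.1 t.2 p
    & connect [rel u v : 'I_N * 'I_N |
        [&& arc_step u v, arc_balanced M u.1 u.2 & arc_balanced M v.1 v.2]] s t].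
Proof.
have DleN : (D <= n)%N.
  suff : (Ky <= n)%N by rewrite /D; lia.
  apply: leq_trans (_ : \sum_(p < n) 1 <= _)%N; last by rewrite sum1_card card_ord.
  by apply: leq_sum => p _; case: (ya p).
have m0 : (0 < m)%N by rewrite /m; lia.
have mN : (m < N)%N by rewrite /m; lia.
have [r hr] : exists r : 'I_m.+1, forall i : 'I_m.+1, g i <= g r.
  case: (@arg_maxP _ _ _ (ord0 : 'I_m.+1) predT (fun i : 'I_m.+1 => g i)) => // r _ h.
  by exists r => i; apply: h.
have ltr := ltn_ord r.
have gper i : (i <= m)%N -> g (r + i) <= g r.
  move=> ltm; have [h|h] := leqP (r + i) m.
    by apply: (hr (Ordinal (_ : (r + i < m.+1)%N))).
  rewrite (_ : (r + i = (r + i - m) + m)%N); last by lia.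
  rewrite profile_period; last by lia.
  by have h' : (r + i - m < m.+1)%N by [lia]; apply: (hr (Ordinal h')).
have [i lt|i le||c] := @climbers_meet (fun i => g (r + i)%N) m m0.
- by rewrite addnS; apply: profile_step; lia.
- by rewrite addn0; apply: gper.
- by rewrite addn0 profile_period //; lia.
move=> hc.
have ltS (i : nat) : (i <= 2 * m)%N -> (i < N)%N by rewrite /m; lia.
pose emb (i : 'I_m.+1) : 'I_N := inord (r + i).
have embE i : emb i = (r + i)%N :> nat.
  by rewrite inordK //; apply: ltS; have := ltn_ord i; lia.
exists (Ordinal mN), (emb c, emb c), (emb ord0, emb ord_max); split => /=.
- by rewrite /m leq_addr.
- by move=> p ltp; rewrite /arc_pos; case: (_ < _)%N; case: (_ < _)%N.
- move=> p ltp; rewrite /arc_pos !embE /= addn0.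
  have hm : (2 * n <= m)%N by rewrite /m leq_addr.
  have h2 : (2 * p < r + m)%N by lia.
  have h3 : (2 * p + m < r)%N = false by lia.
  have h4 : (2 * p + m < r + m)%N = (2 * p < r)%N by lia.
  by rewrite h2 h3 h4; case: (_ < _)%N.
set R := [rel u v | _].
have gnear (i j : 'I_m.+1) : (i.+1 == j :> nat) || (j.+1 == i :> nat) ->
    `|g (r + i) - g (r + j)| <= 1.
  have ltj := ltn_ord j; have lti := ltn_ord i.
  case/orP => /eqP h.
    by have := @profile_step (r + i)%N; rewrite -h addnS => /(_ ltac:(lia)); lia.
  by have := @profile_step (r + j)%N; rewrite -h addnS => /(_ ltac:(lia)); lia.
have bal (i j : 'I_m.+1) : (i <= j)%N -> `|g (r + i) - g (r + j)| <= 1 ->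
    arc_balanced m (emb i) (emb j).
  by have ltj := ltn_ord j; move=> ij h; rewrite !embE; apply: balanced_arc h; lia.
apply: (connect_inv (I := fun p : 'I_m.+1 * 'I_m.+1 =>
   connect R (emb p.1, emb p.2) (emb ord0, emb ord_max)) _ hc); last exact: connect0.
move=> [p1 p2] [q1 q2] /= /and5P[/eqP gp /eqP gq /andP[lp lq] n1 n2] IH.
have bp : arc_balanced m (emb p1) (emb p2) by apply: bal => //; rewrite gp subrr.
have bq : arc_balanced m (emb q1) (emb q2) by apply: bal => //; rewrite gq subrr.
have st (i j k : 'I_m.+1) : (j.+1 == k :> nat) || (k.+1 == j :> nat) ->
    arc_step (emb i, emb j) (emb i, emb k) /\ arc_step (emb j, emb i) (emb k, emb i).
  by move=> h; rewrite /arc_step /= !eqxx !embE /= -!addnS !eqn_add2l h orbT.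
have n1' : (q1.+1 == p1 :> nat) || (p1.+1 == q1 :> nat) by rewrite orbC.
have n2' : (q2.+1 == p2 :> nat) || (p2.+1 == q2 :> nat) by rewrite orbC.
(* A joint move is split into two moves of a single end point. The intermediate arc is chosen with
   its ends still in order; their heights differ by at most 1, which [balanced_arc] tolerates. *)
have [h|h] := leqP p1 q2.
  have b : arc_balanced m (emb p1) (emb q2) by apply: bal => //; rewrite gp; apply: gnear.
  apply: connect_trans IH; apply: (connect_trans (y := (emb p1, emb q2))); apply: connect1.
    by rewrite /R /= bq b (st q2 q1 p1 n1').2.
  by rewrite /R /= bp b (st p1 q2 p2 n2').1.
have b : arc_balanced m (emb q1) (emb p2) by apply: bal; [lia | rewrite gq; apply: gnear].
apply: connect_trans IH; apply: (connect_trans (y := (emb q1, emb p2))); apply: connect1.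
  by rewrite /R /= bq b (st q1 q2 p2 n2').1.
by rewrite /R /= bp b (st p2 q1 p1 n1').2.
Qed.
End Balanced.

(** * Balls and hybrid partitions *)

Lemma card_bigcup_le (I T : finType) (A : {pred I}) (F : I -> {set T}) m :
  (forall i, #|F i| <= m) -> #|\bigcup_(i in A) F i| <= #|A| * m.
Proof.
move=> h; rewrite -sum_nat_const; elim/big_rec2: _ => [|i k S _ kS]; first by rewrite cards0.
by apply: leq_trans (leq_card_setU _ _) _; rewrite leq_add.
Qed.

Section Ball.
Variable G : sgraph.

Definition expand (S : {set G}) : {set G} :=
  S :|: \bigcup_(w in S) [set u | adj w u].

Definition ball (r : nat) (v : G) : {set G} := iter r expand [set v].

Lemma ballSP r v u :
  reflect (u \in ball r v \/ exists2 w, w \in ball r v & adj w u) (u \in ball r.+1 v).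
Proof.
rewrite /= /expand inE; apply: (iffP orP) => -[h|h]; try by left.
  by case/bigcupP: h => w wb; rewrite inE => a; right; exists w.
by case: h => w wb a; right; apply/bigcupP; exists w; rewrite ?inE.
Qed.

Lemma ball_leq r r' v : r <= r' -> ball r v \subset ball r' v.
Proof.
move=> /subnKC <-; elim: (r' - r) => [|k IH]; first by rewrite addn0.
apply: subset_trans IH _; rewrite addnS; apply/subsetP => u h.
by apply/ballSP; left.
Qed.

Lemma ball_trans a b u v w : u \in ball a v -> w \in ball b u -> w \in ball (a + b) v.
Proof.
move=> uv; elim: b w => [|b IH] w; first by rewrite addn0 inE => /eqP ->.
case/ballSP => [/IH h|[z /IH h zw]]; rewrite addnS; apply/ballSP; first by left.
by right; exists z.
Qed.

Lemma ball_sym r u v : (u \in ball r v) = (v \in ball r u).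
Proof.
suff h a b : a \in ball r b -> b \in ball r a by apply/idP/idP; apply: h.
elim: r a b => [|r IH] a b; first by rewrite !inE eq_sym.
case/ballSP => [/IH h|[w wb wa]]; first by apply/ballSP; left.
rewrite -add1n; apply: (ball_trans (u := w)); last exact: IH.
by apply/ballSP; right; exists a; rewrite ?inE // adj_sym.
Qed.

Lemma card_ball D r v : max_degree_le G D -> #|ball r v| <= D.+1 ^ r.
Proof.
move=> hD; elim: r => [|r IH]; first by rewrite cards1.
rewrite expnS mulSn; apply: leq_trans (_ : #|ball r v| + D * #|ball r v| <= _); last first.
  by rewrite leq_add // leq_mul2l IH orbT.
rewrite /= /expand -/(ball r v); apply: leq_trans (leq_card_setU _ _) _.
by rewrite leq_add2l mulnC; apply: card_bigcup_le.
Qed.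

(** A path without repeated vertices inside [A] has fewer than [#|A|] edges. *)
Lemma connected_in_ball (A : {set G}) B u v :
  connected_in A -> #|A| <= B -> u \in A -> v \in A -> v \in ball B u.
Proof.
move=> cA AB uA vA.
have /connectP[p0 pth0 e0] := implyP (forallP (implyP (forallP cA u) uA) v) vA.
case/shortenP: pth0 e0 => p pth un _ ev.
have pA : {subset u :: p <= A}.
  move=> w; rewrite inE => /orP[/eqP -> //|].
  elim: (p) (u) pth => [|a q IH] b //= /andP[/and3P[_ _ aA] pq].
  by rewrite inE => /orP[/eqP -> //|]; apply: IH pq.
have sz : size p < #|A|.
  by rewrite -[(size p).+1]/(size (u :: p)) -(card_uniqP un); apply/subset_leq_card/subsetP.
apply: (subsetP (ball_leq _ (leq_trans (ltnW sz) AB))).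
rewrite ev {sz pA un ev cA AB uA vA}.
elim/last_ind: p pth => [|p w IH] /=; first by rewrite inE.
rewrite rcons_path last_rcons size_rcons => /andP[/IH h /and3P[a _ _]].
by apply/ballSP; right; exists (last u p).
Qed.
End Ball.

Section Hybrid.
Variables (G : sgraph) (B : nat).
Implicit Types (x y : {set {set G}}) (P : {set G}).

(** Membership in [Omega] without the limit on the number of classes, which hybrids may exceed. *)
Definition valid x : bool :=
  [&& partition x [set: G], contiguous x & bounded B x].

Lemma OmegaE q x : (x \in Omega G q B) = valid x && (#|x| <= q).
Proof.
by rewrite inE /is_qpartition /valid; case: partition => //=; rewrite andbC.
Qed.

Lemma valid_pblock x v : valid x -> pblock x v \in x.
Proof. by case/and3P => /and3P[/eqP cx _ _] _ _; rewrite pblock_mem // cx inE. Qed.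

Lemma mem_valid_pblock x v : valid x -> v \in pblock x v.
Proof. by case/and3P => /and3P[/eqP cx _ _] _ _; rewrite mem_pblock cx inE. Qed.

Lemma valid_trivIset x : valid x -> trivIset x.
Proof. by case/and3P => /and3P[]. Qed.

Lemma pblock_mem_sym x u v : valid x -> (v \in pblock x u) = (u \in pblock x v).
Proof.
move=> vx; have tx := valid_trivIset vx.
by rewrite -!eq_pblock ?(eq_sym (pblock x v)) //; case/and3P: vx => /and3P[/eqP-> _ _] _ _; rewrite inE.
Qed.

Lemma pblock_eqP x u v : valid x -> reflect (pblock x u = pblock x v) (v \in pblock x u).
Proof.
move=> vx; rewrite -eq_pblock ?valid_trivIset //; first exact: eqP.
by case/and3P: vx => /and3P[/eqP-> _ _] _ _; rewrite inE.
Qed.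

Lemma valid_connected x u : valid x -> connected_in (pblock x u).
Proof. by move=> vx; case/and3P: (vx) => _ /forall_inP h _; apply/h/valid_pblock. Qed.

Lemma pblock_ball x u : valid x -> pblock x u \subset ball B u.
Proof.
move=> vx; apply/subsetP => v h.
apply: connected_in_ball (valid_connected u vx) _ (mem_valid_pblock u vx) h.
by case/and3P: (vx) => _ _ /forall_inP; apply; apply: valid_pblock.
Qed.

Lemma valid_blockP x C : valid x -> C \in x -> exists2 u, u \in C & C = pblock x u.
Proof.
move=> vx Cx; have [C0|[u uC]] := set_0Vmem C.
  by case/and3P: vx => /and3P[_ _ /negP[]]; rewrite -C0.
by exists u => //; rewrite (def_pblock (valid_trivIset vx) Cx uC).
Qed.

Definition in_block x : rel G := [rel u v | adj u v && (v \in pblock x u)].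

Lemma connect_in_block x u v : valid x -> connect (in_block x) u v = (v \in pblock x u).
Proof.
move=> vx; apply/idP/idP => h.
  apply: (connect_inv (I := fun w => w \in pblock x u) _ h); last exact: mem_valid_pblock.
  move=> a b /andP[_ hab] ha; move/(pblock_eqP _ _ vx): ha => ->; exact: hab.
have := implyP (forallP (implyP (forallP (valid_connected u vx) u) (mem_valid_pblock u vx)) v) h.
apply: connect_sub => a b /and3P[ab ha hb]; apply: connect1; rewrite /in_block /= ab /=.
by move/(pblock_eqP _ _ vx): ha => <-.
Qed.

Definition hybrid_edge P x y : rel G :=
  [rel u v | [&& adj u v, (u \in P) == (v \in P) & v \in pblock (if u \in P then y else x) u]].

Definition hybrid P x y : {set {set G}} :=
  equivalence_partition (connect (hybrid_edge P x y)) [set: G].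

Lemma valid_if (b : bool) x y : valid x -> valid y -> valid (if b then y else x).
Proof. by case: b. Qed.

Section Fixed.
Variables (x y : {set {set G}}) (vx : valid x) (vy : valid y).

Lemma hybrid_edge_sym P : symmetric (hybrid_edge P x y).
Proof.
move=> u v; rewrite /hybrid_edge /= adj_sym eq_sym; case: adj => //=; case: eqP => //= ->.
by rewrite pblock_mem_sym //; case: ifP.
Qed.

Let equiv P : {in [set: G] & &, equivalence_rel (connect (hybrid_edge P x y))}.
Proof.
have cs := sym_connect_sym (hybrid_edge_sym P).
by move=> a b c _ _ _; split; [exact: connect0|move=> h; apply: same_connect].
Qed.

Lemma hybrid_pblock P u v : (v \in pblock (hybrid P x y) u) = connect (hybrid_edge P x y) u v.
Proof. by rewrite pblock_equivalence_partition ?inE. Qed.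

Lemma hybrid_partition P : partition (hybrid P x y) [set: G].
Proof. exact: equivalence_partitionP. Qed.

Lemma hybrid_connect P u v : connect (hybrid_edge P x y) u v ->
  (u \in P) = (v \in P) /\ v \in pblock (if u \in P then y else x) u.
Proof.
move=> h; apply: (connect_inv (I := fun v => (u \in P) = (v \in P) /\
  v \in pblock (if u \in P then y else x) u) _ h); last first.
  by split => //; apply: mem_valid_pblock; case: ifP.
move=> a b /and3P[_ /eqP <- hb] [e ha]; split=> //; move: hb; rewrite -e.
have vz := valid_if (u \in P) vx vy.
by move/(pblock_eqP _ _ vz): ha => <-.
Qed.

Lemma hybrid_valid P : valid (hybrid P x y).
Proof.
have pt := hybrid_partition P; case/and3P: (pt) => /eqP cv tr n0.
have blk C : C \in hybrid P x y -> exists2 u, u \in C & C = pblock (hybrid P x y) u.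
  move=> hC; have [C0|[u uC]] := set_0Vmem C; first by rewrite -C0 hC in n0.
  by exists u => //; rewrite (def_pblock tr hC uC).
rewrite /valid pt /=; apply/andP; split; apply/forall_inP => C /blk [w wC eC].
  apply/forall_inP => u; rewrite {1}eC hybrid_pblock => wu.
  apply/forall_inP => v; rewrite {1}eC hybrid_pblock => wv.
  have uv : connect (hybrid_edge P x y) u v.
    by apply: connect_trans wv; rewrite (sym_connect_sym (hybrid_edge_sym P)).
  have : connect (hybrid_edge P x y) w u by [].
  case/connectP: uv => p; elim: p u {wu wv} => [|a p IH] u /= ; first by move=> _ ->.
  case/andP=> ua pth ev wu.
  have wa := connect_trans wu (connect1 ua).
  apply: connect_trans (connect1 _) (IH _ pth ev wa).
  by rewrite /= {1 2}eC !hybrid_pblock wu wa; case/and3P: ua => ->.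
apply: leq_trans (_ : #|pblock (if w \in P then y else x) w| <= B).
  by apply/subset_leq_card/subsetP => v; rewrite eC hybrid_pblock => /hybrid_connect[].
have vz := valid_if (w \in P) vx vy.
by case/and3P: (vz) => _ _ /forall_inP; apply; apply: valid_pblock.
Qed.

(** A hybrid class lies inside one block of its source, so off the cut the hybrid shows faithfully
    which edges the source joins. *)
Lemma hybrid_edge_mem P u v : adj u v -> (u \in P) = (v \in P) ->
  (v \in pblock (hybrid P x y) u) = (v \in pblock (if u \in P then y else x) u).
Proof.
move=> a e; rewrite hybrid_pblock; apply/idP/idP => [/hybrid_connect[]//|h].
by apply: connect1; rewrite /hybrid_edge /= a e eqxx -e.
Qed.

Lemma hybrid0 : hybrid set0 x y = x.
Proof.
have vh := hybrid_valid set0.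
suff e u : pblock (hybrid set0 x y) u = pblock x u.
  apply/setP => C; apply/idP/idP => h.
    have [u _ ->] := valid_blockP vh h.
    by rewrite e valid_pblock.
  by have [u _ ->] := valid_blockP vx h; rewrite -e valid_pblock.
apply/setP => v; rewrite hybrid_pblock -connect_in_block //.
by apply: eq_connect => a b; rewrite /hybrid_edge /in_block /= !inE eqxx.
Qed.

Lemma hybridT : hybrid [set: G] x y = y.
Proof.
have vh := hybrid_valid [set: G].
suff e u : pblock (hybrid [set: G] x y) u = pblock y u.
  apply/setP => C; apply/idP/idP => h.
    have [u _ ->] := valid_blockP vh h.
    by rewrite e valid_pblock.
  by have [u _ ->] := valid_blockP vy h; rewrite -e valid_pblock.
apply/setP => v; rewrite hybrid_pblock -connect_in_block //.
by apply: eq_connect => a b; rewrite /hybrid_edge /in_block /= !inE eqxx.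
Qed.
End Fixed.

Lemma valid_eq x x' : valid x -> valid x' ->
  (forall u v, adj u v -> (v \in pblock x u) = (v \in pblock x' u)) -> x = x'.
Proof.
move=> vx vx' h.
suff e u : pblock x u = pblock x' u.
  apply/setP => C; apply/idP/idP => hC.
    by have [u _ ->] := valid_blockP vx hC; rewrite e valid_pblock.
  by have [u _ ->] := valid_blockP vx' hC; rewrite -e valid_pblock.
apply/setP => v; rewrite -!connect_in_block //.
by apply: eq_connect => a b; rewrite /in_block /=; case ab: adj => //=; apply: h.
Qed.

Definition cut_pairs P : {set G * G} := [set e | adj e.1 e.2 && ((e.1 \in P) != (e.2 \in P))].
Definition joined x : {set G * G} := [set e | e.2 \in pblock x e.1].

(** A contiguous partition is determined by the edges that it joins ([valid_eq]). An edge off the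
    cut is shown for [x] by one hybrid and for [y] by the other; the edges on the cut are supplied
    by the last two hypotheses. *)
Lemma hybrid_inj P x y x' y' : valid x -> valid y -> valid x' -> valid y' ->
  hybrid P x y = hybrid P x' y' -> hybrid P y x = hybrid P y' x' ->
  cut_pairs P :&: joined x = cut_pairs P :&: joined x' ->
  cut_pairs P :&: joined y = cut_pairs P :&: joined y' ->
  x = x' /\ y = y'.
Proof.
move=> vx vy vx' vy' h1 h2 c1 c2.
split; apply: valid_eq => // u v uv; case: (eqVneq (u \in P) (v \in P)) => e.
- have := hybrid_edge_mem vx vy uv e; have := hybrid_edge_mem vy vx uv e.
  by rewrite h1 h2 !hybrid_edge_mem //; case: ifP => _ a b.
- by move/setP/(_ (u, v)): c1; rewrite !inE /= uv e.
- have := hybrid_edge_mem vx vy uv e; have := hybrid_edge_mem vy vx uv e.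
  by rewrite h1 h2 !hybrid_edge_mem //; case: ifP => _ a b.
by move/setP/(_ (u, v)): c2; rewrite !inE /= uv e.
Qed.

Section Locality.
Variables (x y : {set {set G}}) (vx : valid x) (vy : valid y).

(** A source block that avoids [v] is divided alike by [P] and [P']. A class that disappears
    therefore comes from the source block of [v], which lies in the ball. *)
Lemma hybrid_local P P' v C : (forall u, u != v -> (u \in P) = (u \in P')) ->
  C \in hybrid P x y -> C \notin hybrid P' x y -> C \subset ball B v.
Proof.
move=> hP hC; have [u uC eC] := valid_blockP (hybrid_valid vx vy P) hC.
pose z := if u \in P then y else x; have vz : valid z by apply: valid_if.
have Cz : C \subset pblock z u.
  by apply/subsetP => w; rewrite eC hybrid_pblock // => /hybrid_connect[].
case hv: (v \in pblock z u).
  move=> _; apply: subset_trans Cz _.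
  by move/(pblock_eqP _ _ vz): hv => ->; apply: pblock_ball.
case/negP; have nv w : w \in pblock z u -> w != v by apply: contraTneq => ->; rewrite hv.
suff -> : C = pblock (hybrid P' x y) u by apply/valid_pblock/hybrid_valid.
rewrite eC; apply/setP => w; rewrite !hybrid_pblock //; apply/idP/idP => h.
  case/connectP: h => p; have: connect (hybrid_edge P x y) u u by [].
  elim: p {2 3 4 5}u => [|a p IH] b hb /=; first by move=> _ ->.
  case/andP=> ba pth ew; have ha := connect_trans hb (connect1 ba).
  apply: connect_trans (connect1 _) (IH _ ha pth ew).
  have [_ /nv nb] := hybrid_connect vx vy hb; have [_ /nv na] := hybrid_connect vx vy ha.
  by case/and3P: ba => h1 h2 h3; rewrite /hybrid_edge /= h1 -!hP // h2.
apply: (connect_inv (I := connect (hybrid_edge P x y) u) _ h); last exact: connect0.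
move=> a b ab ha; apply: connect_trans (ha) (connect1 _).
have [ea hz] := hybrid_connect vx vy ha; have na := nv _ hz.
case/and3P: ab => h1 h2; rewrite -(hP a na) -ea => h3.
have nb : b != v.
  by apply: nv; move/(pblock_eqP _ _ vz): hz => ->.
by rewrite /hybrid_edge /= h1 -ea h3 andbT; move: h2; rewrite -!hP // -ea.
Qed.
End Locality.

Section Count.
Variable s : G -> nat.
Hypothesis s_inj : injective s.

(** One representative per class turns the number of classes into a sum of marks over positions, the
    form in which arcs are balanced. *)
Definition first_in x (v : G) : bool := [forall u in pblock x v, s v <= s u].

Lemma first_exists x u : valid x -> exists2 v, v \in pblock x u & first_in x v.
Proof.
move=> vx; have hu := mem_valid_pblock u vx.
case: (arg_minnP s hu) => v vu h; exists v => //.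
by move/(pblock_eqP _ _ vx): (vu) => e; apply/forall_inP => w; rewrite -e => /h.
Qed.

Lemma first_uniq x u v : valid x -> first_in x u -> first_in x v -> v \in pblock x u -> u = v.
Proof.
move=> vx /forall_inP hu /forall_inP hv uv; apply: s_inj.
by apply/eqP; rewrite eqn_leq hu // hv // pblock_mem_sym.
Qed.

Lemma card_first x : valid x -> #|[set v | first_in x v]| = #|x|.
Proof.
move=> vx; rewrite -(card_in_imset (f := pblock x)); last first.
  move=> u v; rewrite !inE => hu hv e; apply: (first_uniq vx hu hv).
  by rewrite e mem_valid_pblock.
apply: eq_card => C; apply/imsetP/idP => [[v _ ->]|hC]; first exact: valid_pblock.
have [u _ ->] := valid_blockP vx hC; have [v vu hv] := first_exists u vx.
by exists v; rewrite ?inE //; apply/pblock_eqP.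
Qed.

Definition hybrid_first P x y : {set G} := [set v | first_in (if v \in P then y else x) v].

Definition boundary P : {set G} := [set v | [exists u, adj v u && ((u \in P) != (v \in P))]].

(** Different first vertices lie in different hybrid classes, since a hybrid class lies in one block
    of one source. *)
Lemma hybrid_card_ge P x y : valid x -> valid y -> #|hybrid_first P x y| <= #|hybrid P x y|.
Proof.
move=> vx vy; rewrite -(card_in_imset (f := pblock (hybrid P x y))); last first.
  move=> u v; rewrite !inE => hu hv e.
  have : v \in pblock (hybrid P x y) u by rewrite e mem_valid_pblock // hybrid_valid.
  rewrite hybrid_pblock // => /hybrid_connect[] // euv h.
  by apply: first_uniq h => //; [apply: valid_if | rewrite euv].
apply/subset_leq_card/subsetP => C /imsetP[v _ ->].
by apply/valid_pblock/hybrid_valid.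
Qed.

(** A hybrid class that avoids the boundary is an entire source block and contains its first vertex;
    every other class is charged to a boundary vertex in it. *)
Lemma hybrid_card_le P x y : valid x -> valid y ->
  #|hybrid P x y| <= #|hybrid_first P x y| + #|boundary P|.
Proof.
move=> vx vy; set h := hybrid P x y; have vh : valid h by apply: hybrid_valid.
apply: leq_trans (_ : #|(pblock h @: hybrid_first P x y) :|: (pblock h @: boundary P)| <= _).
  apply/subset_leq_card/subsetP => C hC; have [u uC eC] := valid_blockP vh hC.
  rewrite inE; case hb : [exists w in C, w \in boundary P].
    case/exists_inP: hb => w wC wb; apply/orP; right; apply/imsetP; exists w => //.
    by rewrite (def_pblock (valid_trivIset vh) hC wC).
  apply/orP; left; pose z := if u \in P then y else x.
  have vz : valid z by apply: valid_if.
  have [w wu fw] := first_exists u vz.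
  suff hw : connect (hybrid_edge P x y) u w.
    apply/imsetP; exists w; last by rewrite eC; apply/pblock_eqP; rewrite // hybrid_pblock.
    by rewrite inE; case: (hybrid_connect vx vy hw) => <- _.
  move: wu; rewrite -connect_in_block // => wu.
  apply: (connect_inv (I := connect (hybrid_edge P x y) u) _ wu); last exact: connect0.
  move=> a b /andP[ab bz] ha; apply: connect_trans (ha) (connect1 _).
  have [ea az] := hybrid_connect vx vy ha.
  have na : a \notin boundary P.
    move/negbT: hb; rewrite negb_exists_in => /forall_inP; apply.
    by rewrite eC hybrid_pblock.
  rewrite /hybrid_edge /= ab -ea bz andbT ea; move: na; rewrite inE negb_exists => /forallP/(_ b).
  by rewrite ab /= negbK eq_sym.
apply: leq_trans (leq_card_setU _ _) _.
by apply: leq_add; apply: leq_imset_card.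
Qed.
End Count.
End Hybrid.

Lemma bandwidthP (G : sgraph) :
  exists s : G -> nat, [/\ injective s, forall v, s v < #|G| &
    forall u v, adj u v -> s u <= s v + bandwidth G].
Proof.
rewrite /bandwidth.
have i0 : injectiveb [ffun v : G => enum_rank v].
  by apply/injectiveP => u v; rewrite !ffunE => /enum_rank_inj.
case: arg_minnP => // s /injectiveP si _; exists (fun v => nat_of_ord (s v)); split => [u v /val_inj /si|v|u v uv] //.
have h (a c : nat) : a <= c + absz (a%:Z - c%:Z)%R by lia.
apply: leq_trans (h (s u) (s v)) _; rewrite leq_add2l.
exact: (leq_bigmax_cond (F := fun e : G * G => absz ((s e.1)%:Z - (s e.2)%:Z)%R) (u, v)).
Qed.

Section HybridPath.
Variables (G : sgraph) (B D b : nat).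
Hypothesis hD : max_degree_le G D.
Variable s : G -> nat.
Hypothesis s_inj : injective s.
Hypothesis s_lt : forall v, s v < #|G|.
Hypothesis s_band : forall u v, adj u v -> s u <= s v + b.
Notation n := #|G|.

Lemma card_window k l : #|[set v : G | (k <= s v) && (s v < k + l)]| <= l.
Proof.
case: l => [|l].
  rewrite leqn0 cards_eq0; apply/eqP/setP => v; rewrite !inE; lia.
rewrite -{2}(card_ord l.+1).
rewrite -(card_in_imset (f := fun v : G => inord (s v - k) : 'I_l.+1)) ?max_card //.
move=> u v; rewrite !inE => hu hv /(congr1 val) /=.
by rewrite !inordK; try lia; move=> h; apply: s_inj; lia.
Qed.

Definition arc_set (m : nat) (t : nat * nat) : {set G} := [set v | arc_pos m t.1 t.2 (s v)].

(** An arc can be cut at four places, each end as it stands and shifted by [m]. A boundary vertex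
    lies within [b] of such a place, which leaves [2 * b] vertices per place. *)
Lemma card_boundary m t : #|boundary (arc_set m t)| <= 8 * b.
Proof.
pose T o c := [set v : G | (c <= 2 * s v + o + 2 * b) && (2 * s v + o < c + 2 * b)].
have cT o c : #|T o c| <= 2 * b.
  apply: leq_trans (card_window (c - (o + 2 * b)).+1./2 (2 * b)).
  by apply/subset_leq_card/subsetP => v; rewrite !inE; lia.
apply: leq_trans (_ : #|(T 0 t.1 :|: T m t.1) :|: (T 0 t.2 :|: T m t.2)| <= _).
  apply/subset_leq_card/subsetP => v; rewrite inE => /existsP[u /andP[uv]].
  have h1 := s_band uv; have h2 : s v <= s u + b by apply: s_band.
  have h3 : s u <= s v + b by apply: s_band; rewrite adj_sym.
  have key o c : v \notin T o c -> (2 * s u + o < c) = (2 * s v + o < c).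
    rewrite inE; lia.
  rewrite !inE; move: (key 0 t.1) (key m t.1) (key 0 t.2) (key m t.2).
  rewrite !inE /arc_pos !addn0; do 4! case: (_ && _) => //=.
  by do 4! move=> /(_ isT) ->; rewrite eqxx.
apply: leq_trans (leq_card_setU _ _) _.
have := cT 0 t.1; have := cT m t.1; have := cT 0 t.2; have := cT m t.2.
have := leq_card_setU (T 0 t.1) (T m t.1); have := leq_card_setU (T 0 t.2) (T m t.2).
move=> [h1 _] [h2 _]; lia.
Qed.

Lemma card_cut_pairs m t : #|cut_pairs (arc_set m t)| <= 8 * b * D.
Proof.
set P := arc_set m t.
apply: leq_trans (leq_mul (card_boundary m t) (leqnn D)).
rewrite -sum_nat_const.
apply: leq_trans (_ : \sum_(v in boundary P) #|[set w | adj v w]| <= _); last first.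
  by apply: leq_sum => v _; apply: hD.
have -> : \sum_(v in boundary P) #|[set w | adj v w]| =
    #|[set e : G * G | (e.1 \in boundary P) && adj e.1 e.2]|.
  rewrite -sum1_card; under eq_bigr do rewrite -sum1_card.
  by rewrite pair_big_dep /=; apply: eq_bigl => e; rewrite !inE.
apply/subset_leq_card/subsetP => -[u v]; rewrite inE /= => /andP[uv ne].
by rewrite inE /= uv andbT inE; apply/existsP; exists v; rewrite uv eq_sym ne.
Qed.

Lemma card_positions (Q : pred nat) (a : pred G) :
  #|[set v : G | Q (s v) && a v]| = \sum_(p < n | Q p) [exists v, (s v == p :> nat) && a v].
Proof.
pose so v := Ordinal (s_lt v).
have sb : bijective so.
  by apply: inj_card_bij; [move=> u v [/s_inj] | rewrite card_ord].
rewrite (reindex so) /=; last exact: onW_bij.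
rewrite -sum1_card [RHS](eq_bigr (fun v => nat_of_bool (a v))); last first.
  move=> v _; congr nat_of_bool; apply/existsP/idP => [[u /andP[/eqP/s_inj -> //]]|av].
  by exists v; rewrite eqxx.
rewrite -big_mkcondr /=; apply: eq_bigl => v; by rewrite inE.
Qed.

Lemma arc_set_step N m (t t' : 'I_N * 'I_N) : 0 < n -> 2 * n <= m -> arc_step t t' ->
  exists v, forall u, u != v ->
    (u \in arc_set m (val t.1, val t.2)) = (u \in arc_set m (val t'.1, val t'.2)).
Proof.
move=> n0 nm st.
(* Only a vertex whose doubled position is [c], possibly after the shift by [m], changes sides when
   an end moves between [c] and [c + 1]; as [2 * n <= m], there is at most one. *)
pose c := if t.1 == t'.1 then minn t.2 t'.2 else minn t.1 t'.1.
have [v0 _] : exists v0, v0 \in G by apply/card_gt0P.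
have [v hv] : exists v, forall u, (2 * s u == c) || (2 * s u + m == c) -> u = v.
  case: (pickP (fun u => (2 * s u == c) || (2 * s u + m == c))) => [v hv|h].
    exists v => u hu; apply: s_inj; have := s_lt u; have := s_lt v; lia.
  by exists v0 => u; rewrite h.
exists v => u uv; have hu : ~~ ((2 * s u == c) || (2 * s u + m == c)).
  by apply: contra uv => /hv ->.
rewrite !inE /arc_pos /=; move: st hu; rewrite /arc_step /= /c.
have key i j : (i.+1 == j) || (j.+1 == i) ->
    ~~ ((2 * s u == minn i j) || (2 * s u + m == minn i j)) ->
    (2 * s u < i) = (2 * s u < j) /\ (2 * s u + m < i) = (2 * s u + m < j) by lia.
case: t t' {c hv} => [t1 t2] [r1 r2] /=.
case: (eqVneq t1 r1) => [->|ne] /=.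
  case/orP => [h|/andP[_ h]]; last by lia.
  by move/(key _ _ h) => [-> ->].
by case/andP => /eqP -> h /(key _ _ h) [-> ->].
Qed.

(** The first three bounds are those that [fact_balance] needs to compare weights; the last two
    limit the excess over [q] to [1 + 8 * b] classes. *)
Definition hybrid_good (x y : {set {set G}}) (P : {set G}) : bool :=
  let h := #|hybrid P x y| in let h' := #|hybrid P y x| in
  [&& #|x| <= h + 1, #|x| <= h' + 1, #|x| + #|y| <= h + h', h <= #|y| + 1 + 8 * b
    & h' <= #|y| + 1 + 8 * b].

Notation N := (8 * n).+1.

Lemma hybrid_path (x y : {set {set G}}) : 0 < n -> valid B x -> valid B y -> #|x| <= #|y| ->
  exists (m : 'I_N) (t0 t1 : 'I_N * 'I_N),
  let S t := arc_set m (val t.1, val t.2) in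
  [/\ 2 * n <= m, S t0 = set0, S t1 = [set: G]
    & connect [rel t t' : 'I_N * 'I_N |
        [&& arc_step t t', hybrid_good x y (S t) & hybrid_good x y (S t')]] t0 t1].
Proof.
move=> n0 vx vy le.
pose fi z (p : nat) := [exists v, (s v == p :> nat) && first_in s z v].
have total z : valid B z -> \sum_(p < n) fi z p = #|z|.
  move=> vz; rewrite -(card_first s_inj vz) -(card_positions predT).
  by apply: eq_card => v; rewrite !inE.
have le' : \sum_(p < n) fi x p <= \sum_(p < n) fi y p by rewrite !total.
have [m [t0 [t1 [nm h0 h1 hc]]]] := balanced_arcs n0 le'.
exists m, t0, t1 => S; split => //.
- apply/setP => v; rewrite !inE; apply/negbTE/h0/s_lt.
- by apply/setP => v; rewrite !inE h1.
have cf z z' Q : #|hybrid_first s [set v | Q (s v)] z z'| =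
    \sum_(p < n | Q p) fi z' p + \sum_(p < n | ~~ Q p) fi z p.
  rewrite -card_positions -(card_positions (fun p => ~~ Q p)) -cardsUI.
  rewrite [X in _ + X](_ : _ = 0) ?addn0.
    apply: eq_card => v; rewrite !inE; by case: (Q _) => /=; rewrite ?orbF.
  apply/eqP; rewrite cards_eq0; apply/eqP/setP => v; rewrite !inE.
  by case: (Q _) => //=; rewrite andbF.
have good (t : 'I_N * 'I_N) : arc_balanced n (fi y) (fi x) m t.1 t.2 -> hybrid_good x y (S t).
  rewrite /arc_balanced !total // => /andP[b1 b2].
  have := hybrid_card_ge s_inj (S t) vx vy; have := hybrid_card_ge s_inj (S t) vy vx.
  have := hybrid_card_le s (S t) vy vx; have := hybrid_card_le s (S t) vx vy.
  have := card_boundary m (val t.1, val t.2).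
  rewrite /S /arc_set /= !cf.
  have := total _ vx; rewrite (bigID (fun p : 'I_n => arc_pos m t.1 t.2 p)) /=.
  have := total _ vy; rewrite (bigID (fun p : 'I_n => arc_pos m t.1 t.2 p)) /=.
  move: b1 b2; rewrite /hybrid_good.
  have key ax ay X Y bx' by' bd h h' : ax <= ay + 1 -> X + ay <= Y + ax + 1 ->
    ay + by' = Y -> ax + bx' = X -> bd <= 8 * b -> h <= ay + bx' + bd ->
    h' <= ax + by' + bd -> ax + by' <= h' -> ay + bx' <= h ->
    [&& X <= h + 1, X <= h' + 1, X + Y <= h + h', h <= Y + 1 + 8 * b
      & h' <= Y + 1 + 8 * b] by lia.
  exact: key.
apply: connect_sub hc => u v /and3P[st b1 b2]; apply: connect1.
by rewrite /= st !good.
Qed.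
End HybridPath.

(** * Labellings *)

Section PermExtension.
Variables (T : finType) (A : {set T}) (h : T -> T).
Hypothesis h_inj : {in A &, injective h}.

(** The complements of [A] and of its image have the same size and are matched in the order of
    enumeration. *)
Lemma extend_perm : exists s : {perm T}, {in A, forall a, s a = h a}.
Proof.
pose C := ~: A; pose E := ~: (h @: A).
have eC : #|C| = #|E|.
  by apply/eqP; rewrite -(eqn_add2l #|A|) cardsC -{1}(card_in_imset h_inj) cardsC.
pose k x := if x \in A then h x else nth x (enum E) (index x (enum C)).
have kE x : x \notin A -> k x \in E /\ k x = nth x (enum E) (index x (enum C)).
  move=> xA; rewrite /k (negbTE xA); split=> //; rewrite -mem_enum mem_nth //.
  by rewrite -cardE -eC cardE index_mem mem_enum inE.
have kA x : x \in A -> k x \in h @: A by move=> xA; rewrite /k xA imset_f.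
have k_inj : injective k.
  move=> x y; case xA : (x \in A); case yA : (y \in A).
  - by rewrite /k xA yA; apply: h_inj.
  - move=> e; have [ky _] := kE y (negbT yA); have := kA x xA.
    by rewrite e => h1; rewrite inE h1 in ky.
  - move=> e; have [kx _] := kE x (negbT xA); have := kA y yA.
    by rewrite -e => h1; rewrite inE h1 in kx.
  have [_ ->] := kE x (negbT xA); have [_ ->] := kE y (negbT yA).
  have ix z : z \notin A -> index z (enum C) < size (enum E).
    by move=> zA; rewrite -cardE -eC cardE index_mem mem_enum inE.
  move/eqP; rewrite (set_nth_default x y) ?ix ?yA // nth_uniq ?ix ?xA ?yA ?enum_uniq //.
  move/eqP => e; have xC : x \in enum C by rewrite mem_enum inE xA.
  have yC : y \in enum C by rewrite mem_enum inE yA.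
  by rewrite -(nth_index x xC) e nth_index.
by exists (perm k_inj) => a aA; rewrite permE /k aA.
Qed.
End PermExtension.

Section Labels.
Variables (G : sgraph) (q : nat).
Notation lab := {ffun G -> 'I_q}.
Implicit Types (f g : lab) (x : {set {set G}}).

Definition parts (f : lab) : {set {set G}} := preim_partition f [set: G].

Definition fibre (f : lab) (c : 'I_q) : {set G} := [set u | f u == c].

Lemma partsP f X : reflect (exists u, X = fibre f (f u)) (X \in parts f).
Proof.
apply: (iffP imsetP) => [[u _ ->]|[u ->]]; exists u => //.
  by apply/setP => v; rewrite !inE eq_sym.
by apply/setP => v; rewrite !inE eq_sym.
Qed.

Lemma parts_partition f : partition (parts f) [set: G].
Proof. exact: preim_partitionP. Qed.

Lemma mem_pblock_parts f u v : (v \in pblock (parts f) u) = (f u == f v).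
Proof.
rewrite /parts /preim_partition pblock_equivalence_partition ?inE //.
by move=> a b c _ _ _; split=> // /eqP ->.
Qed.

Lemma parts_eqP f g : reflect (forall u v, (f u == f v) = (g u == g v)) (parts f == parts g).
Proof.
apply: (iffP eqP) => [e u v|h]; first by rewrite -!mem_pblock_parts e.
apply/setP => X; apply/partsP/partsP => -[u ->]; exists u; apply/setP => v; rewrite !inE.
  by rewrite h.
by rewrite h.
Qed.

Lemma parts_comp (s : {perm 'I_q}) f : parts [ffun v => s (f v)] = parts f.
Proof. by apply/eqP/parts_eqP => u v; rewrite !ffunE (inj_eq perm_inj). Qed.

Lemma card_parts f : #|parts f| <= q.
Proof.
rewrite -[X in _ <= X]card_ord; apply: leq_trans (leq_imset_card (fibre f) 'I_q).
by apply/subset_leq_card/subsetP => X /partsP[u ->]; apply: imset_f.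
Qed.

Lemma parts_qpartition f : is_qpartition q (parts f).
Proof. by rewrite /is_qpartition parts_partition card_parts. Qed.

(** This allows labellings of two partitions to be chosen so that they coincide literally wherever
    the partitions agree. *)
Lemma relabel f g (U : {set G}) :
  {in U &, forall u v, (f u == f v) = (g u == g v)} ->
  exists s : {perm 'I_q}, {in U, forall u, s (f u) = g u}.
Proof.
move=> h; pose k c := if [pick u in U | f u == c] is Some u then g u else c.
have kf u : u \in U -> k (f u) = g u.
  move=> uU; rewrite /k; case: pickP => [v /andP[vU /eqP e]|/(_ u)]; last by rewrite uU eqxx.
  by apply/eqP; rewrite -h // e.
have [|s hs] := @extend_perm _ (f @: U) k.
  by move=> _ _ /imsetP[u uU ->] /imsetP[v vU ->]; rewrite !kf // => /eqP; rewrite -h // => /eqP.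
by exists s => u uU; rewrite hs ?kf // imset_f.
Qed.

Definition upd f (v : G) (c : 'I_q) : lab := [ffun u => if u == v then c else f u].

Lemma move_fibre f v c : move (parts f) v (fibre f c) = parts (upd f v c).
Proof.
have fibE d w : w \in fibre f d -> fibre f d = fibre f (f w) by rewrite inE => /eqP ->.
have updc : v |: fibre f c = fibre (upd f v c) c.
  by apply/setP => u; rewrite !inE ffunE; case: (u == v); rewrite ?eqxx.
have updd d : d != c -> fibre f d :\ v = fibre (upd f v c) d.
  move=> dc; apply/setP => u; rewrite !inE ffunE; case: (u == v) => //=.
  by rewrite eq_sym (negbTE dc).
apply/setP => X; rewrite !inE; apply/andP/partsP.
  case=> X0 /imsetP[C]; rewrite !inE => /orP[/eqP ->|/partsP[w ->]].
    case: eqP => [e|_] eX; last by rewrite eX set0D eqxx in X0.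
    exists v; rewrite eX ffunE eqxx -updc -e; reflexivity.
  case: eqP => [e|ne] eX.
    have wc : f w = c by apply/eqP; have : w \in fibre f (f w) by [rewrite inE]; rewrite e inE.
    by exists v; rewrite eX ffunE eqxx -updc wc.
  have [w' w'X] := set0Pn _ X0.
  have wc : f w != c by apply/eqP => wc; apply: ne; rewrite wc.
  have e : upd f v c w' = f w.
    by move: w'X; rewrite eX updd // inE => /eqP.
  by exists w'; rewrite eX updd // e.
case=> u ->; case: (eqVneq (upd f v c u) c) => e.
  rewrite e -updc; split; first by apply/set0Pn; exists v; rewrite setU11.
  apply/imsetP; exists (fibre f c); last by rewrite eqxx.
  rewrite !inE; have [->|[w wc]] := set_0Vmem (fibre f c); first by rewrite eqxx.
  by apply/orP; right; apply/partsP; exists w; apply: fibE.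
have uv : u != v by apply: contraNneq e => ->; rewrite ffunE eqxx.
have eu : upd f v c u = f u by rewrite ffunE (negbTE uv).
rewrite eu in e *; split.
  by apply/set0Pn; exists u; rewrite inE eu.
apply/imsetP; exists (fibre f (f u)).
  by rewrite inE; apply/orP; right; apply/partsP; exists u.
rewrite ifN ?updd //; apply: contra e => /eqP e.
by have : u \in fibre f (f u) by [rewrite inE]; rewrite e inE.
Qed.

Lemma sum_classes (R : nmodType) f (phi : {set G} -> R) :
  (\sum_(A <- classes q (parts f)) phi A = \sum_(c : 'I_q) phi (fibre f c))%R.
Proof.
rewrite /classes big_cat /= big_enum /= [RHS](bigID (fun c => fibre f c != set0)) /=.
have inj : {in [set c | fibre f c != set0] &, injective (fibre f)}.
  move=> c d; rewrite !inE => /set0Pn[u uc] _ e.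
  by move: (uc); rewrite e; move: uc; rewrite !inE => /eqP -> /eqP.
have im : parts f = fibre f @: [set c | fibre f c != set0].
  apply/setP => X; apply/partsP/imsetP => [[u ->]|[c]].
    by exists (f u) => //; rewrite inE; apply/set0Pn; exists u; rewrite inE.
  by rewrite inE => /set0Pn[u]; rewrite inE => /eqP e ->; exists u; rewrite e.
congr (_ + _)%R.
  by rewrite {1}im big_imset //=; apply: eq_bigl => c; rewrite inE.
rewrite [RHS](eq_bigr (fun=> phi set0)); last by move=> c; rewrite negbK => /eqP ->.
rewrite big_nseq sumr_const iter_addr_0; congr (_ *+ _)%R.
have -> : #|parts f| = #|[set c | fibre f c != set0]| by rewrite {1}im card_in_imset.
rewrite -{1}(card_ord q) -(cardC (mem [set c | fibre f c != set0])) addKn.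
by apply: eq_card => c; rewrite !inE.
Qed.

Lemma exists_label x : is_qpartition q x -> exists f, parts f = x.
Proof.
case/andP => px sx; case/and3P: (px) => /eqP cx tx n0.
have blk v : pblock x v \in enum x by rewrite mem_enum pblock_mem // cx inE.
have lt v : index (pblock x v) (enum x) < q.
  by apply: leq_trans sx; rewrite cardE index_mem.
pose f : lab := [ffun v => Ordinal (lt v)].
exists f; have e u v : (f u == f v) = (v \in pblock x u).
  rewrite !ffunE -val_eqE /= -eq_pblock ?cx ?inE //.
  apply/eqP/eqP => [h|-> //].
  by rewrite -(nth_index set0 (blk u)) h nth_index.
have fb u : fibre f (f u) = pblock x u by apply/setP => v; rewrite inE eq_sym e.
apply/setP => X; apply/partsP/idP => [[u ->]|hX].
  by rewrite fb -mem_enum.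
have [X0|[u uX]] := set_0Vmem X; first by rewrite -X0 hX in n0.
by exists u; rewrite fb (def_pblock tx hX uX).
Qed.

(** The labellings of [x] are the injections of its classes into the labels. The count is the weight
    of [x] in the stationary distribution. *)
Lemma card_labels x : is_qpartition q x -> #|[set f : lab | parts f == x]| = q ^_ #|x|.
Proof.
move=> qx; have [f0 e0] := exists_label qx.
pose T := {A : {set G} | A \in x}.
have cT : #|{: T}| = #|x| by rewrite card_sig.
have bx v : fibre f0 (f0 v) \in x by rewrite -e0; apply/partsP; exists v.
pose bk v : T := exist _ (fibre f0 (f0 v)) (bx v).
have -> : q ^_ #|x| = #|[set i : {ffun T -> 'I_q} | injectiveb i]|.
  by rewrite card_inj_ffuns cT card_ord.
pose F (i : {ffun T -> 'I_q}) : lab := [ffun v => i (bk v)].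
have bkE u v : (bk u == bk v) = (f0 u == f0 v).
  rewrite -val_eqE /=; apply/eqP/eqP => [/setP/(_ u)|-> //].
  by rewrite !inE eqxx => /esym/eqP.
have bk_onto (A : T) : exists v, A = bk v.
  have : val A \in parts f0 by rewrite e0 (valP A).
  by case/partsP => v hv; exists v; apply: val_inj.
rewrite -(card_in_imset (f := F)).
  apply: eq_card => f; rewrite !inE; apply/idP/imsetP; last first.
    case=> i; rewrite inE => /injectiveP ii ->; apply/eqP; rewrite -[RHS]e0.
    by apply/eqP/parts_eqP => u v; rewrite !ffunE (inj_eq ii) bkE.
  rewrite -[X in _ == X]e0 => /parts_eqP h.
  have pk (A : T) : exists v, A == bk v by have [v ->] := bk_onto A; exists v.
  pose i : {ffun T -> 'I_q} := [ffun A => f (xchoose (pk A))].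
  have ib v : i (bk v) = f v.
    by rewrite ffunE; apply/eqP; rewrite h -bkE eq_sym; apply: (xchooseP (pk (bk v))).
  exists i; last by apply/ffunP => v; rewrite ffunE ib.
  rewrite inE; apply/injectiveP => A C; have [u ->] := bk_onto A; have [v ->] := bk_onto C.
  by rewrite !ib => /eqP; rewrite h -bkE => /eqP.
move=> i j _ _ /ffunP e; apply/ffunP => A; have [v ->] := bk_onto A.
by have := e v; rewrite !ffunE.
Qed.
End Labels.

Local Open Scope ring_scope.

(** * Canonical paths through hybrids *)

Lemma eq_ler (R : numDomainType) (x y : R) : x = y -> x <= y.
Proof. by move->. Qed.

(** The form of all congestion bounds below: [phi] is an encoding and [M] bounds the number of
    objects with the same code. *)
Lemma sum_fibres_le (R : realFieldType) (I J : finType) (S : pred I) (T : pred J)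
    (phi : I -> J) (F : J -> R) (M : R) :
  (forall i, S i -> T (phi i)) -> (forall j, T j -> 0 <= F j) ->
  (forall j, T j -> #|[set i | S i && (phi i == j)]|%:R <= M) ->
  \sum_(i | S i) F (phi i) <= M * \sum_(j | T j) F j.
Proof.
move=> hST F0 hM; rewrite (partition_big phi T) //= mulr_sumr.
apply: ler_sum => j Tj; rewrite (eq_bigr (fun=> F j)); last by move=> i /andP[_ /eqP ->].
rewrite sumr_const -mulr_natl; apply: ler_wpM2r; first exact: F0.
by apply: le_trans (hM _ Tj); rewrite ler_nat; apply/subset_leq_card/subsetP => i; rewrite inE.
Qed.

Lemma ler_sum_sub (R : realFieldType) (I : finType) (P Q : pred I) (F : I -> R) :
  (forall i, P i -> Q i) -> (forall i, Q i -> 0 <= F i) ->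
  \sum_(i | P i) F i <= \sum_(i | Q i) F i.
Proof.
move=> PQ F0; rewrite big_mkcond [leRHS]big_mkcond; apply: ler_sum => i _.
by case: ifP => [/PQ -> //|_]; case: ifP => // /F0.
Qed.

Lemma sqrD_le (R : realFieldType) (a b : R) : (a + b) ^+ 2 <= 2 * (a ^+ 2 + b ^+ 2).
Proof. by have := sqr_ge0 (a - b); nra. Qed.

(** Every step of a repetition-free path is at most the square root of the whole edge sum, and there
    are fewer than [#|T|] steps. The crude bound costs a polynomial factor, but no particular path
    has to be named. *)
Lemma connect_sqr_le (R : realType) (T : finType) (e : rel T) (phi : T -> R) t0 t1 :
  connect e t0 t1 ->
  (phi t0 - phi t1) ^+ 2 <=
    #|T|%:R ^+ 2 * \sum_(p : T * T | e p.1 p.2) (phi p.1 - phi p.2) ^+ 2.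
Proof.
set Q := \sum_(p | _) _ => /connectP[p0 pth0 e0].
case/shortenP: pth0 e0 => p pth un _ ->.
have Q0 : 0 <= Q by apply: sumr_ge0 => i _; apply: sqr_ge0.
have st a b : e a b -> `|phi a - phi b| <= Num.sqrt Q.
  move=> ab; rewrite -sqrtr_sqr ler_sqrt //.
  rewrite /Q (bigD1 (a, b)) //= lerDl.
  by apply: sumr_ge0 => i _; apply: sqr_ge0.
have le : `|phi t0 - phi (last t0 p)| <= (size p)%:R * Num.sqrt Q.
  elim: p t0 pth {un} => [|a p IH] b /=; first by rewrite subrr normr0 mul0r.
  case/andP => ba pth; rewrite -(subrK (phi a) (phi b)) -addrA.
  apply: le_trans (ler_normD _ _) _; rewrite -natr1 mulrDl mul1r [leRHS]addrC.
  by apply: lerD; [apply: st | apply: IH].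
rewrite -[leLHS]real_normK ?num_real //.
apply: le_trans (_ : ((size p)%:R * Num.sqrt Q) ^+ 2 <= _).
  by rewrite lerXn2r // nnegrE mulr_ge0 // sqrtr_ge0.
rewrite exprMn sqr_sqrtr //; apply: ler_wpM2r => //.
rewrite lerXn2r ?nnegrE ?ler0n // ler_nat.
by apply: leq_trans (leqnSn _) _; rewrite -[(size p).+1]/(size (t0 :: p)) -(card_uniqP un) max_card.
Qed.

Lemma fact_transfer c u s : (c <= u)%N -> ((c + s)`! * u`! <= c`! * (u + s)`!)%N.
Proof.
move=> cu; elim: s => [|s IH]; first by rewrite !addn0.
rewrite !addnS !factS -mulnA [X in (_ <= X)%N]mulnCA.
by apply: leq_mul => //; rewrite ltnS leq_add2r.
Qed.

(** Log-convexity of the factorial: a product of two factorials grows as the arguments spread. *)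
Lemma fact_spread a c u v : (u <= a)%N -> (v <= a)%N -> (u + v <= a + c)%N ->
  (u`! * v`! <= a`! * c`!)%N.
Proof.
wlog uv : u v / (u <= v)%N.
  move=> h ua va l; case: (leqP u v) => [uv|/ltnW uv]; first exact: h.
  by rewrite mulnC; apply: h; rewrite // addnC.
move=> ua va l; have [uc|cu] := leqP u c; first by rewrite mulnC leq_mul // leq_fact.
rewrite -(subnKC (ltnW cu)) [X in (_ <= X)%N]mulnC.
apply: leq_trans (fact_transfer _ (ltnW (leq_trans cu uv))) _.
by rewrite leq_mul2l leq_fact ?orbT //; lia.
Qed.

(** The factor [q.+1] pays for the case in which one hybrid has only [k - 1] classes, so that its
    deficit [q - p'] exceeds [q - k] by one; otherwise [fact_spread] suffices. *)
Lemma fact_balance q k l p p' : (k <= l)%N -> (l <= q)%N ->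
  (k <= p + 1)%N -> (k <= p' + 1)%N -> (k + l <= p + p')%N ->
  ((q - p)`! * (q - p')`! <= q.+1 * ((q - k)`! * (q - l)`!))%N.
Proof.
wlog h : p p' / (p' <= p)%N.
  move=> H kl lq kp kp' l'; case: (leqP p' p) => [h|/ltnW h]; first exact: H.
  by rewrite mulnC; apply: H; rewrite // [(p' + _)%N]addnC.
move=> kl lq kp kp' s.
have [v1|v1] := leqP (q - p') (q - k).
  apply: leq_trans (leq_pmull _ _) => //; have [pq|qp] := leqP p q.
    by apply: fact_spread; lia.
  have -> : (q - p = 0)%N by lia.
  by rewrite mul1n; apply: leq_trans (leq_pmulr _ (fact_gt0 _)); rewrite leq_fact.
have e : (q - p' = (q - k).+1)%N by lia.
rewrite e factS mulnCA; apply: leq_mul; first by lia.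
by rewrite mulnC leq_mul // leq_fact //; lia.
Qed.

Section Energy.
Variables (R : realType) (G : sgraph) (B q rho : nat).
Notation part := {set {set G}}.
Implicit Types (f : part -> R) (x y : part).

Definition local_change x y : bool :=
  [exists v, (x :\: y) :|: (y :\: x) \subset powerset (ball rho v)].

(** The stationary weight divided by [q!]. Truncated subtraction gives the value 1 above [q]
    classes, so the weight extends to hybrids with too many classes. *)
Definition wt x : R := ((q - #|x|)`!)%:R^-1.

Definition energy (r : nat) f : R :=
  \sum_(x in Omega G r B) \sum_(y in Omega G r B | local_change x y) wt x * (f x - f y) ^+ 2.

Definition spread f : R :=
  \sum_(x in Omega G q B) \sum_(y in Omega G q B) wt x * wt y * (f x - f y) ^+ 2.

Definition mass (r : nat) : R := \sum_(x in Omega G r B) wt x.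

Lemma wt_gt0 x : 0 < wt x.
Proof. by rewrite invr_gt0 ltr0n fact_gt0. Qed.

Lemma wt_le1 x : wt x <= 1.
Proof. by rewrite invf_le1 ?ltr0n ?fact_gt0 // ler1n fact_gt0. Qed.

Lemma energy_ge0 r f : 0 <= energy r f.
Proof.
apply: sumr_ge0 => x _; apply: sumr_ge0 => y _.
by rewrite mulr_ge0 ?sqr_ge0 // ltW ?wt_gt0.
Qed.

Lemma mass_ge0 r : 0 <= mass r.
Proof. by apply: sumr_ge0 => x _; rewrite ltW ?wt_gt0. Qed.

Lemma local_changeC x y : local_change x y = local_change y x.
Proof. by rewrite /local_change; apply: eq_existsb => v; rewrite setUC. Qed.
End Energy.

Section Base.
Variables (R : realType) (G : sgraph) (B D q rho : nat).
Hypothesis hD : max_degree_le G D.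
Hypothesis rhoB : (B <= rho)%N.
Hypothesis n_gt0 : (0 < #|G|)%N.
Notation n := #|G|.
Notation part := {set {set G}}.
Notation b := (bandwidth G).

(** A pair is encoded by the hybrid of [y] and [x], which is summed in [mass], together with the
    local change from one hybrid of [x] and [y] to the next, which is summed in [energy]. By
    [hybrid_inj] a code is shared by at most one pair for each choice of two subsets of the cut. *)
Lemma hybrid_sum_le (f : part -> R) (P P' : {set G}) r (C : nat) v :
  (#|cut_pairs P| <= C)%N -> (forall u, u != v -> (u \in P) = (u \in P')) ->
  \sum_(p : part * part | ([&& valid B p.1, valid B p.2,
       #|hybrid P p.1 p.2| <= r, #|hybrid P' p.1 p.2| <= r & #|hybrid P p.2 p.1| <= r])%N)
    wt R q (hybrid P p.1 p.2) * wt R q (hybrid P p.2 p.1) *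
      (f (hybrid P p.1 p.2) - f (hybrid P' p.1 p.2)) ^+ 2
  <= (2 ^ (2 * C))%:R * (mass R G B q r * energy B q rho r f).
Proof.
move=> hC hP.
pose phi (p : part * part) :=
  (hybrid P p.2 p.1, (hybrid P p.1 p.2, hybrid P' p.1 p.2)).
pose F (j : part * (part * part)) : R :=
  wt R q j.2.1 * wt R q j.1 * (f j.2.1 - f j.2.2) ^+ 2.
pose T (j : part * (part * part)) :=
  (j.1 \in Omega G r B) && ((j.2.1 \in Omega G r B) &&
     ((j.2.2 \in Omega G r B) && local_change rho j.2.1 j.2.2)).
have -> : mass R G B q r * energy B q rho r f = \sum_(j | T j) F j.
  rewrite /mass /energy big_distrlr /=.
  transitivity (\sum_(i in Omega G r B) \sum_(j | (j.1 \in Omega G r B) &&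
      ((j.2 \in Omega G r B) && local_change rho j.1 j.2)) F (i, (j.1, j.2))).
    apply: eq_bigr => i _; rewrite -(pair_big_dep (fun x => x \in Omega G r B)
      (fun x y => (y \in Omega G r B) && local_change rho x y) (fun x y => F (i, (x, y)))) /=.
    by apply: eq_bigr => x _; rewrite mulr_sumr; apply: eq_bigr => y _; rewrite /F /=; ring.
  rewrite (pair_big_dep (fun x => x \in Omega G r B) (fun x j => (j.1 \in Omega G r B) &&
      ((j.2 \in Omega G r B) && local_change rho j.1 j.2)) (fun x j => F (x, (j.1, j.2)))) /=.
  by apply: eq_bigr => -[x [y z]].
apply: (sum_fibres_le (phi := phi) (F := F)).
- move=> [x y] /and5P[/= vx vy h1 h2 h3].
  rewrite /T /= !OmegaE !hybrid_valid // h1 h2 h3 /=.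
  apply/existsP; exists v; apply/subsetP => A; rewrite inE powersetE => hA.
  apply: subset_trans (ball_leq v rhoB).
  case/orP: hA; rewrite inE => /andP[a1 a2].
    by apply: (hybrid_local vx vy hP a2 a1).
  by apply: (hybrid_local vx vy _ a2 a1) => u /hP ->.
- by move=> j _; rewrite mulr_ge0 ?sqr_ge0 // mulr_ge0 // ltW // wt_gt0.
move=> j _; rewrite ler_nat.
set S := [set i | _].
pose psi (p : part * part) :=
  (cut_pairs P :&: joined p.1, cut_pairs P :&: joined p.2).
rewrite -(card_in_imset (f := psi)); last first.
  move=> [x y] [x' y'] ; rewrite !inE /= => /andP[/and5P[vx vy _ _ _] /eqP <-].
  move=> /andP[/and5P[vx' vy' _ _ _] /eqP e] [c1 c2].
  case: e => e1 e2 _.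
  by have [-> ->] := hybrid_inj vx vy vx' vy' (esym e2) (esym e1) c1 c2.
apply: leq_trans (_ : #|setX (powerset (cut_pairs P)) (powerset (cut_pairs P))| <= _)%N.
  by apply/subset_leq_card/subsetP => c /imsetP[p _ ->]; rewrite inE !powersetE !subsetIl.
by rewrite cardsX !card_powerset -expnD leq_exp2l // mul2n -addnn leq_add.
Qed.
Notation N := (8 * n).+1.

Let wt_hybrid_good (x y : part) (P : {set G}) : (#|x| <= #|y|)%N -> (#|y| <= q)%N -> hybrid_good b x y P ->
  wt R q x * wt R q y <= q.+1%:R * (wt R q (hybrid P x y) * wt R q (hybrid P y x)).
Proof.
move=> xy yq /and5P[h1 h2 h3 _ _].
have := fact_balance xy yq h1 h2 h3; rewrite -(ler_nat R) !natrM.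
rewrite /wt -!invfM.
move=> le; rewrite ler_pdivlMr ?mulr_gt0 ?ltr0n ?fact_gt0 // mulrC.
by rewrite ler_pdivrMr ?mulr_gt0 ?ltr0n ?fact_gt0.
Qed.

(** The factor 2 comes from assuming [#|x| <= #|y|]. Of [N ^ 9], [N ^ 4] is the squared number of
    arcs in [connect_sqr_le], [N ^ 4] counts pairs of arcs, and [N] counts the periods [m], which
    depend on [x] and [y] and are therefore all summed. *)
Lemma spread_le_energy (f : part -> R) r : r = (q + 1 + 8 * b)%N ->
  spread B q f <=
    (2 * N ^ 9 * q.+1 * 2 ^ (16 * b * D))%:R * (mass R G B q r * energy B q rho r f).
Proof.
move=> hr; have [s [s_inj s_lt s_band]] := bandwidthP G.
pose Om := Omega G q B.
pose W (x y : part) : R := wt R q x * wt R q y * (f x - f y) ^+ 2.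
have W0 x y : 0 <= W x y by rewrite mulr_ge0 ?sqr_ge0 // mulr_ge0 // ltW // wt_gt0.
have half : spread B q f <= 2 * \sum_(x in Om) \sum_(y in Om | (#|x| <= #|y|)%N) W x y.
  have -> : spread B q f = \sum_(x in Om) \sum_(y in Om | (#|x| <= #|y|)%N) W x y +
                          \sum_(x in Om) \sum_(y in Om | ~~ (#|x| <= #|y|)%N) W x y.
    by rewrite -big_split /=; apply: eq_bigr => x _; rewrite [LHS](bigID (fun y : part => (#|x| <= #|y|)%N)).
  rewrite mulr2n mulrDl !mul1r lerD2l [leRHS](exchange_big_dep (fun y : part => y \in Om)) /=; last first.
    by move=> x y _ /andP[].
  apply: ler_sum => x xO; rewrite [leRHS](bigID (fun y : part => ~~ (#|x| <= #|y|)%N)) /=.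
  rewrite ler_wpDr //; first by apply: sumr_ge0 => y _; apply: W0.
  apply: eq_ler; apply: eq_big => [y|y _].
    by rewrite xO; case: (leqP #|x| #|y|) => h; rewrite ?(ltnW h) /= ?andbF ?andbT.
  by rewrite /W [wt R q x * _]mulrC -sqrrN opprB.
pose S m (t : 'I_N * 'I_N) := arc_set s m (val t.1, val t.2).
pose T := ('I_N * 'I_N)%type.
pose F x y m (t t' : T) := wt R q (hybrid (S m t) x y) * wt R q (hybrid (S m t) y x) *
  (f (hybrid (S m t) x y) - f (hybrid (S m t') x y)) ^+ 2.
have F0 x y m t t' : 0 <= F x y m t t'.
  by rewrite mulr_ge0 ?sqr_ge0 // mulr_ge0 // ltW // wt_gt0.
pose ok x y (m : nat) (t t' : T) := [&& (2 * n <= m)%N, arc_step t t',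
  hybrid_good b x y (S m t) & hybrid_good b x y (S m t')].
have key x y : x \in Om -> y \in Om -> (#|x| <= #|y|)%N ->
    W x y <= (N ^ 4 * q.+1)%:R * \sum_(m < N) \sum_(p : T * T | ok x y m p.1 p.2) F x y m p.1 p.2.
  rewrite !OmegaE => /andP[vx xq] /andP[vy yq] xy.
  have [m [t0 [t1 /= [nm e0 e1 hc]]]] := hybrid_path s_inj s_lt s_band n_gt0 vx vy xy.
  have := connect_sqr_le (fun t : T => f (hybrid (S m t) x y)) hc.
  rewrite /= /S e0 e1 (hybrid0 vx vy) (hybridT vx vy) => hle.
  rewrite /W; apply: le_trans (_ : wt R q x * wt R q y * _ <= _).
    by apply: ler_wpM2l hle; rewrite mulr_ge0 // ltW // wt_gt0.
  have -> : (#|{: T}|%:R ^+ 2 : R) = (N ^ 4)%:R.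
    by rewrite card_prod card_ord -natrX -[(N * N)%N]/(N ^ 2)%N -expnM.
  rewrite mulrCA natrM -[leRHS]mulrA; apply: ler_wpM2l => //.
  apply: le_trans (_ : q.+1%:R * \sum_(p : T * T | ok x y m p.1 p.2) F x y m p.1 p.2 <= _).
    rewrite !mulr_sumr; apply: le_trans (_ : _ <= \sum_(p : T * T | ok x y m p.1 p.2)
      wt R q x * wt R q y * (f (hybrid (S m p.1) x y) - f (hybrid (S m p.2) x y)) ^+ 2) _.
      by apply: eq_ler; apply: eq_bigl => p; rewrite /ok nm.
    apply: ler_sum => p /and4P[_ _ g1 _]; rewrite /F mulrA ler_wpM2r ?sqr_ge0 //.
    exact: wt_hybrid_good.
  apply: ler_wpM2l => //; rewrite (bigD1 m) //= lerDl.
  by apply: sumr_ge0 => ? _; apply: sumr_ge0 => ? _; apply: F0.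
apply: le_trans half _.
pose ME := mass R G B q r * energy B q rho r f.
have fibre (m : nat) (p : T * T) : (2 * n <= m)%N -> arc_step p.1 p.2 ->
    \sum_(z : part * part | [&& z.1 \in Om, z.2 \in Om,
       (#|z.1| <= #|z.2|)%N & ok z.1 z.2 m p.1 p.2]) F z.1 z.2 m p.1 p.2
    <= (2 ^ (2 * (8 * b * D)))%:R * ME.
  move=> nm st; have [v hv] := arc_set_step s_inj s_lt n_gt0 nm st.
  have := hybrid_sum_le f r (card_cut_pairs hD s_inj s_band m (val p.1.1, val p.1.2)) hv.
  apply: le_trans; apply: ler_sum_sub => [z|z _]; last exact: F0.
  rewrite !OmegaE => /and4P[/andP[v1 q1] /andP[v2 q2] le /and4P[_ _ g1 g2]].
  case/and5P: g1 => _ _ _ h1 h2; case/and5P: g2 => _ _ _ h3 _.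
  by rewrite v1 v2 /= hr; apply/and3P; split; [apply: leq_trans h1 _|apply: leq_trans h3 _|
    apply: leq_trans h2 _]; rewrite !leq_add2r.
rewrite (_ : (2 * N ^ 9 * q.+1 * 2 ^ (16 * b * D))%:R * ME = 2 * ((N ^ 4 * q.+1)%:R *
    \sum_(m < N) \sum_(p : T * T) (2 ^ (2 * (8 * b * D)))%:R * ME)); last first.
  rewrite !sumr_const !card_prod !card_ord -mulrnA -[(_ * ME) *+ _]mulr_natl.
  rewrite (_ : 2 * (8 * b * D) = 16 * b * D)%N; last by rewrite !mulnA.
  move: (8 * n).+1 (2 ^ _)%N => k e; rewrite !natrM; ring.
rewrite ler_pM2l //.
apply: le_trans (_ : \sum_(x in Om) \sum_(y in Om | (#|x| <= #|y|)%N)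
  (N ^ 4 * q.+1)%:R * \sum_(m < N) \sum_(p : T * T | ok x y m p.1 p.2) F x y m p.1 p.2 <= _).
  by apply: ler_sum => x xO; apply: ler_sum => y /andP[yO xy]; apply: key.
rewrite (pair_big_dep (fun x => x \in Om) (fun x y => (y \in Om) && (#|x| <= #|y|)%N)
  (fun x y => (N ^ 4 * q.+1)%:R * \sum_(m < N) \sum_(p : T * T | ok x y m p.1 p.2)
     F x y m p.1 p.2)) /=.
rewrite -mulr_sumr; apply: ler_wpM2l => //.
rewrite exchange_big /=; apply: ler_sum => m _.
rewrite (exchange_big_dep (fun p : T * T => (2 * n <= m)%N && arc_step p.1 p.2)) /=; last first.
  by move=> z p _ /and4P[-> ->].
rewrite big_mkcond /=; apply: ler_sum => p _; case: ifP => [/andP[nm st]|_]; last first.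
  by rewrite mulr_ge0 // mulr_ge0 ?mass_ge0 ?energy_ge0.
apply: le_trans (fibre m p nm st).
apply: eq_ler; apply: eq_bigl => z.
by rewrite -!andbA.
Qed.
End Base.

(** * Carrying a local change from one partition to another *)

Section Merge.
Variables (G : sgraph) (B rho D : nat).
Implicit Types (x y z u : {set {set G}}).
Notation changed_at x y v := ((x :\: y) :|: (y :\: x) \subset powerset (ball rho v)).

(* Applies to [z] the replacement of blocks that turns [x] into [u]. *)
Definition merge x u z : {set {set G}} := (z :\: (x :\: u)) :|: (u :\: x).

(** Hence [x], [u], [z] and the merge form a square: the merge arises from [u] by the change to [z],
    and from [z] by the change to [u]. *)
Lemma mergeC x u z : merge x u z = merge x z u.
Proof.
apply/setP => A; rewrite !inE.
by case: (A \in x); case: (A \in u); case: (A \in z).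
Qed.

Lemma rebuild x y : x = (y :\: (y :\: x)) :|: (x :\: y).
Proof. by apply/setP => A; rewrite !inE; case: (A \in x); case: (A \in y). Qed.

Lemma valid_block_uniq x A C w : valid B x -> A \in x -> C \in x -> w \in A -> w \in C -> A = C.
Proof.
by move=> /valid_trivIset tx Ax Cx wA wC; rewrite -(def_pblock tx Ax wA) (def_pblock tx Cx wC).
Qed.

Lemma valid_neq0 x : valid B x -> set0 \notin x.
Proof. by case/and3P => /and3P[]. Qed.

Lemma replaced_mem x u z w C : valid B x -> valid B u -> x :\: u \subset z ->
  C \in u -> C \notin x -> w \in C -> pblock x w \in x :\: u.
Proof.
move=> vx vu sz Cu Cx wC; rewrite inE (valid_pblock w vx) andbT.
apply: contra Cx => pu; rewrite -(valid_block_uniq vu pu Cu (mem_valid_pblock w vx) wC).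
exact: (valid_pblock w vx).
Qed.

(** A block of [u] outside [x] covers vertices of blocks that [x] loses. These are all in [z], so
    [z] cannot already contain the new block. *)
Lemma merge_diff x u z : valid B x -> valid B u -> valid B z -> x :\: u \subset z ->
  z :\: merge x u z = x :\: u /\ merge x u z :\: z = u :\: x.
Proof.
move=> vx vu vz sz; split; apply/setP => A; rewrite !inE.
  have := subsetP sz A; rewrite inE.
  by case: (A \in x); case: (A \in u); case: (A \in z) => //= h; have := h isT.
case Au: (A \in u); case Ax: (A \in x) => //=; rewrite ?andbF ?orbF ?orbT ?andbT //=;
  try by case: (A \in z).
apply/negP => Az; have [w wA _] := valid_blockP vu Au.
have h := replaced_mem vx vu sz Au (negbT Ax) wA.
have := valid_block_uniq vz Az (subsetP sz _ h) wA (mem_valid_pblock w vx).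
by move=> e; move: Ax; rewrite e (valid_pblock w vx).
Qed.

Lemma merge_valid x u z : valid B x -> valid B u -> valid B z -> x :\: u \subset z ->
  valid B (merge x u z).
Proof.
move=> vx vu vz sz.
have sub A : A \in merge x u z -> A \in z \/ A \in u.
  by rewrite !inE => /orP[/andP[_ h]|/andP[_ h]]; [left|right].
apply/and3P; split; last 2 first.
- apply/forall_inP => A /sub[] h.
    by case/and3P: vz => _ /forall_inP /(_ _ h).
  by case/and3P: vu => _ /forall_inP /(_ _ h).
- apply/forall_inP => A /sub[] h.
    by case/and3P: vz => _ _ /forall_inP /(_ _ h).
  by case/and3P: vu => _ _ /forall_inP /(_ _ h).
apply/and3P; split.
- apply/eqP/setP => w; rewrite inE; apply/bigcupP.
  case h: (pblock z w \in x :\: u).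
    exists (pblock u w); last exact: (mem_valid_pblock w vu).
    rewrite !inE (valid_pblock w vu) andbT; case pu : (pblock u w \in x) => //=; last by rewrite orbT.
    move: h; rewrite inE => /andP[h1 h2].
    have e := valid_block_uniq vx h2 pu (mem_valid_pblock w vz) (mem_valid_pblock w vu).
    by rewrite e (valid_pblock w vu) in h1.
  exists (pblock z w); last exact: (mem_valid_pblock w vz).
  by rewrite inE [_ \in _ :\: _]inE h (valid_pblock w vz).
- have cross A C w : A \in z -> A \notin x :\: u -> C \in u -> C \notin x -> w \in A -> w \in C -> False.
    move=> Az nA Cu Cx wA wC; have h := replaced_mem vx vu sz Cu Cx wC.
    have e := valid_block_uniq vz Az (subsetP sz _ h) wA (mem_valid_pblock w vx).
    by rewrite e h in nA.
  apply/trivIsetP => A C hA hC; apply: contraR => /pred0Pn[w /andP[/= wA wC]]; apply/eqP.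
  move: hA hC; rewrite !(in_setU _ (_ :\: _)) ![_ \in _ :\: (_ :\: _)]in_setD ![_ \in u :\: x]in_setD.
  case/orP=> /andP[a1 a2]; case/orP=> /andP[c1 c2].
  + exact: valid_block_uniq vz a2 c2 wA wC.
  + by case: (cross _ _ _ a2 a1 c2 c1 wA wC).
  + by case: (cross _ _ _ c2 c1 a2 a1 wC wA).
  + exact: valid_block_uniq vu a2 c2 wA wC.
by apply/negP => /sub[] h; [have := valid_neq0 vz|have := valid_neq0 vu]; rewrite h.
Qed.

Lemma card_diff (x u : {set {set G}}) : (#|x| + #|u :\: x| = #|u| + #|x :\: u|)%N.
Proof. by rewrite -(cardsID u x) -(cardsID x u) [u :&: x]setIC; lia. Qed.

Lemma merge_card x u z : valid B x -> valid B u -> valid B z -> x :\: u \subset z ->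
  (#|merge x u z| + #|x| = #|z| + #|u|)%N.
Proof.
move=> vx vu vz sz; have [e1 e2] := merge_diff vx vu vz sz.
have := card_diff z (merge x u z); have := card_diff x u; rewrite e1 e2; lia.
Qed.

Lemma merge_local x u z : valid B x -> valid B u -> valid B z -> x :\: u \subset z ->
  local_change rho x u -> local_change rho z (merge x u z).
Proof.
by move=> vx vu vz sz; rewrite /local_change; have [-> ->] := merge_diff vx vu vz sz.
Qed.

(** Compared with [u], the merge shows exactly the blocks lost and gained from [x] to [v], from
    which [v] is rebuilt. *)
Lemma merge_inj x u v v' : valid B x -> valid B u -> valid B v -> valid B v' ->
  x :\: v \subset u -> x :\: v' \subset u -> merge x u v = merge x u v' -> v = v'.
Proof.
move=> vx vu vv vv' s s'; rewrite ![merge x u _]mergeC => e.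
have [a1 a2] := merge_diff vx vv vu s; have [c1 c2] := merge_diff vx vv' vu s'.
by rewrite (rebuild v x) (rebuild v' x) -a1 -a2 -c1 -c2 e.
Qed.

Hypothesis hD : max_degree_le G D.
Let M := (D.+1 ^ rho)%N.
Let C0 := (2 ^ (2 ^ M))%N.

(** The lost blocks are nonempty, disjoint and contained in one ball, which has at most [M]
    vertices. *)
Lemma local_card_diff x u : valid B x -> local_change rho x u -> (#|x| <= #|u| + M)%N.
Proof.
move=> vx /existsP[v /subsetP hv].
apply: leq_trans (_ : #|u| + #|x :\: u| <= _)%N; first by have := card_diff x u; lia.
rewrite leq_add2l; apply: leq_trans (card_ball rho v hD).
apply: leq_trans (_ : #|cover (x :\: u)| <= _)%N; last first.
  apply/subset_leq_card/subsetP => w /bigcupP[A hA wA].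
  by have := hv A; rewrite inE hA powersetE => /(_ isT) /subsetP; apply.
have tr : trivIset (x :\: u).
  apply/trivIsetP => A C; rewrite !inE => /andP[_ hA] /andP[_ hC].
  by move/trivIsetP: (valid_trivIset vx); apply.
move: tr; rewrite /trivIset => /eqP <-; rewrite -sum1_card; apply: leq_sum => A.
rewrite inE => /andP[_ hA]; rewrite card_gt0.
by apply: contraNneq (valid_neq0 vx) => <-.
Qed.

(** [y] is determined by its blocks inside the ball, and [C0] bounds the number of families of
    subsets of a ball. *)
Lemma card_local_at x v :
  (#|[set y | changed_at x y v]| <= C0)%N.
Proof.
rewrite -(card_in_imset (f := fun y => y :&: powerset (ball rho v))); last first.
  move=> y z; rewrite !inE => /subsetP hy /subsetP hz /setP e; apply/setP => A.
  have := e A; have := hy A; have := hz A; rewrite !inE.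
  case: (A \subset _); rewrite ?andbT ?andbF //.
  by case: (A \in x); case: (A \in y); case: (A \in z) => //= h1 h2;
    first [by have := h1 isT | by have := h2 isT].
apply: leq_trans (_ : #|powerset (powerset (ball rho v))| <= _)%N.
  by apply/subset_leq_card/subsetP => c /imsetP[y _ ->]; rewrite powersetE subsetIr.
by rewrite !card_powerset !leq_exp2l // card_ball.
Qed.

Lemma card_local x : (#|[set y | local_change rho x y]| <= #|G| * C0)%N.
Proof.
apply: leq_trans (_ : #|\bigcup_(v in G)
  [set y | changed_at x y v]| <= _)%N.
  apply/subset_leq_card/subsetP => y; rewrite inE => /existsP[v hv].
  by apply/bigcupP; exists v => //; rewrite inE.
by apply: card_bigcup_le => v; apply: card_local_at.
Qed.

(** A vertex of a common lost block lies in both balls, so the centre of the change to [y] is within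
    two radii of [v0]. The bound is independent of [n], whereas reductions are linearly many. *)
Lemma card_local_meet x z : valid B x -> local_change rho x z ->
  (#|[set y | local_change rho x y && ~~ [disjoint x :\: y & x :\: z]]| <= M * M * C0)%N.
Proof.
move=> vx /existsP[v0 /subsetP hv0].
pose near := \bigcup_(a in ball rho v0) ball rho a.
have cn : (#|near| <= M * M)%N.
  apply: leq_trans (_ : #|ball rho v0| * M <= _)%N; last by rewrite leq_mul2r card_ball ?orbT.
  by apply: card_bigcup_le => v; apply: card_ball.
apply: leq_trans (_ : #|near| * C0 <= _)%N; last by rewrite leq_mul2r cn orbT.
apply: leq_trans (_ : #|\bigcup_(v in near)
  [set y | changed_at x y v]| <= _)%N.
  apply/subset_leq_card/subsetP => y; rewrite inE => /andP[/existsP[v hv] /pred0Pn[A /andP[/= h1 h2]]].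
  apply/bigcupP; exists v; last by rewrite inE.
  have [w wA _] : exists2 w, w \in A & A = pblock x w.
    by apply: (valid_blockP vx); move: h1; rewrite inE => /andP[].
  apply/bigcupP; exists w.
    by have := hv0 A; rewrite in_setU h2 powersetE => /(_ isT) /subsetP; apply.
  rewrite ball_sym; move/subsetP: hv => /(_ A); rewrite in_setU h1 powersetE => /(_ isT) /subsetP; exact.
by apply: card_bigcup_le => v; apply: card_local_at.
Qed.
End Merge.

(** * Descent by averaging over reductions *)

Lemma le_average (R : realFieldType) (I : finType) (S : pred I) (m a : R) (g : I -> R) :
  0 < m -> 0 <= a -> m <= #|[set i | S i]|%:R -> (forall i, S i -> a <= g i) ->
  a <= m^-1 * \sum_(i | S i) g i.
Proof.
move=> m0 a0 hm hg; rewrite ler_pdivlMl //.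
apply: le_trans (ler_wpM2r a0 hm) _.
rewrite mulr_natl -sumr_const; apply: le_trans (_ : \sum_(i | S i) a <= _).
  by apply: eq_ler; apply: eq_bigl => i; rewrite inE.
exact: ler_sum.
Qed.

Lemma sqr_average_le (R : realFieldType) (I : finType) (S : {set I}) (f : I -> R) (c : R) :
  S != set0 ->
  (#|S|%:R^-1 * (\sum_(i in S) f i) - c) ^+ 2 <= #|S|%:R^-1 * \sum_(i in S) (f i - c) ^+ 2.
Proof.
rewrite -card_gt0 => S0; set k : R := #|S|%:R; set m := k^-1 * _.
have k0 : 0 < k by rewrite ltr0n.
have e : \sum_(i in S) (f i - c) ^+ 2 = \sum_(i in S) (f i - m) ^+ 2 + k * (m - c) ^+ 2.
  have sf : \sum_(i in S) f i = k * m by rewrite mulrA divff ?mul1r // gt_eqF.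
  rewrite (eq_bigr (fun i => (f i - m) ^+ 2 + ((m - c) * 2 * f i - (m - c) * (m + c)))).
    rewrite big_split /= sumrB -mulr_sumr sf sumr_const -mulr_natl -/k; ring.
  by move=> i _; ring.
rewrite e mulrDr mulrA mulVf ?gt_eqF // mul1r lerDr; apply: mulr_ge0; first by rewrite invr_ge0 ltW.
by apply: sumr_ge0 => i _; apply: sqr_ge0.
Qed.

Lemma merge_arith (r k X U Z T : nat) : (X = r.+1 -> U <= r -> Z <= r.+1 -> X <= U + k ->
  X <= Z + k -> T + X = Z + U -> T <= r /\ r.+1 <= T + 2 * k)%N.
Proof. lia. Qed.

Section Descent.
Variables (R : realType) (G : sgraph) (B D q rho r : nat).
Hypothesis hD : max_degree_le G D.
Hypothesis qr : (q <= r)%N.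
Hypothesis n_gt0 : (0 < #|G|)%N.
Notation n := #|G|.
Notation part := {set {set G}}.
Notation local := (local_change rho).
Let M := (D.+1 ^ rho)%N.
Let C0 := (2 ^ (2 ^ M))%N.
Variable d0 : R.
Hypothesis d0_gt0 : 0 < d0.
Notation Om := (Omega G r B).
Notation Om1 := (Omega G r.+1 B).
Definition top : {set part} := [set x in Om1 | #|x| == r.+1].
Definition red (x : part) : {set part} := [set u in Om | local x u].
Hypothesis red_large : forall x, x \in top -> d0 * n%:R <= #|red x|%:R.
Hypothesis n_large : (4 * (M * M * C0))%N%:R <= d0 * n%:R.

(** Half the guaranteed number of reductions. By [n_large] at least this many remain after
    discarding those that share a lost block with either of two given local changes. *)
Let m0 : R := d0 * n%:R / 2.
Let m0_gt0 : 0 < m0.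
Proof. by rewrite divr_gt0 // mulr_gt0 // ltr0n. Qed.

Let Om_valid x : x \in Om -> valid B x.
Proof. by rewrite OmegaE => /andP[]. Qed.
Let Om1_valid x : x \in Om1 -> valid B x.
Proof. by rewrite OmegaE => /andP[]. Qed.
Let top_valid x : x \in top -> valid B x.
Proof. by rewrite inE => /andP[/Om1_valid]. Qed.

Let compat (x u v : part) := [disjoint x :\: u & x :\: v].

Let compat_sub x u z : compat x u z -> x :\: u \subset z.
Proof.
move=> /pred0P h; apply/subsetP => A hA; have := h A; rewrite /= hA /= !inE.
by move: hA; rewrite inE => /andP[_ ->]; rewrite andbT => /negbFE.
Qed.

Let compatC x u z : compat x u z = compat x z u.
Proof. by rewrite /compat disjoint_sym. Qed.

Let card_good x z1 z2 : x \in top -> local x z1 -> local x z2 ->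
  m0 <= #|[set J | [&& J \in red x, compat x J z1 & compat x J z2]]|%:R.
Proof.
move=> xt l1 l2; have vx := top_valid xt.
set S := [set J | _].
have h : (#|red x| <= #|S| + (M * M * C0 + M * M * C0))%N.
  apply: leq_trans (_ : #|S :|: ([set y | local x y && ~~ [disjoint x :\: y & x :\: z1]] :|:
      [set y | local x y && ~~ [disjoint x :\: y & x :\: z2]])| <= _)%N.
    apply/subset_leq_card/subsetP => J hJ; apply/setUP.
    have lJ : local x J by move: hJ; rewrite inE => /andP[].
    case c1 : (compat x J z1); last by right; rewrite !inE lJ -/(compat x J z1) c1.
    case c2 : (compat x J z2); first by left; rewrite inE hJ c1 c2.
    by right; rewrite !inE lJ -/(compat x J z2) c2 orbT.
  apply: leq_trans (leq_card_setU _ _) _; rewrite leq_add2l.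
  by apply: leq_trans (leq_card_setU _ _) _; rewrite leq_add // (card_local_meet hD vx).
have h1 := red_large xt; have h2 : (#|red x|%:R : R) <= (#|S| + (M * M * C0 + M * M * C0))%:R.
  by rewrite ler_nat.
move: h2 n_large; rewrite !natrD natrM /m0; lra.
Qed.

(* On such pairs [wt] is at least 1 / (2 M)!, so they can be summed unweighted. *)
Let near_top (u v : part) : bool :=
  [&& u \in Om, v \in Om, local u v & (r.+1 <= #|u| + 2 * M)%N].

Variable f : part -> R.
Let E1 : R := \sum_(p : part * part | near_top p.1 p.2) (f p.1 - f p.2) ^+ 2.

Let E1_le : E1 <= (2 * M)`!%:R * energy B q rho r f.
Proof.
rewrite /E1 /energy (pair_big_dep (fun u => u \in Om) (fun u v => (v \in Om) && local u v)
  (fun u v => wt R q u * (f u - f v) ^+ 2)) /= mulr_sumr.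
apply: le_trans (_ : \sum_(p : part * part | near_top p.1 p.2)
    (2 * M)`!%:R * (wt R q p.1 * (f p.1 - f p.2) ^+ 2) <= _).
  apply: ler_sum => p /and4P[_ _ _ h]; rewrite mulrA ler_peMl ?sqr_ge0 //.
  rewrite /wt ler_pdivlMr ?ltr0n ?fact_gt0 // mul1r ler_nat leq_fact //; lia.
apply: ler_sum_sub => [p /and4P[-> -> -> _] //|p _].
by rewrite mulr_ge0 // mulr_ge0 ?sqr_ge0 // ltW // wt_gt0.
Qed.

Let E1_ge0 : 0 <= E1.
Proof. by apply: sumr_ge0 => p _; apply: sqr_ge0. Qed.

Notation triple := (part * (part * part))%type.

(** A triple is recovered from its image pair and its first component, and the latter is a local
    change of a member of the pair: [n * C0] possibilities for each member. *)
Let fibre_bound (phi : triple -> part * part) (S : pred triple) :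
  (forall i, S i -> near_top (phi i).1 (phi i).2) ->
  (forall i, S i -> local (phi i).1 i.1 \/ local (phi i).2 i.1) ->
  (forall i j, S i -> S j -> phi i = phi j -> i.1 = j.1 -> i = j) ->
  \sum_(i | S i) (f (phi i).1 - f (phi i).2) ^+ 2 <= (2 * (n * C0))%:R * E1.
Proof.
move=> h1 h2 h3; apply: (sum_fibres_le (F := fun p => (f p.1 - f p.2) ^+ 2)) => //.
- by move=> j _; apply: sqr_ge0.
move=> j _; rewrite ler_nat.
rewrite -(card_in_imset (f := fun i : triple => i.1)); last first.
  by move=> a c; rewrite !inE => /andP[Sa /eqP ea] /andP[Sc /eqP ec]; apply: h3; rewrite // ea ec.
apply: leq_trans (_ : #|[set y | local j.1 y] :|: [set y | local j.2 y]| <= _)%N.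
  apply/subset_leq_card/subsetP => y /imsetP[i]; rewrite inE => /andP[Si /eqP <-] ->.
  by rewrite !inE; case: (h2 i Si) => ->; rewrite ?orbT.
apply: leq_trans (leq_card_setU _ _) _; rewrite mul2n -addnn.
by apply: leq_add; apply: (card_local _ hD).
Qed.

Definition lift (x : part) : R :=
  if x \in top then #|red x|%:R^-1 * \sum_(u in red x) f u else f x.

Let Q : R := \sum_(p : part * part | (p.1 \in top) && (p.2 \in red p.1)) (lift p.1 - f p.2) ^+ 2.

Let redE x u : u \in red x -> [/\ u \in Om, valid B u & local x u].
Proof. by rewrite inE => /andP[h l]; split=> //; apply: Om_valid. Qed.

Let top_card x : x \in top -> #|x| = r.+1.
Proof. by rewrite inE => /andP[_ /eqP]. Qed.

Let merge_facts x u z : x \in top -> u \in red x -> z \in Om1 -> local x z -> compat x u z ->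
  [/\ merge x u z \in Om, local z (merge x u z), local u (merge x u z),
      (#|x| <= #|u| + M)%N & (r.+1 <= #|merge x u z| + 2 * M)%N].
Proof.
move=> xt /redE[uO vu lu] zO lz cp; have vx := top_valid xt; have vz := Om1_valid zO.
have sz := compat_sub cp; have su : x :\: z \subset u by apply: compat_sub; rewrite compatC.
have c := merge_card vx vu vz sz; have tc := top_card xt.
have b1 := local_card_diff hD vx lu; have b2 := local_card_diff hD vx lz.
have [u1 z1] : (#|u| <= r)%N /\ (#|z| <= r.+1)%N.
  by move: uO zO; rewrite !OmegaE => /andP[_ ->] /andP[_ ->].
have [a1 a2] := merge_arith tc u1 z1 b1 b2 c.
split=> //.
- by rewrite OmegaE merge_valid.
- exact: merge_local vx vu vz sz lu.
by rewrite mergeC; apply: merge_local vx vz vu su lz.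
Qed.

Let topE x : (x \in top) = (x \in Om1) && (#|x| == r.+1).
Proof. by rewrite in_set. Qed.

Let Om_Om1 x : x \in Om -> x \in Om1.
Proof. by rewrite !OmegaE => /andP[-> /leqW ->]. Qed.

Let S (i : triple) :=
  [&& i.1 \in top, i.2.1 \in red i.1, i.2.2 \in red i.1 & compat i.1 i.2.1 i.2.2].

(** Compatible reductions [u] and [v] of [x] are compared through their merge, in which both have
    been carried out; each of the two steps is a pair near the top level. *)
Let reduction_pairs : \sum_(i | S i)
     (f i.2.1 - f i.2.2) ^+ 2 <= 2 * ((2 * (n * C0))%:R * E1 + (2 * (n * C0))%:R * E1).
Proof.
apply: le_trans (_ : \sum_(i | S i) 2 * ((f i.2.1 - f (merge i.1 i.2.1 i.2.2)) ^+ 2 +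
    (f (merge i.1 i.2.1 i.2.2) - f i.2.2) ^+ 2) <= _).
  apply: ler_sum => i _; apply: le_trans (sqrD_le _ _).
  by apply: eq_ler; congr (_ ^+ 2); ring.
rewrite -mulr_sumr big_split /= ler_wpM2l // lerD //.
- apply: (fibre_bound (phi := fun i => (i.2.1, merge i.1 i.2.1 i.2.2))).
  + move=> [x [u v]] /and4P[/= xt hu hv cp]; have [vO vv lv] := redE hv.
    have [h1 h2 h3 h4 h5] := merge_facts xt hu (Om_Om1 vO) lv cp; have [uO _ _] := redE hu.
    by rewrite /near_top /= uO h1 h3 /= -(top_card xt) (leq_trans h4) // leq_add2l leq_pmull.
  + by move=> [x [u v]] /and4P[/= xt hu hv cp]; left; rewrite local_changeC; case: (redE hu).
  move=> [x [u v]] [x' [u' v']] /and4P[/= xt hu hv cp] /and4P[/= xt' hu' hv' cp'] [eu em] ex; subst x' u'.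
  congr (_, (_, _)).
  have [vO vv lv] := redE hv; have [_ vu _] := redE hu; have vx := top_valid xt.
  have [_ vv' _] := redE hv'.
  by apply: (merge_inj vx vu vv vv' _ _ em); apply: compat_sub; rewrite compatC.
apply: (fibre_bound (phi := fun i => (merge i.1 i.2.1 i.2.2, i.2.2))).
- move=> [x [u v]] /and4P[/= xt hu hv cp]; have [vO vv lv] := redE hv.
  have [h1 h2 h3 h4 h5] := merge_facts xt hu (Om_Om1 vO) lv cp.
  by rewrite /near_top /= vO h1 local_changeC h2.
- by move=> [x [u v]] /and4P[/= xt hu hv cp]; right; rewrite local_changeC; case: (redE hv).
move=> [x [u v]] [x' [u' v']] /and4P[/= xt hu hv cp] /and4P[/= xt' hu' hv' cp'] [em ev] ex; subst x' v'.
congr (_, (_, _)).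
have [_ vv _] := redE hv; have [_ vu _] := redE hu; have vx := top_valid xt.
have [_ vu' _] := redE hu'.
by apply: (merge_inj vx vv vu vu' (compat_sub cp) (compat_sub cp')); rewrite ![merge x v _]mergeC.
Qed.

Let C : R := (2 * (n * C0))%:R.
Let red_n0 x : x \in top -> red x != set0.
Proof.
move=> xt; rewrite -card_gt0 -(ltr0n R); apply: lt_le_trans (red_large xt).
by rewrite mulr_gt0 // ltr0n.
Qed.

(** Two reductions of [x] may be incompatible, but at least [m0] reductions are compatible with
    both, and averaging over these reduces the matter to [reduction_pairs]. The factor [m0^-1]
    offsets [C], which is of order [n]. *)
Let Q_le : Q <= m0^-1 * (16 * C * E1).
Proof.
pose a x := \sum_(u in red x) \sum_(v in red x | compat x u v) (f u - f v) ^+ 2.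
have pairs x u w : x \in top -> u \in red x -> w \in red x -> (f u - f w) ^+ 2 <=
    m0^-1 * (2 * (\sum_(v in red x | compat x u v) (f u - f v) ^+ 2 +
                  \sum_(v in red x | compat x w v) (f w - f v) ^+ 2)).
  move=> xt hu hw; have [_ _ lu] := redE hu; have [_ _ lw] := redE hw.
  have := le_average m0_gt0 (sqr_ge0 (f u - f w)) (card_good xt lu lw)
    (g := fun v => 2 * ((f u - f v) ^+ 2 + (f w - f v) ^+ 2)).
  move=> /(_ _)/le_trans; apply => [v _|].
    apply: le_trans (_ : ((f u - f v) + - (f w - f v)) ^+ 2 <= _).
      by apply: eq_ler; congr (_ ^+ 2); ring.
    by apply: le_trans (sqrD_le _ _) _; rewrite sqrrN.
  apply: ler_wpM2l; first by rewrite invr_ge0 ltW.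
  rewrite -mulr_sumr ler_wpM2l // big_split /= lerD //.
    apply: ler_sum_sub => [v|v _]; last exact: sqr_ge0.
    by move=> /and3P[-> h _]; rewrite compatC.
  apply: ler_sum_sub => [v|v _]; last exact: sqr_ge0.
  by move=> /and3P[-> _ h]; rewrite compatC.
have row x : x \in top -> \sum_(u in red x) (lift x - f u) ^+ 2 <= m0^-1 * (4 * a x).
  move=> xt; set k : R := #|red x|%:R.
  have k0 : 0 < k by rewrite ltr0n card_gt0 red_n0.
  apply: le_trans (_ : \sum_(u in red x) k^-1 * \sum_(w in red x) (f w - f u) ^+ 2 <= _).
    by apply: ler_sum => u _; rewrite /lift xt; apply: sqr_average_le; apply: red_n0.
  rewrite -mulr_sumr.
  apply: le_trans (_ : k^-1 * (\sum_(u in red x) \sum_(w in red x) m0^-1 *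
    (2 * (\sum_(v in red x | compat x w v) (f w - f v) ^+ 2 +
          \sum_(v in red x | compat x u v) (f u - f v) ^+ 2))) <= _).
    apply: ler_wpM2l; first by rewrite invr_ge0 ltW.
    by apply: ler_sum => u hu; apply: ler_sum => w hw; apply: pairs.
  set A := fun u => \sum_(v in red x | compat x u v) (f u - f v) ^+ 2.
  rewrite (eq_bigr (fun u => m0^-1 * (2 * (a x + k * A u)))); last first.
    by move=> u _; rewrite -mulr_sumr -mulr_sumr big_split /= sumr_const -[_ *+ #|_|]mulr_natl.
  rewrite -mulr_sumr -mulr_sumr big_split /= sumr_const -mulr_sumr -[a x *+ _]mulr_natl.
  rewrite -/(a x) -/k; apply: eq_ler; field.
  by rewrite !gt_eqF.
rewrite /Q -(pair_big_dep (fun x => x \in top) (fun x u => u \in red x)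
  (fun x u => (lift x - f u) ^+ 2)) /=.
apply: le_trans (_ : \sum_(x in top) m0^-1 * (4 * a x) <= _); first exact: ler_sum.
rewrite -mulr_sumr; apply: ler_wpM2l; first by rewrite invr_ge0 ltW.
rewrite -mulr_sumr; apply: le_trans (_ : 4 * (2 * (C * E1 + C * E1)) <= _); last by lra.
apply: ler_wpM2l => //; apply: le_trans reduction_pairs.
rewrite /a; apply: eq_ler.
under eq_bigr do rewrite (pair_big_dep (fun u => u \in red _) (fun u v => (v \in red _) && compat _ u v)
  (fun u v => (f u - f v) ^+ 2)) /=.
rewrite (pair_big_dep (fun x => x \in top) (fun x p => (p.1 \in red x) &&
   ((p.2 \in red x) && compat x p.1 p.2)) (fun x p => (f p.1 - f p.2) ^+ 2)) /=.
by [].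
Qed.
(** Data for a detour around a step from [x] to [y] that starts at the top level: [x] is reduced to
    [u], the change to [y] is applied to [u] and gives [t i], and undoing the reduction leads to
    [y]. *)
Let P (i : triple) := [&& i.1 \in top, i.2.1 \in Om1, local i.1 i.2.1,
  i.2.2 \in red i.1 & compat i.1 i.2.2 i.2.1].
Let t (i : triple) := merge i.1 i.2.2 i.2.1.

Let P_facts i : P i -> [/\ valid B i.1, valid B i.2.1, valid B i.2.2,
   near_top i.2.2 (t i) & [/\ local i.1 i.2.2, t i \in Om, local i.2.1 (t i) & (r.+1 <= #|t i| + 2 * M)%N]].
Proof.
case: i => [x [y u]] /and5P[/= xt yO ly hu cp]; have [uO vu lu] := redE hu.
have [h1 h2 h3 h4 h5] := merge_facts xt hu yO ly cp.
split=> //; [exact: top_valid | exact: Om1_valid |].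
by rewrite /near_top uO h1 h3 -(top_card xt) (leq_trans h4) // leq_add2l leq_pmull.
Qed.

Let part_A : \sum_(i | P i) (lift i.1 - f i.2.2) ^+ 2 <= (n * C0)%:R * Q.
Proof.
apply: (sum_fibres_le (phi := fun i : triple => (i.1, i.2.2))
  (F := fun p => (lift p.1 - f p.2) ^+ 2)).
- by move=> i /and5P[-> _ _ -> _].
- by move=> j _; apply: sqr_ge0.
move=> j _; rewrite ler_nat; apply: leq_trans (card_local rho hD j.1).
rewrite -(card_in_imset (f := fun i : triple => i.2.1)); last first.
  move=> [x [y u]] [x' [y' u']]; rewrite !inE /= => /andP[_ /eqP <-] /andP[_ /eqP[-> ->]] ->.
  by [].
apply/subset_leq_card/subsetP => y /imsetP[i]; rewrite inE => /andP[/and5P[_ _ l _ _] /eqP <-] ->.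
by rewrite inE.
Qed.

Let part_B : \sum_(i | P i) (f i.2.2 - f (t i)) ^+ 2 <= C * E1.
Proof.
apply: (fibre_bound (phi := fun i => (i.2.2, t i))).
- by move=> i /P_facts[].
- by move=> i /P_facts[_ _ _ _ [l _ _ _]]; left; rewrite local_changeC.
move=> [x [y u]] [x' [y' u']] hi hj /= [eu em] ex; subst x' u'; congr (_, (_, _)).
have [/= vx vy vu _ _] := P_facts hi; have [/= _ vy' _ _ _] := P_facts hj.
case/and5P: hi => _ _ _ _ /= cp; case/and5P: hj => _ _ _ _ /= cp'.
by apply: (merge_inj vx vu vy vy' _ _ em); apply: compat_sub; rewrite compatC.
Qed.

Let merge_det x y u u' : valid B x -> valid B y -> valid B u -> valid B u' ->
  compat x u y -> compat x u' y -> merge x u y = merge x u' y -> u = u'.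
Proof.
move=> vx vy vu vu' c c'; rewrite ![merge x _ y]mergeC; apply: (merge_inj vx vy vu vu');
  exact: compat_sub.
Qed.

(** If [y] is not at the top level, [lift] does not alter its value and the pair is near the top.
    Otherwise [t i] is a reduction of [y], and the term occurs in [Q]. *)
Let part_C : \sum_(i | P i) (f (t i) - lift i.2.1) ^+ 2 <= C * E1 + (n * C0)%:R * Q.
Proof.
rewrite (bigID (fun i : triple => i.2.1 \notin top)) /=; apply: lerD.
  rewrite (eq_bigr (fun i : triple => (f (t i) - f i.2.1) ^+ 2)); last first.
    by move=> i /andP[_ h]; rewrite /lift (negbTE h).
  apply: (fibre_bound (phi := fun i => (t i, i.2.1))).
  - move=> i /andP[hi nt]; have [_ _ _ _ [l tO lt ct]] := P_facts hi.
    case/and5P: hi => _ yO _ _ _; rewrite /near_top tO local_changeC lt ct andbT /=.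
    move: yO nt; rewrite topE !OmegaE => /andP[-> le]; rewrite le /= => ne.
    by rewrite -ltnS ltn_neqAle ne le.
  - by move=> i /andP[/and5P[_ _ l _ _] _]; right; rewrite local_changeC.
  move=> [x [y u]] [x' [y' u']] /andP[hi _] /andP[hj _] /= [em ey] ex; subst x' y'.
  congr (_, (_, _)).
  have [/= vx vy vu _ _] := P_facts hi; have [/= _ _ vu' _ _] := P_facts hj.
  case/and5P: hi => _ _ _ _ /= cp; case/and5P: hj => _ _ _ _ /= cp'.
  exact: merge_det cp cp' em.
rewrite (eq_bigr (fun i : triple => (lift i.2.1 - f (t i)) ^+ 2)); last first.
  by move=> i _; rewrite -sqrrN opprB.
apply: (sum_fibres_le (phi := fun i : triple => (i.2.1, t i))
  (F := fun p => (lift p.1 - f p.2) ^+ 2)).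
- move=> i /andP[/P_facts[_ _ _ _ [_ tO lt _]]]; rewrite negbK => -> /=.
  by rewrite inE tO lt.
- by move=> j _; apply: sqr_ge0.
move=> j _; rewrite ler_nat; apply: leq_trans (card_local rho hD j.1).
rewrite -(card_in_imset (f := fun i : triple => i.1)); last first.
  move=> [x [y u]] [x' [y' u']]; rewrite !inE /= => /andP[/andP[hi _] /eqP <-].
  move=> /andP[/andP[hj _] /eqP[ey em]] ex; subst x' y'; congr (_, (_, _)).
  have [/= vx vy vu _ _] := P_facts hi; have [/= _ _ vu' _ _] := P_facts hj.
  case/and5P: hi => _ _ _ _ /= cp; case/and5P: hj => _ _ _ _ /= cp'.
  exact: merge_det cp cp' (esym em).
apply/subset_leq_card/subsetP => y /imsetP[i]; rewrite inE => /andP[/andP[/and5P[_ _ l _ _] _] /eqP <-] ->.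
by rewrite inE local_changeC.
Qed.

Let top_pairs : \sum_(p : part * part | [&& p.1 \in top, p.2 \in Om1 & local p.1 p.2])
    (lift p.1 - lift p.2) ^+ 2 <= m0^-1 * (3 * (2 * C * E1 + 2 * ((n * C0)%:R * Q))).
Proof.
apply: le_trans (_ : \sum_(p : part * part | [&& p.1 \in top, p.2 \in Om1 & local p.1 p.2])
  m0^-1 * \sum_(u | (u \in red p.1) && compat p.1 u p.2)
    3 * ((lift p.1 - f u) ^+ 2 + (f u - f (t (p.1, (p.2, u)))) ^+ 2 +
         (f (t (p.1, (p.2, u))) - lift p.2) ^+ 2) <= _).
  apply: ler_sum => -[x y] /and3P[/= xt yO l].
  apply: le_average => //; first exact: sqr_ge0.
    apply: le_trans (card_good xt l l) _; rewrite ler_nat.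
    by apply/subset_leq_card/subsetP => u; rewrite inE => /and3P[h c _]; rewrite inE h c.
  move=> u _; move: (lift x) (lift y) (f u) (f (t (x, (y, u)))) => a b c d /=.
  have := sqr_ge0 ((a - c) - (c - d)); have := sqr_ge0 ((a - c) - (d - b)).
  have := sqr_ge0 ((c - d) - (d - b)); nra.
rewrite -mulr_sumr; apply: ler_wpM2l; first by rewrite invr_ge0 ltW.
under eq_bigr do rewrite -mulr_sumr.
rewrite -mulr_sumr; apply: ler_wpM2l => //.
rewrite (pair_big_dep (fun p : part * part => [&& p.1 \in top, p.2 \in Om1 & local p.1 p.2])
  (fun p u => (u \in red p.1) && compat p.1 u p.2)
  (fun p u => (lift p.1 - f u) ^+ 2 + (f u - f (t (p.1, (p.2, u)))) ^+ 2 +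
         (f (t (p.1, (p.2, u))) - lift p.2) ^+ 2)) /=.
rewrite (reindex (fun i : triple => ((i.1, i.2.1), i.2.2))) /=; last first.
  by exists (fun p : part * part * part => (p.1.1, (p.1.2, p.2))) => [[x [y u]]|[[x y] u]].
rewrite (eq_bigl P); last first.
  by move=> [x [y u]]; rewrite /P /= -!andbA.
rewrite (eq_bigr (fun i : triple => (lift i.1 - f i.2.2) ^+ 2 + (f i.2.2 - f (t i)) ^+ 2 +
  (f (t i) - lift i.2.1) ^+ 2)); last by move=> [x [y u]].
rewrite !big_split /=; have := part_A; have := part_B; have := part_C; lra.
Qed.

(** With [c = C0 / d0], dividing [n * C0] and [C] by [m0] gives [2 * c] and [4 * c]. The term
    [64 * c] bounds [Q] relative to [E1], the factorial passes from [E1] to the weighted energy, and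
    the last 2 allows the top partition at either end of a pair. *)
Definition descent_factor : R :=
  let c := C0%:R / d0 in 1 + 24 * c * (1 + 64 * c) * (2 * M)`!%:R * 2.

Lemma lift_eq x : x \in Om -> lift x = f x.
Proof.
rewrite /lift topE !OmegaE => /andP[_ le]; case: ifP => // /andP[_ /eqP e].
by rewrite e ltnn in le.
Qed.

Let Om1_nontop x : (x \in Om1) && (x \notin top) = (x \in Om).
Proof.
rewrite topE !OmegaE; case: valid => //=; rewrite -(ltnS _ r) (ltn_neqAle _ r.+1).
by case: (_ <= _)%N; case: (_ == _).
Qed.

Lemma energy_lift_le : energy B q rho r.+1 lift <= descent_factor * energy B q rho r f.
Proof.
set T := \sum_(p : part * part | [&& p.1 \in top, p.2 \in Om1 & local p.1 p.2])
  (lift p.1 - lift p.2) ^+ 2.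
have le : energy B q rho r.+1 lift <= energy B q rho r f + 2 * T.
  rewrite /energy (pair_big_dep (fun x => x \in Om1) (fun x y => (y \in Om1) && local x y)
    (fun x y => wt R q x * (lift x - lift y) ^+ 2)) /=.
  rewrite (pair_big_dep (fun x => x \in Om) (fun x y => (y \in Om) && local x y)
    (fun x y => wt R q x * (f x - f y) ^+ 2)) /=.
  have wt_le x y : wt R q x * (lift x - lift y) ^+ 2 <= (lift x - lift y) ^+ 2.
    by rewrite ler_piMl ?sqr_ge0 ?wt_le1.
  rewrite (bigID (fun p : part * part => p.1 \in top)) /= mulr2n mulrDl mul1r addrC addrA lerD //.
    rewrite (bigID (fun p : part * part => p.2 \in top)) /= addrC lerD //.
      apply: eq_ler; apply: eq_big => [p|p].
        rewrite -!Om1_nontop; case: (p.1 \in Om1); case: (p.2 \in Om1) => //=;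
          by case: (p.1 \in top); case: (p.2 \in top); rewrite ?andbT ?andbF.
      rewrite -andbA => /andP[/and3P[h1 h2 _] /andP[t1 t2]].
      by rewrite !lift_eq // -Om1_nontop ?h1 ?h2.
    rewrite /T (reindex (fun p : part * part => (p.2, p.1))) /=; last first.
      by exists (fun p : part * part => (p.2, p.1)) => -[].
    apply: le_trans (_ : \sum_(p : part * part | [&& p.2 \in Om1, p.1 \in Om1 & local p.2 p.1] &&
      (p.2 \notin top) && (p.1 \in top)) (lift p.1 - lift p.2) ^+ 2 <= _).
      by apply: ler_sum => p _; rewrite -[leRHS]sqrrN opprB; apply: wt_le.
    apply: ler_sum_sub => [p|p _]; last exact: sqr_ge0.
    by move=> /andP[/andP[/and3P[-> _]]]; rewrite local_changeC => -> _ ->.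
  apply: le_trans (_ : \sum_(p : part * part | (p.1 \in Om1) && ((p.2 \in Om1) && local p.1 p.2) &&
    (p.1 \in top)) (lift p.1 - lift p.2) ^+ 2 <= _); first by apply: ler_sum => p _; apply: wt_le.
  apply: ler_sum_sub => [p|p _]; last exact: sqr_ge0.
  by move=> /andP[/and3P[_ -> ->] ->].
apply: le_trans le _; rewrite /descent_factor; set c := C0%:R / d0.
have n0 : n%:R != 0 :> R by rewrite pnatr_eq0 -lt0n.
have d00 : d0 != 0 by rewrite gt_eqF.
have e1 : m0^-1 * (n * C0)%:R = 2 * c.
  by rewrite /m0 /c natrM; field; rewrite n0 d00.
have e2 : m0^-1 * C = 4 * c by rewrite /C natrM mulrCA e1; ring.
have c0 : 0 <= c by rewrite divr_ge0 // ltW.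
have hQ : Q <= 64 * c * E1.
  apply: le_trans Q_le _.
  by rewrite (_ : m0^-1 * _ = 16 * (m0^-1 * C) * E1); [rewrite e2; lra | ring].
have hT : T <= 24 * c * (1 + 64 * c) * E1.
  apply: le_trans top_pairs _.
  have -> : m0^-1 * (3 * (2 * C * E1 + 2 * ((n * C0)%:R * Q))) =
     6 * (m0^-1 * C) * E1 + 6 * (m0^-1 * (n * C0)%:R) * Q by ring.
  rewrite e1 e2; have : c * Q <= c * (64 * c * E1) by apply: ler_wpM2l.
  have := E1_ge0; have : 0 <= c * c * E1 by rewrite mulr_ge0 ?E1_ge0 // mulr_ge0.
  nra.
have : c * (1 + 64 * c) * E1 <= c * (1 + 64 * c) * ((2 * M)`!%:R * energy B q rho r f).
  by apply: ler_wpM2l E1_le; rewrite mulr_ge0 // addr_ge0 // mulr_ge0.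
move: hT; set k := (2 * M)`!%:R; lra.
Qed.

(** Pairs of a top partition and a reduction are counted twice: a top partition has at least
    [d0 * n] reductions, a partition is a reduction of at most [n * C0] others, and a reduction has
    weight at least [1 / M!]. *)
Lemma mass_step_le : mass R G B q r.+1 <= (1 + C0%:R / d0 * M`!%:R) * mass R G B q r.
Proof.
rewrite {1}/mass (bigID (fun x => x \notin top)) /= mulrDl mul1r; apply: lerD.
  by apply: eq_ler; apply: eq_bigl => x; rewrite Om1_nontop.
rewrite (eq_bigl (fun x => x \in top)); last first.
  by move=> x; rewrite negbK topE; case: (x \in Om1).
apply: le_trans (_ : #|top|%:R <= _).
  rewrite -sumr_const; apply: ler_sum => x _; exact: wt_le1.
suff h : d0 * n%:R * #|top|%:R <= (n * C0)%:R * (M`!%:R * mass R G B q r).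
  rewrite -(ler_pM2l (_ : 0 < d0 * n%:R)) ?mulr_gt0 ?ltr0n //; apply: le_trans h _.
  rewrite natrM; apply: eq_ler; field; by rewrite gt_eqF.
apply: le_trans (_ : \sum_(p : part * part | (p.1 \in top) && (p.2 \in red p.1))
   (M`!%:R * wt R q p.2) <= _).
  rewrite mulrC mulr_natl -sumr_const -(pair_big_dep (fun x => x \in top) (fun x u => u \in red x)
    (fun x u => M`!%:R * wt R q u)) /=; apply: ler_sum => x xt.
  apply: le_trans (red_large xt) _; rewrite -sumr_const; apply: ler_sum => u hu.
  have [uO vu lu] := redE hu; have le := local_card_diff hD (top_valid xt) lu.
  rewrite /wt ler_pdivlMr ?ltr0n ?fact_gt0 // mul1r ler_nat leq_fact //.
  by rewrite leq_subLR (leq_trans qr) // -ltnS -(top_card xt) (leq_trans le).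
rewrite /mass mulr_sumr; apply: (sum_fibres_le (phi := fun p : part * part => p.2)
  (F := fun u => M`!%:R * wt R q u)).
- by move=> p /andP[_ /redE[]].
- by move=> u _; rewrite mulr_ge0 // ltW // wt_gt0.
move=> u _; rewrite ler_nat; apply: leq_trans (card_local rho hD u).
rewrite -(card_in_imset (f := fun p : part * part => p.1)); last first.
  by move=> [x y] [x' y']; rewrite !inE /= => /andP[_ /eqP ->] /andP[_ /eqP ->] ->.
apply/subset_leq_card/subsetP => x /imsetP[p]; rewrite inE => /andP[/andP[_ hr] /eqP <-] ->.
by rewrite inE local_changeC; case: (redE hr).
Qed.
End Descent.

(** * Reductions are local changes *)

Section Reductions.
Variables (G : sgraph) (B K q : nat).

(** A block that meets [H] lies in the ball around any common vertex. A block that avoids [H] keeps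
    its label, so it sits strictly inside a block of the other partition, and every vertex gained
    belongs to [H]. *)
Lemma agree_sub (H : {set G}) (f g : {ffun G -> 'I_q}) (A : {set G}) :
  valid B (parts f) -> valid B (parts g) ->
  (forall v, v \notin H -> f v = g v) ->
  A \in parts f -> A \notin parts g ->
  exists2 h, h \in H & A \subset ball B h.
Proof.
move=> vf vg fg Af Ag; have [a aA eA] := valid_blockP vf Af.
have [[h hH hA]|nH] : (exists2 h, h \in H & h \in A) \/ (forall h, h \in H -> h \notin A).
    case h : [exists h in H, h \in A]; [left|right]; first by case/exists_inP: h => w; exists w.
    move=> w wH; apply/negP => wA; move/negbT: h; rewrite negb_exists_in => /forall_inP/(_ w wH).
    by rewrite wA.
  exists h => //; suff -> : A = pblock (parts f) h by apply: pblock_ball.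
  by rewrite eA; apply/(pblock_eqP _ _ vf); rewrite -eA.
have AH v : v \in A -> f v = g v.
  by move=> vA; apply: fg; apply: contraL vA; apply: nH.
have sub : A \subset pblock (parts g) a.
  apply/subsetP => v vA; rewrite mem_pblock_parts -!AH //.
  by move: vA; rewrite {1}eA mem_pblock_parts.
have : ~~ (pblock (parts g) a \subset A).
  apply: contra Ag => s; rewrite (_ : A = pblock (parts g) a).
    exact: (valid_pblock a vg).
  by apply/eqP; rewrite eqEsubset sub.
case/subsetPn => w wg wA; exists w.
  apply: contraR wA => /fg e; rewrite eA mem_pblock_parts AH // e.
  by move: wg; rewrite mem_pblock_parts.
apply: subset_trans sub _; move/(pblock_eqP _ _ vg): (wg) => ->; exact: pblock_ball.
Qed.

Lemma agree_local (H : {set G}) (x y : {set {set G}}) : (0 < #|G|)%N ->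
  valid B x -> valid B y -> connected_in H -> (#|H| <= K)%N -> agree_except q H x y ->
  local_change (K + B) x y.
Proof.
move=> n0 vx vy cH sH /existsP[f /existsP[g /and3P[/eqP fx /eqP gy /forallP fg]]].
have fgE v : v \notin H -> f v = g v by move=> h; apply/eqP/(implyP (fg v)).
have [h0 hh0] : exists h0, forall h, h \in H -> h \in ball K h0.
  have [->|[h0 h0H]] := set_0Vmem H.
    by have [v _] := card_gt0P n0; exists v => h; rewrite inE.
  by exists h0 => h hH; apply: connected_in_ball cH sH h0H hH.
apply/existsP; exists h0; apply/subsetP => A hA; rewrite powersetE.
have [h hH hs] : exists2 h, h \in H & A \subset ball B h.
  subst x y; move: hA; rewrite in_setU !in_setD => /orP[/andP[a1 a2]|/andP[a1 a2]].
    exact: agree_sub vx vy fgE a2 a1.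
  by apply: agree_sub vy vx _ a2 a1 => v /fgE ->.
by apply: subset_trans hs _; apply/subsetP => u; apply: ball_trans; apply: hh0.
Qed.
End Reductions.

Lemma reductions_sub_red (G : sgraph) (B K r : nat) x : (0 < #|G|)%N -> x \in top G B r ->
  reductions r.+1 B K x \subset red B (K + B) r x.
Proof.
move=> n0; rewrite in_set => /andP[]; rewrite OmegaE => /andP[vx _] _.
apply/subsetP => y; rewrite in_set => /and3P[yO le /existsP[H /and3P[cH sH ag]]].
rewrite in_set; move: yO; rewrite !OmegaE => /andP[vy _].
by rewrite vy -ltnS le /=; apply: agree_local n0 vx vy cH sH ag.
Qed.

Section Poincare.
Variables (R : realType) (G : sgraph) (B D q rho : nat) (d0 : R).
Hypothesis hD : max_degree_le G D.
Hypothesis n_gt0 : (0 < #|G|)%N.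
Hypothesis rhoB : (B <= rho)%N.
Notation n := #|G|.
Notation b := (bandwidth G).
Hypothesis d0_gt0 : 0 < d0.
Hypothesis red_large : forall r x, (q <= r)%N -> x \in top G B r ->
  d0 * n%:R <= #|red B rho r x|%:R.
Let M := (D.+1 ^ rho)%N.
Let C0 := (2 ^ (2 ^ M))%N.
Hypothesis n_large : (4 * (M * M * C0))%N%:R <= d0 * n%:R.

Definition mass_factor : R := 1 + C0%:R / d0 * M`!%:R.

Let fac0 : 0 <= descent_factor D rho d0.
Proof.
have c0 : 0 <= C0%:R / d0 by rewrite divr_ge0 // ltW.
rewrite /descent_factor /= -/M -/C0; move: c0; set c := C0%:R / d0 => c0.
by rewrite addr_ge0 // mulr_ge0 // mulr_ge0 // mulr_ge0 ?addr_ge0 // mulr_ge0.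
Qed.

Let mfac0 : 0 <= mass_factor.
Proof. by rewrite addr_ge0 // mulr_ge0 // divr_ge0 // ltW. Qed.

Lemma descend s (f : {set {set G}} -> R) : exists2 f',
  {in Omega G q B, f' =1 f} &
  energy B q rho (q + s) f' <= descent_factor D rho d0 ^+ s * energy B q rho q f.
Proof.
elim: s => [|s [f' e le]]; first by exists f => //; rewrite addn0 mul1r.
have qs : (q <= q + s)%N by apply: leq_addr.
exists (lift B rho (q + s) f').
  move=> x xq; rewrite lift_eq ?e //; move: xq; rewrite !OmegaE => /andP[-> h].
  exact: leq_trans h qs.
rewrite addnS; apply: le_trans (energy_lift_le hD qs n_gt0 d0_gt0 _ n_large _) _.
  by move=> x; apply: red_large.
by rewrite exprS -mulrA; apply: ler_wpM2l.
Qed.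

Lemma mass_descend s : mass R G B q (q + s) <= mass_factor ^+ s * mass R G B q q.
Proof.
elim: s => [|s IH]; first by rewrite addn0 mul1r.
have qs : (q <= q + s)%N by apply: leq_addr.
rewrite addnS; apply: le_trans (mass_step_le hD qs n_gt0 d0_gt0 _) _.
  by move=> x; apply: red_large.
by rewrite exprS -[leRHS]mulrA; exact: (ler_wpM2l mfac0 IH).
Qed.

(** Hybrids have at most [q + 1 + 8 * b] classes, so [1 + 8 * b] lifts extend [f] to all of them
    without altering it on [Omega G q B]. *)
Lemma spread_le (f : {set {set G}} -> R) :
  spread B q f <= (2 * (8 * n).+1 ^ 9 * q.+1 * 2 ^ (16 * b * D))%:R *
    (mass_factor * descent_factor D rho d0) ^+ (1 + 8 * b) *
    (mass R G B q q * energy B q rho q f).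
Proof.
have [f' e le] := descend (1 + 8 * b) f.
have -> : spread B q f = spread B q f'.
  by apply: eq_bigr => x xO; apply: eq_bigr => y yO; rewrite !e.
have h0 := spread_le_energy hD rhoB n_gt0 f' (erefl (q + 1 + 8 * b)%N).
apply: le_trans h0 _.
rewrite -[leRHS]mulrA; apply: ler_wpM2l => //; rewrite exprMn -addnA.
have h := ler_pM (mass_ge0 _ _ _ _ _) (energy_ge0 _ _ _ _ _) (mass_descend (1 + 8 * b)) le.
by apply: le_trans h _; rewrite mulrACA.
Qed.
End Poincare.

(** * Walks on labellings *)

Section Walk.
Variables (R : realType) (G : sgraph) (q : nat) (L : {set {ffun G -> 'I_q}}).
Notation lab := {ffun G -> 'I_q}.
Notation n := #|G|.
Hypothesis nq_gt0 : (0 < n * q)%N.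

(* The starting point [f] itself need not belong to [L]. *)
Fixpoint walk (j : nat) (f g : lab) : R :=
  if j is j'.+1 then \sum_(p : G * 'I_q | upd f p.1 p.2 \in L) walk j' (upd f p.1 p.2) g
  else (f == g)%:R.

Lemma walk_ge0 j f g : 0 <= walk j f g.
Proof. by elim: j f => [|j IH] f /=; [rewrite ler0n | apply: sumr_ge0 => p _]. Qed.

Lemma sum_walk_from j f : \sum_g walk j f g <= (n * q)%:R ^+ j.
Proof.
elim: j f => [|j IH] f /=.
  rewrite (bigD1 f) //= eqxx big1 ?addr0 ?expr0 // => g ne.
  by rewrite eq_sym (negbTE ne).
rewrite exchange_big /=; apply: le_trans (_ : \sum_(p : G * 'I_q) (n * q)%:R ^+ j <= _).
  rewrite big_mkcond /=; apply: ler_sum => p _; case: ifP => // _.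
  by rewrite exprn_ge0.
by rewrite sumr_const card_prod card_ord exprS mulr_natl.
Qed.

(** A recolouring is recovered from its result, the vertex and the old label, so a labelling is
    reached in at most [n * q] ways. *)
Lemma sum_upd_le (psi : lab -> R) : (forall f, 0 <= psi f) ->
  \sum_(i : lab * (G * 'I_q) | (i.1 \in L) && (upd i.1 i.2.1 i.2.2 \in L))
     psi (upd i.1 i.2.1 i.2.2) <= (n * q)%:R * \sum_(f in L) psi f.
Proof.
move=> p0; apply: (sum_fibres_le (phi := fun i : lab * (G * 'I_q) => upd i.1 i.2.1 i.2.2)).
- by move=> i /andP[].
- by move=> f _; apply: p0.
move=> f _; rewrite ler_nat.
have -> : (n * q = #|{: G * 'I_q}|)%N by rewrite card_prod card_ord.
apply: leq_trans (max_card [set (i.2.1, i.1 i.2.1) | i : lab * (G * 'I_q) in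
   [set i | ((i.1 \in L) && (upd i.1 i.2.1 i.2.2 \in L)) && (upd i.1 i.2.1 i.2.2 == f)]]).
rewrite card_in_imset // => -[g [v c]] [g' [v' c']]; rewrite !inE /=.
move=> /andP[_ /eqP e] /andP[_ /eqP e'] [ev ec]; subst v'.
have cc : c = c' by move/ffunP/(_ v): (etrans e (esym e')); rewrite !ffunE eqxx.
congr (_, (_, _)) => //; apply/ffunP => u; case: (eqVneq u v) => [->//|uv].
by move/ffunP/(_ u): (etrans e (esym e')); rewrite !ffunE (negbTE uv).
Qed.

Lemma sum_walk_to j g : \sum_(f in L) walk j f g <= (n * q)%:R ^+ j.
Proof.
elim: j => [|j IH] /=.
  apply: le_trans (_ : \sum_f (f == g)%:R <= _); first exact: ler_sum_sub.
  rewrite (bigD1 g) //= eqxx big1 ?addr0 ?expr0 // => f ne.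
  by rewrite (negbTE ne).
rewrite (pair_big_dep (fun f => f \in L) (fun f (p : G * 'I_q) => upd f p.1 p.2 \in L)
  (fun f p => walk j (upd f p.1 p.2) g)) /=.
apply: le_trans (sum_upd_le (psi := fun f => walk j f g) _) _; first by move=> f; apply: walk_ge0.
by rewrite exprS; apply: ler_wpM2l.
Qed.

Variable phi : lab -> R.

Definition label_form : R :=
  \sum_(f in L) \sum_(p : G * 'I_q | upd f p.1 p.2 \in L) (phi f - phi (upd f p.1 p.2)) ^+ 2.

Lemma label_form_ge0 : 0 <= label_form.
Proof. by apply: sumr_ge0 => f _; apply: sumr_ge0 => p _; apply: sqr_ge0. Qed.

Definition walk_form (j : nat) : R :=
  \sum_(f in L) \sum_g walk j f g * (phi f - phi g) ^+ 2.

(** A first step is split off with [sqrD_le]. The number [n * q] bounds both the ways to take a step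
    and the ways to have arrived by one, and the 4 absorbs the two terms. *)
Lemma walk_form_le j : walk_form j <= (4 * (n * q)%:R) ^+ j * label_form.
Proof.
set k : R := (n * q)%:R; have k1 : 1 <= k by rewrite ler1n.
have k0 : 0 <= k by apply: le_trans k1.
have F0 := label_form_ge0.
elim: j => [|j IH].
  rewrite /walk_form big1 ?expr0 ?mul1r // => f _; apply: big1 => g _ /=.
  by case: eqP => [->|_]; rewrite ?subrr ?expr0n ?mulr0 ?mul0r.
have step : walk_form j.+1 <= 2 * (k ^+ j * label_form) + 2 * (k * walk_form j).
  rewrite /walk_form /=.
  apply: le_trans (_ : \sum_(f in L) \sum_(p : G * 'I_q | upd f p.1 p.2 \in L)
    (2 * (k ^+ j * (phi f - phi (upd f p.1 p.2)) ^+ 2) +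
     2 * \sum_g walk j (upd f p.1 p.2) g * (phi (upd f p.1 p.2) - phi g) ^+ 2) <= _).
    apply: ler_sum => f fL; under eq_bigr do rewrite mulr_suml.
    rewrite exchange_big /=; apply: ler_sum => p pL; set f' := upd _ _ _.
    apply: le_trans (_ : \sum_g walk j f' g * (2 * ((phi f - phi f') ^+ 2 + (phi f' - phi g) ^+ 2)) <= _).
      apply: ler_sum => g _; apply: ler_wpM2l; first exact: walk_ge0.
      apply: le_trans (sqrD_le _ _); apply: eq_ler.
      by congr (_ ^+ 2); ring.
    rewrite [leLHS](eq_bigr (fun g => 2 * (walk j f' g * (phi f - phi f') ^+ 2) +
      2 * (walk j f' g * (phi f' - phi g) ^+ 2))); last by move=> g _; ring.
    rewrite big_split /= -!mulr_sumr -mulr_suml; apply: lerD => //; apply: ler_wpM2l => //.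
    by apply: ler_wpM2r; [apply: sqr_ge0 | apply: sum_walk_from].
  rewrite [leLHS](eq_bigr (fun f => 2 * (k ^+ j *
      \sum_(p : G * 'I_q | upd f p.1 p.2 \in L) (phi f - phi (upd f p.1 p.2)) ^+ 2) +
    2 * \sum_(p : G * 'I_q | upd f p.1 p.2 \in L)
      \sum_g walk j (upd f p.1 p.2) g * (phi (upd f p.1 p.2) - phi g) ^+ 2)); last first.
    by move=> f _; rewrite big_split /= -!mulr_sumr.
  rewrite big_split /= -!mulr_sumr; apply: lerD => //; apply: ler_wpM2l => //.
  rewrite (pair_big_dep (fun f => f \in L) (fun f (p : G * 'I_q) => upd f p.1 p.2 \in L)
    (fun f p => \sum_g walk j (upd f p.1 p.2) g * (phi (upd f p.1 p.2) - phi g) ^+ 2)) /=.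
  apply: (sum_upd_le (psi := fun f => \sum_g walk j f g * (phi f - phi g) ^+ 2)) => f.
  by apply: sumr_ge0 => g _; rewrite mulr_ge0 ?sqr_ge0 ?walk_ge0.
apply: le_trans step _.
have h1 : k * walk_form j <= k * ((4 * k) ^+ j * label_form) by apply: ler_wpM2l.
have h2 : k ^+ j * label_form <= k * ((4 * k) ^+ j * label_form).
  rewrite mulrA; apply: ler_wpM2r => //; rewrite exprMn mulrCA -[leLHS]mul1r.
  rewrite -[leLHS]mul1r; apply: ler_pM; rewrite ?mulr_ge0 ?exprn_ge0 //.
    by rewrite exprn_ege1 // ler1n.
  by apply: ler_pM; rewrite ?exprn_ge0.
rewrite exprS -mulrA -mulrA; lra.
Qed.

(** The vertices of [W] are recoloured one at a time, through the mixtures of [f] and [g] assumed to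
    be in [L]. Surplus steps give a vertex the label it already has, so the length is exactly
    [j]. *)
Lemma walk_reach j (f g : lab) (W : {set G}) : (0 < n)%N ->
  (#|W| <= j)%N -> (forall v, v \notin W -> f v = g v) ->
  (forall U : {set G}, U \subset W -> [ffun v => if v \in U then g v else f v] \in L) ->
  1 <= walk j f g.
Proof.
move=> n0; elim: j f W => [|j IH] f W sW fg hyb.
  have W0 : W = set0 by apply/eqP; rewrite -cards_eq0 -leqn0.
  have -> : f = g by apply/ffunP => v; apply: fg; rewrite W0 inE.
  by rewrite /= eqxx.
have [v [vW hv]] : exists v, (v \in W \/ W = set0) /\ upd f v (g v) \in L.
  have [W0|[v vW]] := set_0Vmem W.
    have [v _] := card_gt0P n0; exists v; split; first by right.
    have := hyb set0 (sub0set _); congr (_ \in L); apply/ffunP => u; rewrite !ffunE inE.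
    by case: eqP => // ->; apply: fg; rewrite W0 inE.
  exists v; split; first by left.
  have := hyb [set v]; rewrite sub1set => /(_ vW); congr (_ \in L).
  by apply/ffunP => u; rewrite !ffunE inE; case: eqP => // ->.
rewrite /= (bigD1 (v, g v)) //=.
suff h : 1 <= walk j (upd f v (g v)) g.
  by rewrite (le_trans h) // lerDl; apply: sumr_ge0 => p _; apply: walk_ge0.
apply: (IH _ (W :\ v)).
- case: vW => [vW|W0]; first by move: sW; rewrite (cardsD1 v) vW.
  by rewrite W0 set0D cards0.
- move=> u; rewrite !inE negb_and negbK ffunE; case: eqP => [-> //|_] /= uW; exact: fg.
move=> U /subsetP UW; have := hyb (U :|: (W :&: [set v])).
have -> : U :|: (W :&: [set v]) \subset W.
  apply/subsetP => u; rewrite !inE => /orP[/UW|/andP[]//]; by rewrite !inE => /andP[].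
move=> /(_ isT); congr (_ \in L); apply/ffunP => u; rewrite !ffunE !inE.
case uU : (u \in U) => //=; case: (eqVneq u v) => [->|_]; rewrite ?andbF ?andbT //.
by case: ifP => // /negbT /fg.
Qed.
End Walk.

Section LabelSums.
Variables (R : realType) (G : sgraph) (q : nat).
Notation lab := {ffun G -> 'I_q}.

Lemma weightE (x : {set {set G}}) : (#|x| <= q)%N -> weight R q x = (q ^_ #|x|)%:R.
Proof.
move=> le; rewrite /weight -(ffact_fact le) natrM mulfK //.
by rewrite pnatr_eq0 -lt0n fact_gt0.
Qed.

Lemma weight_wt (x : {set {set G}}) : weight R q x = q`!%:R * wt R q x.
Proof. by []. Qed.

Lemma sum_labels (S : pred {set {set G}}) (h : {set {set G}} -> R) :
  (forall x, S x -> is_qpartition q x) ->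
  \sum_(f : lab | S (parts f)) h (parts f) = \sum_(x | S x) weight R q x * h x.
Proof.
move=> hS; rewrite (partition_big (@parts G q) S) //=; apply: eq_bigr => x Sx.
rewrite (eq_bigr (fun=> h x)); last by move=> f /andP[_ /eqP ->].
rewrite sumr_const -mulr_natl; congr (_ * _); have qx := hS x Sx.
rewrite weightE; last by case/andP: qx.
rewrite -(card_labels qx); congr (_%:R); apply: eq_card => f; rewrite !inE unfold_in /=.
by case: eqP => [->|]; rewrite ?Sx ?andbF.
Qed.
End LabelSums.

(** * From contiguous partitions to labellings of all states *)

Section Compare.
Variables (R : realType) (G : sgraph) (B D q rho K : nat).
Hypothesis hD : max_degree_le G D.
Hypothesis n_gt0 : (0 < #|G|)%N.
Hypothesis q_gt0 : (0 < q)%N.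
Hypothesis leK : (D.+1 ^ rho <= K)%N.
Notation n := #|G|.
Notation Om := (Omega G q B).
Notation lab := {ffun G -> 'I_q}.

Definition LK : {set lab} := [set f | parts f \in OmegaK G q B K].
Definition L0 : {set lab} := [set f | parts f \in Om].

Lemma in_OmegaK (f g : lab) (W : {set G}) : parts g \in Om -> (#|W| <= K)%N ->
  (forall v, v \notin W -> f v = g v) -> f \in LK.
Proof.
move=> gO sW fg; rewrite !in_set parts_qpartition /=.
apply/existsP; exists (parts g); rewrite gO /=; apply/existsP; exists W; rewrite sW /=.
apply/existsP; exists f; apply/existsP; exists g; rewrite /labels !eqxx /=.
by apply/forallP => v; apply/implyP => /fg ->.
Qed.

Lemma L0_sub : L0 \subset LK.
Proof.
apply/subsetP => f; rewrite in_set => fO.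
by apply: (in_OmegaK (W := set0) fO); rewrite ?cards0.
Qed.

Let nq : (0 < n * q)%N. Proof. by rewrite muln_gt0 n_gt0. Qed.

Lemma walk_to_L0 f : f \in LK -> exists2 g, g \in L0 & 1 <= walk R LK K f g.
Proof.
rewrite !in_set => /andP[_ /existsP[w /andP[wO /existsP[W /andP[sW]]]]].
move=> /existsP[f1 /existsP[g1 /and3P[/eqP lf /eqP lg /forallP fg]]].
(* The witnesses of agreement label the same partition as [f], but perhaps differently; a
   permutation of labels makes the contiguous one agree with [f] itself outside [W]. *)
have [s hs] : exists s : {perm 'I_q}, {in [set: G], forall u, s (f1 u) = f u}.
  by apply: relabel => u v _ _; move: (lf) => /eqP/parts_eqP ->.
have sE u : s (f1 u) = f u by apply: hs; rewrite inE.
pose g : lab := [ffun v => s (g1 v)].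
have gO : parts g \in Om by rewrite parts_comp /parts lg.
have fgE v : v \notin W -> f v = g v.
  by move=> h; rewrite ffunE -sE; congr (s _); apply/eqP/(implyP (fg v)).
exists g; first by rewrite in_set.
apply: (walk_reach R (W := W)) => // U /subsetP UW.
apply: (in_OmegaK (W := W) gO sW) => v vW; rewrite ffunE.
by case: ifP => // _; apply: fgE.
Qed.

(** Only vertices of lost classes need new labels. They lie in one ball, hence number at most [K],
    and every mixture on the way differs from the contiguous [f] only there; this is what [K] must
    accommodate. *)
Lemma walk_local (f : lab) (y : {set {set G}}) : f \in L0 -> y \in Om ->
  local_change rho (parts f) y -> exists2 g, parts g = y & 1 <= walk R LK K f g.
Proof.
rewrite in_set => fO yO /existsP[v0 /subsetP hv].
have vx : valid B (parts f) by move: fO; rewrite OmegaE => /andP[].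
have vy : valid B y by move: yO; rewrite OmegaE => /andP[].
have [g0 e0] : exists g0 : lab, parts g0 = y.
  by apply: exists_label; move: yO; rewrite in_set => /and3P[].
pose W := cover (parts f :\: y).
have sW : (#|W| <= K)%N.
  apply: leq_trans (leq_trans (card_ball rho v0 hD) leK).
  apply/subset_leq_card/subsetP => w /bigcupP[A hA wA].
  by have := hv A; rewrite in_setU hA powersetE => /(_ isT) /subsetP; apply.
have common u : u \notin W -> pblock (parts f) u = pblock y u.
  move=> uW; have : pblock (parts f) u \in y.
    apply: contraR uW => h; apply/bigcupP; exists (pblock (parts f) u).
      by rewrite in_setD h (valid_pblock u vx).
    exact: (mem_valid_pblock u vx).
  move=> h; exact: valid_block_uniq vy h (valid_pblock u vy) (mem_valid_pblock u vx) (mem_valid_pblock u vy).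
have [s hs] : exists s : {perm 'I_q}, {in ~: W, forall u, s (g0 u) = f u}.
  apply: relabel => u v; rewrite !in_setC => uW vW.
  by rewrite -!mem_pblock_parts e0 common.
pose g : lab := [ffun v => s (g0 v)].
have fgE v : v \notin W -> f v = g v by move=> h; rewrite ffunE hs // in_setC.
exists g; first by rewrite parts_comp.
apply: (walk_reach R (W := W)) => // U /subsetP UW.
apply: (in_OmegaK (W := W) fO sW) => v vW; rewrite ffunE.
by case: ifP => // /UW; rewrite (negbTE vW).
Qed.

Variable A : R.
Hypothesis A_ge0 : 0 <= A.
Hypothesis spreadA : forall f : {set {set G}} -> R,
  spread B q f <= A * (mass R G B q q * energy B q rho q f).

Variable psi : {set {set G}} -> R.
Let phi (f : lab) : R := psi (parts f).
Let WK := walk_form LK phi K.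
Let k : R := (n * q)%:R.

Let Om_q x : x \in Om -> is_qpartition q x.
Proof. by rewrite in_set => /and3P[]. Qed.

Let energy_le : q`!%:R * energy B q rho q psi <= WK.
Proof.
have -> : q`!%:R * energy B q rho q psi =
    \sum_(f in L0) \sum_(y in Om | local_change rho (parts f) y) (phi f - psi y) ^+ 2.
  rewrite (eq_bigl (fun f => parts f \in Om)); last by move=> f; rewrite in_set.
  rewrite (sum_labels (S := fun x => x \in Om) (fun x =>
    \sum_(y in Om | local_change rho x y) (psi x - psi y) ^+ 2)) //.
  rewrite /energy mulr_sumr; apply: eq_bigr => x _; rewrite weight_wt -mulrA.
  by congr (_ * _); rewrite mulr_sumr.
apply: le_trans (_ : \sum_(f in L0) \sum_g walk R LK K f g * (phi f - phi g) ^+ 2 <= _); last first.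
  apply: ler_sum_sub => [f|f _]; first exact: (subsetP L0_sub).
  by apply: sumr_ge0 => g _; rewrite mulr_ge0 ?sqr_ge0 ?walk_ge0.
apply: ler_sum => f fO.
rewrite [leRHS](partition_big (@parts G q) predT) //=.
apply: le_trans (_ : \sum_(y in Om | local_change rho (parts f) y)
  \sum_(g | parts g == y) walk R LK K f g * (phi f - phi g) ^+ 2 <= _); last first.
  apply: ler_sum_sub => // y _; apply: sumr_ge0 => g _.
  by rewrite mulr_ge0 ?sqr_ge0 ?walk_ge0.
apply: ler_sum => y /andP[yO l]; have [g eg wg] := walk_local fO yO l.
rewrite (bigD1 g) /=; last by rewrite eg.
rewrite /phi eg -[leLHS]mul1r; apply: le_trans (ler_wpM2r (sqr_ge0 _) wg) _.
rewrite lerDl; apply: sumr_ge0 => g' _.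
by rewrite mulr_ge0 ?sqr_ge0 ?walk_ge0.
Qed.

Let WK_ge0 : 0 <= WK.
Proof.
by apply: sumr_ge0 => f _; apply: sumr_ge0 => g _; rewrite mulr_ge0 ?sqr_ge0 ?walk_ge0.
Qed.

Let mass_eq : q`!%:R * mass R G B q q = #|L0|%:R.
Proof.
rewrite -sumr_const (eq_bigl (fun f : lab => parts f \in Om)); last by move=> f; rewrite in_set.
rewrite (sum_labels (S := fun x => x \in Om) (fun=> 1)) //.
by rewrite mulr_sumr; apply: eq_bigr => x _; rewrite mulr1 weight_wt.
Qed.

Let L0_pairs : \sum_(f in L0) \sum_(g in L0) (phi f - phi g) ^+ 2 <= A * #|L0|%:R * WK.
Proof.
have -> : \sum_(f in L0) \sum_(g in L0) (phi f - phi g) ^+ 2 =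
    q`!%:R * (q`!%:R * spread B q psi).
  have e (c : R) : \sum_(g in L0) (c - phi g) ^+ 2 =
      \sum_(y in Om) weight R q y * (c - psi y) ^+ 2.
    rewrite -(sum_labels (S := fun x => x \in Om) (fun y => (c - psi y) ^+ 2)) //.
    by apply: eq_bigl => g; rewrite in_set.
  under eq_bigr do rewrite e.
  rewrite (eq_bigl (fun f : lab => parts f \in Om)); last by move=> f; rewrite in_set.
  rewrite (sum_labels (S := fun x => x \in Om) (fun x =>
    \sum_(y in Om) weight R q y * (psi x - psi y) ^+ 2)) //.
  rewrite /spread !mulr_sumr; apply: eq_bigr => x _; rewrite !mulr_sumr.
  by apply: eq_bigr => y _; rewrite !weight_wt; ring.
apply: le_trans (_ : q`!%:R * (q`!%:R * (A * (mass R G B q q * energy B q rho q psi))) <= _).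
  by do 2! apply: ler_wpM2l => //.
rewrite (_ : _ * _ = A * #|L0|%:R * (q`!%:R * energy B q rho q psi)).
  by apply: ler_wpM2l => //; rewrite mulr_ge0.
by rewrite -mass_eq; ring.
Qed.

(** A contiguous labelling joined to [f] by a walk; the default value does not occur on [LK]. *)
Let proj (f : lab) : lab := odflt f [pick g in L0 | 1 <= walk R LK K f g].

Let projP f : f \in LK -> proj f \in L0 /\ 1 <= walk R LK K f (proj f).
Proof.
move=> /walk_to_L0[g g0 gw]; rewrite /proj; case: pickP => [h /andP[]//|/(_ g)].
by rewrite g0 gw.
Qed.

Let proj_sum : \sum_(f in LK) (phi f - phi (proj f)) ^+ 2 <= WK.
Proof.
apply: ler_sum => f fL; have [_ h] := projP fL; rewrite (bigD1 (proj f)) //=.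
rewrite -[leLHS]mul1r; apply: le_trans (ler_wpM2r (sqr_ge0 _) h) _.
by rewrite lerDl; apply: sumr_ge0 => g' _; rewrite mulr_ge0 ?sqr_ge0 ?walk_ge0.
Qed.

(** Every member of the fibre has a walk to [g], and at most [k ^+ K] walks of this length end at
    [g]. *)
Let proj_fibre g : #|[set f | (f \in LK) && (proj f == g)]|%:R <= k ^+ K.
Proof.
apply: le_trans (_ : _ <= \sum_(f in LK) walk R LK K f g) (sum_walk_to _ _ _ _).
rewrite -sumr_const; apply: le_trans (_ : \sum_(f in [set f | (f \in LK) && (proj f == g)]) walk R LK K f g <= _).
  by apply: ler_sum => f; rewrite in_set => /andP[/projP[_ h] /eqP <-].
by apply: ler_sum_sub => [f|f _]; [rewrite in_set => /andP[] | apply: walk_ge0].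
Qed.

Let proj_pairs : \sum_(f in LK) \sum_(g in LK) (phi (proj f) - phi (proj g)) ^+ 2 <=
  k ^+ K * (k ^+ K * \sum_(f in L0) \sum_(g in L0) (phi f - phi g) ^+ 2).
Proof.
have one (c : R) : \sum_(g in LK) (c - phi (proj g)) ^+ 2 <= k ^+ K * \sum_(g in L0) (c - phi g) ^+ 2.
  apply: (sum_fibres_le (F := fun g => (c - phi g) ^+ 2)) => [f /projP[]//|g _|g _].
    exact: sqr_ge0.
  exact: proj_fibre.
apply: le_trans (_ : \sum_(f in LK) k ^+ K * \sum_(g in L0) (phi (proj f) - phi g) ^+ 2 <= _).
  by apply: ler_sum => f _; apply: one.
rewrite -mulr_sumr; apply: ler_wpM2l; first by rewrite exprn_ge0.
apply: (sum_fibres_le (F := fun f => \sum_(g in L0) (phi f - phi g) ^+ 2)) => [f /projP[]//|g _|g _].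
  by apply: sumr_ge0 => h _; apply: sqr_ge0.
exact: proj_fibre.
Qed.

(** [f] and [g] are compared by way of [proj f] and [proj g]. The outer legs are controlled by
    walks, and the middle one by the inequality [spreadA] for contiguous partitions, whose energy is
    again realised by walks. *)
Lemma label_poincare : \sum_(f in LK) \sum_(g in LK) (phi f - phi g) ^+ 2 <=
  #|LK|%:R * (6 + 3 * (k ^+ K * k ^+ K) * A) * ((4 * k) ^+ K * label_form LK phi).
Proof.
apply: le_trans (_ : _ <= #|LK|%:R * (6 + 3 * (k ^+ K * k ^+ K) * A) * WK) _; last first.
  apply: ler_wpM2l; last exact: (walk_form_le LK nq phi K).
  by rewrite mulr_ge0 // addr_ge0 // !mulr_ge0 // exprn_ge0.
have tri (a b c d : R) : (a - b) ^+ 2 <= 3 * (a - c) ^+ 2 + 3 * (c - d) ^+ 2 + 3 * (b - d) ^+ 2.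
  have := sqr_ge0 ((a - c) - (c - d)); have := sqr_ge0 ((a - c) - (d - b)).
  have := sqr_ge0 ((c - d) - (d - b)); nra.
apply: le_trans (_ : \sum_(f in LK) \sum_(g in LK) (3 * (phi f - phi (proj f)) ^+ 2 +
   3 * (phi (proj f) - phi (proj g)) ^+ 2 + 3 * (phi g - phi (proj g)) ^+ 2) <= _).
  by apply: ler_sum => f _; apply: ler_sum => g _; apply: tri.
rewrite [leLHS](eq_bigr (fun f => #|LK|%:R * (3 * (phi f - phi (proj f)) ^+ 2) +
   3 * \sum_(g in LK) (phi (proj f) - phi (proj g)) ^+ 2 +
   3 * \sum_(g in LK) (phi g - phi (proj g)) ^+ 2)); last first.
  by move=> f _; rewrite !big_split /= sumr_const -[_ *+ #|_|]mulr_natl !mulr_sumr.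
rewrite !big_split /= sumr_const -[_ *+ #|_|]mulr_natl -!mulr_sumr.
set X1 := \sum_(f in LK) _ ^+ 2; set X2 := \sum_(f in LK) \sum_(g in LK) _.
have h1 : X1 <= WK := proj_sum.
have h2 : X2 <= (k ^+ K * k ^+ K * A) * #|LK|%:R * WK.
  apply: le_trans proj_pairs _; rewrite mulrA.
  apply: le_trans (ler_wpM2l _ L0_pairs) _; first by rewrite mulr_ge0 // exprn_ge0.
  rewrite mulrA; apply: ler_wpM2r => //; rewrite mulrA; apply: ler_wpM2l.
    by rewrite mulr_ge0 // mulr_ge0 // exprn_ge0.
  by rewrite ler_nat; apply/subset_leq_card/L0_sub.
have h3 : #|LK|%:R * X1 <= #|LK|%:R * WK by apply: ler_wpM2l.
move: (k ^+ K * k ^+ K) h2 => z h2.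
rewrite (_ : #|LK|%:R * (6 + 3 * z * A) * WK = 3 * (#|LK|%:R * WK) + 3 * (z * A * #|LK|%:R * WK) +
  3 * (#|LK|%:R * WK)); last by ring.
rewrite ![#|LK|%:R * (3 * _)]mulrCA.
by apply: lerD; [apply: lerD|]; apply: ler_wpM2l.
Qed.
End Compare.

(** * Mixing of reversible chains *)

Lemma weighted_cauchy (R : realFieldType) (I : finType) (p a : I -> R) :
  (forall i, 0 <= p i) ->
  (\sum_i p i * a i) ^+ 2 <= (\sum_i p i) * \sum_i p i * a i ^+ 2.
Proof.
move=> p0.
have : 0 <= \sum_i \sum_j p i * p j * (a i - a j) ^+ 2.
  by apply: sumr_ge0 => i _; apply: sumr_ge0 => j _; rewrite mulr_ge0 ?sqr_ge0 // mulr_ge0.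
have -> : \sum_i \sum_j p i * p j * (a i - a j) ^+ 2 =
    2 * ((\sum_i p i) * (\sum_i p i * a i ^+ 2)) - 2 * (\sum_i p i * a i) ^+ 2.
  rewrite expr2 !mulr_suml.
  transitivity (\sum_i \sum_j (p i * a i ^+ 2 * p j + p i * (p j * a j ^+ 2) -
      2 * (p i * a i) * (p j * a j))).
    by apply: eq_bigr => i _; apply: eq_bigr => j _; ring.
  under eq_bigr do rewrite sumrB big_split /= -!mulr_sumr.
  rewrite sumrB big_split /= -!mulr_suml -mulr_sumr; ring.
by rewrite subr_ge0 ler_pM2l.
Qed.

Section Mixing.
Variables (R : realType) (S : finType) (P : S -> S -> R) (pi : S -> R).
Hypothesis P_ge0 : forall x y, 0 <= P x y.
Hypothesis P_sum : forall x, \sum_y P x y = 1.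
Hypothesis pi_gt0 : forall x, 0 < pi x.
Hypothesis pi_sum : \sum_x pi x = 1.
Hypothesis reversible : forall x y, pi x * P x y = pi y * P y x.

Lemma reversible_stationary : stationary P pi.
Proof.
split; first by split=> // x; apply/ltW.
by move=> y; rewrite /evolve; under eq_bigr do rewrite reversible; rewrite -mulr_sumr P_sum mulr1.
Qed.

Lemma dist_afterS x t y : dist_after P x t.+1 y = \sum_z dist_after P x t z * P z y.
Proof. by []. Qed.

Lemma iter_evolve t (mu : S -> R) y :
  iter t (evolve P) mu y = \sum_x mu x * dist_after P x t y.
Proof.
elim: t y => [|t IH] y.
  rewrite /dist_after /= (bigD1 y) //= eqxx mulr1 big1 ?addr0 // => x ne.
  by rewrite eq_sym (negbTE ne) mulr0.
rewrite iterS /evolve; under eq_bigr do rewrite IH mulr_suml.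
rewrite exchange_big; apply: eq_bigr => x _; rewrite dist_afterS mulr_sumr.
by apply: eq_bigr => z _; rewrite mulrA.
Qed.

Lemma dist_after_ge0 x t y : 0 <= dist_after P x t y.
Proof.
elim: t y => [|t IH] y; first by rewrite ler0n.
by rewrite dist_afterS; apply: sumr_ge0 => z _; rewrite mulr_ge0.
Qed.

Lemma dist_after_sum x t : \sum_y dist_after P x t y = 1.
Proof.
elim: t => [|t IH].
  by rewrite (bigD1 x) //= eqxx big1 ?addr0 // => y /negbTE ->.
under eq_bigr do rewrite dist_afterS.
rewrite exchange_big -[RHS]IH; apply: eq_bigr => z _.
by rewrite -mulr_sumr P_sum mulr1.
Qed.

Lemma stationary_iter (mu : S -> R) t : evolve P mu =1 mu -> iter t (evolve P) mu =1 mu.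
Proof.
move=> h; elim: t => [|t IH] y //.
by rewrite iterS -[RHS]h /evolve; apply: eq_bigr => x _; rewrite IH.
Qed.

(** A stationary [mu] is a mixture of the laws started at single states, so it is as close to [pi]
    as the worst of these; at level [c / 4] the distance [c] would be at most [c / 2]. *)
Lemma stationary_unique (mu : S -> R) :
  (forall delta, 0 < delta -> exists t, mixed P pi delta t) ->
  stationary P mu -> mu =1 pi.
Proof.
move=> hmix [[mu0 mu1] st] y.
suff : \sum_x `|mu x - pi x| <= 0.
  move=> h; apply/eqP; rewrite -subr_eq0 -normr_le0; apply: le_trans h.
  by rewrite (bigD1 y) //= lerDl; apply: sumr_ge0.
rewrite leNgt; apply/negP => c0; set c := \sum_x _ in c0.
have [|t ht] := hmix (c / 4); first by rewrite divr_gt0.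
suff : c <= c / 2 by have := c0; lra.
apply: le_trans (_ : \sum_z mu z * \sum_x `|dist_after P z t x - pi x| <= _).
  under [leRHS]eq_bigr do rewrite mulr_sumr.
  rewrite exchange_big /=; apply: ler_sum => x _.
  rewrite -(stationary_iter t st x) iter_evolve -[X in `|_ - X|]mul1r -mu1 mulr_suml -sumrB.
  apply: le_trans (ler_norm_sum _ _ _) _; apply: ler_sum => z _.
  by rewrite -mulrBr normrM ger0_norm.
apply: le_trans (_ : \sum_z mu z * (c / 2) <= _); last by rewrite -mulr_suml mu1 mul1r.
apply: ler_sum => z _; apply: ler_wpM2l => //; have := ht z; rewrite /tv; lra.
Qed.

Lemma mixing_time_exists delta t : mixed P pi delta t ->
  exists s, is_mixing_time P pi delta s /\ (s <= t)%N.
Proof.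
move=> ht; pose b s := [forall x, tv (dist_after P x s) pi <= delta].
have bP s : reflect (mixed P pi delta s) (b s) by apply: forallP.
have ex : exists s, b s by exists t; apply/bP.
case: (ex_minnP ex) => s /bP hs min; exists s; split; last exact/min/bP.
by split=> // s' /bP; apply: min.
Qed.

Section Gap.
Variables (theta A : R).
Hypothesis theta_gt0 : 0 < theta.
Hypothesis lazy : forall x, theta <= P x x.
Hypothesis A_large : 2 * theta <= A.
Hypothesis poincare : forall f : S -> R,
  \sum_x \sum_y pi x * pi y * (f x - f y) ^+ 2 <=
    A * \sum_x \sum_y pi x * P x y * (f x - f y) ^+ 2.

Let op (f : S -> R) x := \sum_y P x y * f y.
Let mean (f : S -> R) := \sum_x pi x * f x.
Let var (f : S -> R) := \sum_x pi x * (f x) ^+ 2 - (mean f) ^+ 2.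
Let beta := 2 * theta / A.
Let A_gt0 : 0 < A.
Proof. by apply: lt_le_trans A_large; rewrite mulr_gt0. Qed.

Let var_pairs f : \sum_x \sum_y pi x * pi y * (f x - f y) ^+ 2 = 2 * var f.
Proof.
transitivity (\sum_x \sum_y (pi x * f x ^+ 2 * pi y + pi x * (pi y * f y ^+ 2) -
      2 * (pi x * f x) * (pi y * f y))).
  by apply: eq_bigr => i _; apply: eq_bigr => j _; ring.
under eq_bigr do rewrite sumrB big_split /= -!mulr_sumr.
rewrite sumrB big_split /= -!mulr_suml -mulr_sumr !pi_sum -/(mean f) /var; ring.
Qed.

Let mean_op f : mean (op f) = mean f.
Proof.
rewrite /mean /op; under eq_bigr do rewrite mulr_sumr.
rewrite exchange_big /=; apply: eq_bigr => y _.
under eq_bigr do rewrite mulrA reversible.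
by rewrite -mulr_suml -mulr_sumr P_sum mulr1.
Qed.

(* By Cauchy-Schwarz, a holding probability of [theta] keeps that fraction of the
   mean square step inside the variance of each row. *)
Let row_variance f x :
  theta * \sum_y P x y * (f x - f y) ^+ 2 <= \sum_y P x y * f y ^+ 2 - (op f x) ^+ 2.
Proof.
pose V := \sum_y P x y * (f x - f y) ^+ 2.
have eV : V = f x ^+ 2 - 2 * f x * op f x + \sum_y P x y * f y ^+ 2.
  rewrite /V (eq_bigr (fun y => P x y * f x ^+ 2 - 2 * f x * (P x y * f y) + P x y * f y ^+ 2)).
    by rewrite big_split sumrB /= -mulr_suml P_sum mul1r -mulr_sumr.
  by move=> y _; ring.
pose p y := P x y * (y != x)%:R.
have sp : \sum_y p y = 1 - P x x.
  rewrite -(P_sum x) (bigD1 x) //= [X in _ = X - _](bigD1 x) //= /p eqxx mulr0 add0r addrAC subrr add0r.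
  by apply: eq_bigr => y ->; rewrite mulr1.
have p0 y : 0 <= p y by rewrite mulr_ge0.
have V0 : 0 <= V by apply: sumr_ge0 => y _; rewrite mulr_ge0 ?sqr_ge0.
have cs : (f x - op f x) ^+ 2 <= (1 - P x x) * V.
  have -> : f x - op f x = \sum_y p y * (f x - f y).
    rewrite -[f x in LHS]mul1r -(P_sum x) mulr_suml -sumrB; apply: eq_bigr => y _.
    by rewrite /p; case: (eqVneq y x) => [->|_]; rewrite ?subrr ?mulr1 ?mulr0 // mulrBr.
  apply: le_trans (weighted_cauchy _ p0) _; rewrite sp; apply: ler_wpM2l.
    by rewrite subr_ge0 -(P_sum x) (bigD1 x) //= lerDl sumr_ge0.
  apply: ler_sum => y _; rewrite /p; case: (y != x); rewrite ?mulr1 // mulr0 mul0r.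
  by rewrite mulr_ge0 ?sqr_ge0.
have := lazy x; rewrite -/V; move: cs eV V0; set W := \sum_y _ * f y ^+ 2; set o := op f x; nra.
Qed.

(** A step lowers the variance by at least [theta] times the Dirichlet form, and [poincare] bounds
    that form below by [2 / A] times the variance. The holding probability replaces a bound on the
    smallest eigenvalue. *)
Let var_op f : var (op f) <= (1 - beta) * var f.
Proof.
have h : theta * \sum_x \sum_y pi x * P x y * (f x - f y) ^+ 2 <= var f - var (op f).
  rewrite /var mean_op opprB addrA subrK.
  have -> : \sum_x pi x * f x ^+ 2 = \sum_x pi x * \sum_y P x y * f y ^+ 2.
    exact: esym (mean_op (fun x => f x ^+ 2)).
  rewrite -sumrB mulr_sumr; apply: ler_sum => x _; rewrite -mulrBr.
  under eq_bigr do rewrite -mulrA.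
  by rewrite -mulr_sumr mulrCA; apply: ler_wpM2l; [apply/ltW | apply: row_variance].
have := poincare f; rewrite var_pairs; move: h; set E := \sum_x _ => h1 h2.
have h3 : theta / A * (2 * var f) <= theta / A * (A * E).
  by apply: ler_wpM2l => //; rewrite divr_ge0 // ltW.
have e : theta / A * (A * E) = theta * E by field; rewrite gt_eqF.
rewrite /beta; rewrite e in h3; have -> : 2 * theta / A = theta / A * 2 by ring.
lra.
Qed.

Let density x t y := dist_after P x t y / pi y.

(** Reversibility turns the evolution of the law into the action of [op] on its density. *)
Let densityS x t y : density x t.+1 y = op (density x t) y.
Proof.
rewrite /density dist_afterS /op mulr_suml; apply: eq_bigr => z _.
have h : P z y / pi y = P y z / pi z.
  have n0 z' : pi z' != 0 by rewrite gt_eqF.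
  apply: (canLR (mulfK (n0 y))); rewrite mulrAC; apply: (canRL (mulfK (n0 z))).
  by rewrite [LHS]mulrC [RHS]mulrC.
by rewrite -mulrA h; ring.
Qed.

Let beta_le1 : 0 <= 1 - beta.
Proof. by rewrite subr_ge0 /beta ler_pdivrMr // mul1r. Qed.

Let var_density x t : var (density x t) <= (1 - beta) ^+ t / pi x.
Proof.
elim: t => [|t IH].
  rewrite expr0 mul1r /var; apply: le_trans (_ : \sum_z pi z * density x 0 z ^+ 2 <= _).
    by rewrite lerBlDr lerDl sqr_ge0.
  rewrite (bigD1 x) //= big1 ?addr0.
    rewrite /density /dist_after /= eqxx; have := pi_gt0 x => p.
    by rewrite mul1r expr2 mulrA divff ?gt_eqF // mul1r.
  by move=> y /negbTE ne; rewrite /density /dist_after /= ne mul0r expr0n mulr0.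
have -> : var (density x t.+1) = var (op (density x t)).
  by rewrite /var /mean; congr (_ - _ ^+ 2); apply: eq_bigr => y _; rewrite densityS.
apply: le_trans (var_op _) _; rewrite exprS -mulrA; exact: ler_wpM2l.
Qed.

Let tv_density x t : (tv (dist_after P x t) pi) ^+ 2 <= (1 - beta) ^+ t / pi x.
Proof.
apply: le_trans (var_density x t).
have m1 : mean (density x t) = 1.
  rewrite -(dist_after_sum x t) /mean; apply: eq_bigr => y _.
  by rewrite /density mulrCA divff ?mulr1 // gt_eqF.
have e : \sum_y `|dist_after P x t y - pi y| = \sum_y pi y * `|density x t y - 1|.
  apply: eq_bigr => y _; rewrite -{2}(ger0_norm (ltW (pi_gt0 y))) -normrM; congr `|_|.
  by rewrite mulrBr mulr1 /density mulrCA divff ?mulr1 // gt_eqF.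
have ev : var (density x t) = \sum_y pi y * `|density x t y - 1| ^+ 2.
  rewrite [RHS](eq_bigr (fun y => pi y * density x t y ^+ 2 - 2 * (pi y * density x t y) + pi y)).
    by rewrite big_split sumrB /= -mulr_sumr pi_sum -/(mean _) /var m1; ring.
  by move=> y _; rewrite real_normK ?num_real //; ring.
have := weighted_cauchy (fun y => `|density x t y - 1|) (fun y => ltW (pi_gt0 y)).
rewrite pi_sum mul1r -ev -e /tv exprMn => h; apply: le_trans h.
by rewrite ler_piMl ?sqr_ge0 //; lra.
Qed.

(** [Q] bounds [1 / pi x], the initial variance of the density. The squared distance is then at most
    [Q] times the exponential of [- beta * t]. *)
Lemma gap_mixed (Q delta : R) t : 0 < delta -> 0 < Q -> (forall x, 1 <= Q * pi x) ->
  ln Q + 2 * ln (1 / delta) <= beta * t%:R -> mixed P pi delta t.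
Proof.
move=> d0 Q0 hQ ht x; have d1 := ltW d0.
have tv0 : 0 <= tv (dist_after P x t) pi.
  by rewrite mulr_ge0 ?invr_ge0 //; apply: sumr_ge0.
rewrite -(ler_pXn2r (n := 2)) ?nnegrE //; apply: le_trans (tv_density x t) _.
have e1 : (1 - beta) ^+ t <= expR (- (beta * t%:R)).
  rewrite -[- (beta * _)]mulNr expRM_natr; apply: lerXn2r; rewrite ?nnegrE ?expR_ge0 //.
  exact: expR_ge1Dx.
apply: le_trans (_ : expR (- (beta * t%:R)) * Q <= _).
  apply: ler_pM; rewrite ?exprn_ge0 ?invr_ge0 ?(ltW (pi_gt0 x)) //.
  by rewrite -[leLHS]mul1r ler_pdivrMr.
have -> : delta ^+ 2 = expR (- (2 * ln (1 / delta))).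
  by rewrite mul1r lnV ?posrE // mulrN opprK mulr2n mulrDl mul1r expRD lnK ?posrE.
rewrite -[X in _ * X](lnK (_ : Q \in Num.pos)) ?posrE // -expRD ler_expR; lra.
Qed.
End Gap.

Section Doeblin.
Variables (T : nat) (s : S) (c : R).
Hypothesis c_le1 : c <= 1.
Hypothesis hit : forall x, c <= dist_after P x T s.

(** As [nu] has total mass 0, the mass [c] that all rows share at [s] can be subtracted from each;
    nonnegative rows of sum [1 - c] remain. *)
Let contract (nu : S -> R) : \sum_x nu x = 0 ->
  \sum_y `|iter T (evolve P) nu y| <= (1 - c) * \sum_x `|nu x|.
Proof.
move=> nu0.
have e y : iter T (evolve P) nu y = \sum_x nu x * (dist_after P x T y - c * (y == s)%:R).
  rewrite iter_evolve; under [RHS]eq_bigr do rewrite mulrBr.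
  by rewrite sumrB -mulr_suml nu0 mul0r subr0.
have d0 x y : 0 <= dist_after P x T y - c * (y == s)%:R.
  rewrite subr_ge0; case: eqP => [->|_]; first by rewrite mulr1.
  by rewrite mulr0 dist_after_ge0.
apply: le_trans (_ : \sum_y \sum_x `|nu x| * (dist_after P x T y - c * (y == s)%:R) <= _).
  apply: ler_sum => y _; rewrite e; apply: le_trans (ler_norm_sum _ _ _) _.
  by apply: ler_sum => x _; rewrite normrM (ger0_norm (d0 _ _)).
rewrite exchange_big mulr_sumr; apply: ler_sum => x _.
have e1 : \sum_y (y == s)%:R = 1 :> R.
  by rewrite (bigD1 s) //= eqxx big1 ?addr0 // => y /negbTE ->.
by rewrite -mulr_sumr sumrB dist_after_sum -mulr_sumr e1 mulr1 mulrC.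
Qed.

Lemma doeblin_mixed (delta : R) m : (1 - c) ^+ m <= delta -> mixed P pi delta (m * T).
Proof.
move=> hm x; apply: le_trans hm.
have zero k : \sum_y iter k (evolve P) (fun y => (y == x)%:R - pi y) y = 0.
  under eq_bigr do rewrite iter_evolve.
  rewrite exchange_big /=; under eq_bigr do rewrite -mulr_sumr dist_after_sum mulr1.
  by rewrite sumrB pi_sum (bigD1 x) //= eqxx big1 ?addr0 ?subrr // => y /negbTE ->.
have diff k y : dist_after P x k y - pi y = iter k (evolve P) (fun y => (y == x)%:R - pi y) y.
  rewrite iter_evolve; under eq_bigr do rewrite mulrBl.
  rewrite sumrB -iter_evolve -iter_evolve; congr (_ - _).
  by rewrite (stationary_iter k (proj2 reversible_stationary)).
rewrite /tv; under eq_bigr do rewrite diff.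
suff h k : \sum_y `|iter (k * T) (evolve P) (fun y => (y == x)%:R - pi y) y| <= (1 - c) ^+ k * 2.
  by rewrite mulrC ler_pdivrMr //.
elim: k => [|k IH].
  rewrite mul0n expr0 mul1r /=; apply: le_trans (_ : \sum_y ((y == x)%:R + pi y) <= _).
    apply: ler_sum => y _; apply: le_trans (ler_normB _ _) _.
    by rewrite (ger0_norm (ltW (pi_gt0 y))) ger0_norm ?ler0n.
  rewrite big_split pi_sum (bigD1 x) //= eqxx big1 ?addr0 //.
  by move=> y /negbTE ->.
rewrite mulSn iterD; apply: le_trans (contract (zero _)) _.
by rewrite exprS -mulrA; apply: ler_wpM2l; rewrite // subr_ge0.
Qed.
End Doeblin.
End Mixing.

(** * The Glauber dynamics *)

Section Glauber.
Variables (R : realType) (G : sgraph) (q B K : nat).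
Notation lab := {ffun G -> 'I_q}.
Notation n := #|G|.
Notation LK := (LK G B q K).
Notation P := (@glauber R G q B K).
Notation pi := (@glauber_pi R G q B K).
Notation st := (state G q B K).
Hypothesis n_gt0 : (0 < n)%N.
Hypothesis q_gt0 : (0 < q)%N.
Hypothesis Omega_neq0 : Omega G q B != set0.

Let k : R := (n * q)%:R.
Let k_gt0 : 0 < k. Proof. by rewrite ltr0n muln_gt0 n_gt0. Qed.

Definition target (f : lab) (p : G * 'I_q) : {set {set G}} :=
  if upd f p.1 p.2 \in LK then parts (upd f p.1 p.2) else parts f.

Lemma mem_LK f : (f \in LK) = (parts f \in OmegaK G q B K).
Proof. by rewrite in_set. Qed.

Lemma OmegaK_label x : x \in OmegaK G q B K -> exists f : lab, parts f = x.
Proof. by rewrite in_set => /andP[/exists_label]. Qed.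

Lemma target_OmegaK f p : f \in LK -> target f p \in OmegaK G q B K.
Proof. by rewrite mem_LK /target; case: ifP => //; rewrite mem_LK. Qed.

Lemma glauber_sum (x : st) (f : lab) (phi : {set {set G}} -> R) : parts f = val x ->
  \sum_(v : G) \sum_(A <- Defs.classes q (val x)) phi (glauber_step q B K (val x) v A) =
  \sum_(p : G * 'I_q) phi (target f p).
Proof.
move=> e; rewrite -(pair_bigA _ (fun v c => phi (target f (v, c)))) /=.
apply: eq_bigr => v _; rewrite -e sum_classes; apply: eq_bigr => c _.
by rewrite /glauber_step move_fibre /target mem_LK.
Qed.

Lemma glauber_label (x y : st) (f : lab) : parts f = val x ->
  P x y = k^-1 * \sum_(p : G * 'I_q) (target f p == val y)%:R.
Proof.
move=> e; rewrite -(glauber_sum (fun w => (w == val y)%:R) e) /glauber mulr_sumr.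
apply: eq_bigr => v _; rewrite mulr_sumr; apply: eq_bigr => A _.
by rewrite /k natrM invfM.
Qed.

Let st_label (x : st) : exists2 f : lab, parts f = val x & f \in LK.
Proof.
have [f e] := OmegaK_label (valP x); exists f => //.
by rewrite mem_LK e (valP x).
Qed.

Lemma sum_states (h : {set {set G}} -> R) :
  \sum_(x : st) h (val x) = \sum_(w in OmegaK G q B K) h w.
Proof. by rewrite [RHS]big_sub. Qed.

Lemma sum_target_eq (f : lab) p (h : st -> R) (h' : {set {set G}} -> R) :
  f \in LK -> (forall x, h' (val x) = h x) ->
  \sum_(y : st) (target f p == val y)%:R * h y = h' (target f p).
Proof.
move=> fL e; have hT := target_OmegaK p fL; rewrite (bigD1 (Sub (target f p) hT)) //=.
rewrite eqxx mul1r -e /= big1 ?addr0 // => y.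
by rewrite -val_eqE /= eq_sym => /negbTE ->; rewrite mul0r.
Qed.

Lemma glauber_ge0 x y : 0 <= P x y.
Proof.
by apply: sumr_ge0 => v _; apply: sumr_ge0 => A _; rewrite !mulr_ge0 ?invr_ge0 ?ler0n.
Qed.

Lemma glauber_mean (x : st) (f : lab) (h : st -> R) (h' : {set {set G}} -> R) :
  parts f = val x -> (forall x, h' (val x) = h x) ->
  \sum_y P x y * h y = k^-1 * \sum_(p : G * 'I_q) h' (target f p).
Proof.
move=> e eh; have fL : f \in LK by rewrite mem_LK e (valP x).
under eq_bigr do rewrite (glauber_label _ e) -mulrA mulr_suml.
rewrite -mulr_sumr exchange_big /=; congr (_ * _); apply: eq_bigr => p _.
exact: sum_target_eq.
Qed.

Lemma glauber_total x : \sum_y P x y = 1.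
Proof.
have [f e _] := st_label x.
have := glauber_mean (h := fun=> 1) (h' := fun=> 1) e (fun=> erefl).
under eq_bigr do rewrite mulr1.
move=> ->; rewrite sumr_const card_prod card_ord -[1 *+ _]/((n * q)%:R) mulVf //.
by rewrite gt_eqF.
Qed.

Lemma glauber_lazy x : q%:R^-1 <= P x x.
Proof.
have [f e fL] := st_label x; rewrite (glauber_label x e).
apply: le_trans (_ : k^-1 * \sum_(v : G) 1 <= _).
  rewrite (_ : \sum_(v : G) 1 = n%:R :> R) ?sumr_const // /k natrM invfM mulrAC mulVf ?mul1r //.
  by rewrite pnatr_eq0 -lt0n.
apply: ler_wpM2l; first by rewrite invr_ge0 ltW.
rewrite -(pair_bigA _ (fun v c => (target f (v, c) == val x)%:R)) /=.
apply: ler_sum => v _; rewrite (bigD1 (f v)) //=.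
have -> : target f (v, f v) = val x.
  rewrite /target /= (_ : upd f v (f v) = f) ?fL //.
  by apply/ffunP => u; rewrite ffunE; case: eqP => [->|].
by rewrite eqxx lerDl; apply: sumr_ge0.
Qed.

Let Z : R := \sum_(y : st) weight R q (val y).

Lemma OmegaK_qpartition x : x \in OmegaK G q B K -> is_qpartition q x.
Proof. by rewrite in_set => /andP[]. Qed.

Lemma sum_LK (h : {set {set G}} -> R) :
  \sum_(f in LK) h (parts f) = \sum_(x : st) weight R q (val x) * h (val x).
Proof.
rewrite (sum_states (fun w => weight R q w * h w)).
rewrite -(sum_labels (S := fun x => x \in OmegaK G q B K)); last exact: OmegaK_qpartition.
by apply: eq_bigl => f; rewrite mem_LK.
Qed.

Let Z_card : Z = #|LK|%:R.
Proof.
rewrite -sumr_const (sum_LK (fun=> 1)); by apply: eq_bigr => x _; rewrite mulr1.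
Qed.

Lemma weight_ge1 (x : st) : 1 <= weight R q (val x).
Proof.
have /andP[_ le] := OmegaK_qpartition (valP x).
by rewrite weightE // ler1n ffact_gt0.
Qed.

Let Z_gt0 : 0 < Z.
Proof.
rewrite Z_card ltr0n card_gt0; have [w wO] := set0Pn _ Omega_neq0.
have [f e] : exists f : lab, parts f = w by apply: exists_label; move: wO; rewrite in_set => /and3P[].
by apply/set0Pn; exists f; apply: (subsetP (L0_sub _ _ _ _)); rewrite in_set e.
Qed.

Lemma glauber_pi_gt0 x : 0 < pi x.
Proof. by rewrite divr_gt0 //; apply: lt_le_trans (weight_ge1 x). Qed.

Lemma glauber_pi_total : \sum_x pi x = 1.
Proof. by rewrite -mulr_suml divff // gt_eqF. Qed.

Lemma glauber_pi_lower x : 1 <= (q ^ n)%:R * pi x.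
Proof.
have : Z <= (q ^ n)%:R.
  by rewrite Z_card ler_nat; apply: leq_trans (max_card _) _; rewrite card_ffun card_ord.
rewrite /glauber_pi -/Z => h; rewrite mulrA ler_pdivlMr // mul1r.
apply: le_trans h _; rewrite -[leLHS]mulr1; apply: ler_wpM2l => //; exact: weight_ge1.
Qed.

(** The recolouring reversed: the new labelling with the same vertex and its old label. It gives the
    symmetry of [flow], and hence reversibility. *)
Let swap (i : lab * (G * 'I_q)) := (upd i.1 i.2.1 i.2.2, (i.2.1, i.1 i.2.1)).
Let swapK : involutive swap.
Proof.
move=> [f [v c]]; rewrite /swap /= !ffunE eqxx; congr (_, _).
by apply/ffunP => u; rewrite !ffunE; case: eqP => // ->.
Qed.

Let flow (x y : st) : R := \sum_(i : lab * (G * 'I_q)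
  | (parts i.1 == val x) && (parts (upd i.1 i.2.1 i.2.2) == val y)) 1.

Let flowC x y : flow x y = flow y x.
Proof.
rewrite /flow (reindex_inj (inv_inj swapK)) /=; apply: eq_bigl => i.
rewrite andbC; congr (_ && _); congr (parts _ == _).
by have := congr1 fst (swapK i).
Qed.

Let flowE x y : x != y -> weight R q (val x) * P x y = k^-1 * flow x y.
Proof.
move=> ne; have /andP[_ le] := OmegaK_qpartition (valP x).
have -> : weight R q (val x) = \sum_(f : lab | parts f == val x) 1.
  rewrite weightE // -(card_labels (OmegaK_qpartition (valP x))) -sumr_const.
  by apply: eq_bigl => f; rewrite in_set.
have dist (r : R) : (\sum_(f : lab | parts f == val x) 1) * r = \sum_(f : lab | parts f == val x) r.
  by rewrite mulr_suml; apply: eq_bigr => f _; rewrite mul1r.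
rewrite dist; transitivity (\sum_(f : lab | parts f == val x)
    k^-1 * \sum_(p : G * 'I_q | parts (upd f p.1 p.2) == val y) 1); last first.
  by rewrite -mulr_sumr /flow (pair_big_dep (fun f : lab => parts f == val x)
    (fun f (p : G * 'I_q) => parts (upd f p.1 p.2) == val y) (fun _ _ => 1)).
apply: eq_bigr => f /eqP e; rewrite (glauber_label y e) [in RHS]big_mkcond.
congr (_ * _); apply: eq_bigr => p _.
rewrite /target; case: ifP => h; first by case: eqP.
rewrite e val_eqE (negbTE ne); case: eqP => // e'.
by move: h; rewrite mem_LK e' (valP y).
Qed.

Lemma glauber_reversible x y : pi x * P x y = pi y * P y x.
Proof.
have [->//|ne] := eqVneq x y.
rewrite /glauber_pi -!/Z mulrAC flowE // [RHS]mulrAC flowE 1?eq_sym //.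
by rewrite flowC.
Qed.

Section Form.
Variable A : R.
Hypothesis A_ge0 : 0 <= A.
Hypothesis poincare : forall psi : {set {set G}} -> R,
  \sum_(f in LK) \sum_(g in LK) (psi (parts f) - psi (parts g)) ^+ 2 <=
  #|LK|%:R * A * label_form LK (psi \o @parts G q).

(** Sums over labellings become sums weighted by [pi], since [Z] is the number of labellings in
    [LK]; [k] converts numbers of recolourings into transition probabilities. *)
Lemma glauber_poincare (f : st -> R) :
  \sum_x \sum_y pi x * pi y * (f x - f y) ^+ 2 <=
    (A * k) * \sum_x \sum_y pi x * P x y * (f x - f y) ^+ 2.
Proof.
pose psi (w : {set {set G}}) : R := if insub w is Some x then f x else 0.
have psiE (x : st) : psi (val x) = f x by rewrite /psi valK.
have Z0 : Z != 0 by rewrite gt_eqF.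
have e1 : \sum_x \sum_y pi x * pi y * (f x - f y) ^+ 2 =
    Z^-1 * (Z^-1 * \sum_(f in LK) \sum_(g in LK) (psi (parts f) - psi (parts g)) ^+ 2).
  rewrite [X in _ * (_ * X)](eq_bigr (fun g : lab => (fun w => \sum_(x : st)
    weight R q (val x) * (psi w - psi (val x)) ^+ 2) (parts g))); last first.
    by move=> g _; rewrite (sum_LK (fun w => (psi (parts g) - psi w) ^+ 2)).
  rewrite (sum_LK (fun w => \sum_(x : st) weight R q (val x) * (psi w - psi (val x)) ^+ 2)).
  rewrite !mulr_sumr; apply: eq_bigr => x _; rewrite !mulr_sumr; apply: eq_bigr => y _.
  rewrite !psiE /glauber_pi -/Z; ring.
have e2 : \sum_x \sum_y pi x * P x y * (f x - f y) ^+ 2 =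
    Z^-1 * (k^-1 * label_form LK (psi \o @parts G q)).
  have ef : label_form LK (psi \o @parts G q) =
      \sum_(g in LK) \sum_(p : G * 'I_q) (psi (parts g) - psi (target g p)) ^+ 2.
    apply: eq_bigr => g _; rewrite big_mkcond /=; apply: eq_bigr => p _.
    by rewrite /target; case: ifP => // _; rewrite subrr expr0n.
  rewrite ef.
  have key (g : lab) (x : st) : parts g = val x ->
      \sum_(p : G * 'I_q) (psi (parts g) - psi (target g p)) ^+ 2 =
      k * \sum_y P x y * (f x - f y) ^+ 2.
    move=> e; rewrite (glauber_mean (h' := fun w => (f x - psi w) ^+ 2) e); last by move=> y; rewrite psiE.
    by rewrite mulrA divff ?mul1r ?gt_eqF // e psiE.
  pose h w := if insub w is Some x then k * \sum_y P x y * (f x - f y) ^+ 2 else 0.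
  rewrite (eq_bigr (fun g : lab => h (parts g))); last first.
    move=> g gL; have hw : parts g \in OmegaK G q B K by rewrite -mem_LK.
    by rewrite (key g (Sub (parts g) hw)) ?SubK // /h insubT.
  rewrite (sum_LK h) !mulr_sumr; apply: eq_bigr => x _; rewrite /h valK !mulr_sumr.
  apply: eq_bigr => y _; rewrite /glauber_pi -/Z; field.
  by rewrite Z0 !pnatr_eq0 -!lt0n q_gt0 n_gt0.
rewrite e1 e2; apply: le_trans (_ : Z^-1 * (Z^-1 * (#|LK|%:R * A * label_form LK (psi \o @parts G q))) <= _).
  apply: ler_wpM2l; first by rewrite invr_ge0 ltW.
  by apply: ler_wpM2l; first by rewrite invr_ge0 ltW.
rewrite -Z_card; apply: eq_ler; field.
by rewrite Z0 !pnatr_eq0 -!lt0n q_gt0 n_gt0.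
Qed.
End Form.
End Glauber.

(** * Many classes *)

Section NonCut.
Variable G : sgraph.
Implicit Types A C : {set G}.

Definition inside A : rel G := [rel x y | [&& adj x y, x \in A & y \in A]].

Lemma connected_inP A :
  reflect {in A &, forall u v, connect (inside A) u v} (connected_in A).
Proof.
apply: (iffP idP) => [h u v uA vA|h].
  exact: (implyP (forallP (implyP (forallP h u) uA) v) vA).
by apply/forall_inP => u uA; apply/forall_inP => v vA; apply: h.
Qed.

Lemma inside_sym A : connect_sym (inside A).
Proof.
by apply: sym_connect_sym => u v; rewrite /inside /= adj_sym; congr (_ && _); rewrite andbC.
Qed.

Lemma inside_sub A C u v : A \subset C -> connect (inside A) u v -> connect (inside C) u v.
Proof.
move=> /subsetP s; apply: connect_sub => a c /and3P[h ha hc].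
by apply: connect1; rewrite /inside /= h !s.
Qed.

Lemma connected_add C a c : connected_in C -> a \in C -> adj a c -> connected_in (c |: C).
Proof.
move=> /connected_inP hC aC ac; apply/connected_inP.
have toa u : u \in c |: C -> connect (inside (c |: C)) a u.
  rewrite in_setU1 => /orP[/eqP ->|uC].
    by apply: connect1; rewrite /inside /= ac !inE aC eqxx orbT.
  by apply: inside_sub (hC _ _ aC uC); apply: subsetUr.
move=> u v uC vC; apply: connect_trans (toa _ vC).
by rewrite inside_sym; apply: toa.
Qed.

(** A largest proper connected subset stays connected when an adjacent vertex of [A] is added, so by
    maximality that vertex was the only one missing. *)
Lemma non_cut_vertex A : connected_in A -> (1 < #|A|)%N ->
  exists2 v, v \in A & connected_in (A :\ v).
Proof.
move=> cA A1; have [a aA] : exists a, a \in A by apply/card_gt0P/ltnW.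
pose ok C := (C \proper A) && connected_in C.
have c1 : ok [set a].
  rewrite /ok properEcard sub1set aA cards1 A1 /=; apply/connected_inP => u v.
  by rewrite !inE => /eqP -> /eqP ->; apply: connect0.
case: (arg_maxnP (fun C : {set G} => #|C|) c1) => C /andP[pC cC] max.
have [c cC0] : exists c, c \in C.
  by apply/card_gt0P; apply: leq_trans (max _ c1); rewrite cards1.
have [sC [b bA bC]] := properP pC.
have [u [v [uC vA vC uv]]] : exists u v, [/\ u \in C, v \in A, v \notin C & adj u v].
  have := connected_inP _ cA _ _ (subsetP sC _ cC0) bA.
  case/connectP=> p; elim: p c cC0 => [|w p IH] c cC0 /=.
    by move=> _ e; rewrite e cC0 in bC.
  case/andP=> /and3P[cw _ wA] pth e; case wC : (w \in C); first exact: IH wC pth e.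
  by exists c, w; rewrite wC.
have cD := connected_add cC uC uv.
have eA : v |: C = A.
  apply/eqP; rewrite eqEsubset subUset sub1set vA sC /=.
  apply: contraT => nA.
  have okD : ok (v |: C) by rewrite /ok cD andbT properE subUset sub1set vA sC.
  by have := max _ okD; rewrite /= cardsU1 vC add1n ltnn.
by exists v => //; rewrite -eA setU1K.
Qed.
End NonCut.

Section LargeQ.
Variables (R : realType) (G : sgraph) (q B K : nat).
Notation lab := {ffun G -> 'I_q}.
Notation n := #|G|.
Notation LK := (LK G B q K).
Notation P := (@glauber R G q B K).
Notation st := (state G q B K).
Hypothesis n_gt0 : (0 < n)%N.
Hypothesis B_gt0 : (0 < B)%N.
Hypothesis q_large : (8 * n ^ 4 <= q)%N.

Lemma card_large : (8 * n <= q)%N.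
Proof. by apply: leq_trans q_large; rewrite leq_mul2l /= -{1}(expn1 n) leq_pexp2l. Qed.

Definition alone (w : {set {set G}}) : {set G} := [set v | [set v] \in w].

Lemma aloneP (f : lab) v : reflect (forall u, f u = f v -> u = v) (v \in alone (parts f)).
Proof.
rewrite inE; apply: (iffP (partsP _ _)) => [[u e] w fw|h].
  have := set11 v; rewrite e inE => /eqP fv.
  by apply/set1P; rewrite e inE fw fv.
exists v; apply/setP => u; rewrite !inE; apply/eqP/eqP => [->//|]; exact: h.
Qed.

Lemma alone_upd (f : lab) v c : (forall u, f u != c) ->
  v |: alone (parts f) \subset alone (parts (upd f v c)).
Proof.
move=> hc; apply/subsetP => u; rewrite in_setU1 => h; apply/aloneP => w.
case/orP: h => [/eqP ->|/aloneP h]; rewrite !ffunE.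
  by rewrite eqxx; case: eqP => [//|_] e; have := hc w; rewrite e eqxx.
case: (eqVneq w v) => [-> |wv]; case: (eqVneq u v) => [-> //|uv].
- by move=> e; have := hc u; rewrite -e eqxx.
- by move=> e; have := hc w; rewrite e eqxx.
exact: h.
Qed.

Lemma unused_label (f g : lab) : exists c, (forall u, f u != c) /\ (forall u, g u != c).
Proof.
have lt : (#|(f @: G) :|: (g @: G)| < #|[set: 'I_q]|)%N.
  rewrite [X in (_ < X)%N]cardsT [X in (_ < X)%N]card_ord.
  apply: leq_ltn_trans (leq_card_setU _ _) _.
  apply: leq_ltn_trans (leq_add (leq_imset_card _ _) (leq_imset_card _ _)) _.
  by apply: leq_trans card_large; rewrite addnn -mul2n ltn_mul2r n_gt0.
have : ~~ ([set: 'I_q] \subset (f @: G) :|: (g @: G)).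
  by apply: contraL lt => /subset_leq_card; rewrite -leqNgt.
case/subsetPn => c _ hc; exists c; split => u; apply: contraNneq hc => <-.
  by rewrite inE imset_f.
by rewrite inE (imset_f g) ?orbT.
Qed.

Lemma split_vertex (g : lab) v c : parts g \in Omega G q B -> (forall u, g u != c) ->
  connected_in (fibre g (g v) :\ v) -> parts (upd g v c) \in Omega G q B.
Proof.
move=> gO hc cv; have /and3P[_ /forall_inP cg /forall_inP bg] : valid B (parts g).
  by move: gO; rewrite OmegaE => /andP[].
have blk u : fibre g (g u) \in parts g by apply/partsP; exists u.
have shape X : X \in parts (upd g v c) ->
    X = [set v] \/ exists u, X = fibre g (g u) /\ v \notin X \/ X = fibre g (g u) :\ v /\ g u = g v.
  case/partsP => u ->; rewrite ffunE; case: (eqVneq u v) => [_|uv].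
    left; apply/setP => w; rewrite !inE ffunE; case: (w == v); rewrite ?eqxx //.
    exact/negbTE.
  right; exists u; case: (eqVneq (g u) (g v)) => e; [right|left]; split=> //.
  - apply/setP => w; rewrite !inE ffunE; case: (w == v) => //=.
    by apply/negbTE; rewrite eq_sym.
  - apply/setP => w; rewrite !inE ffunE; case: (eqVneq w v) => [->|//].
    by rewrite [g v == _]eq_sym (negbTE e); apply/negbTE; rewrite eq_sym.
  by rewrite !inE ffunE eqxx eq_sym.
rewrite OmegaE card_parts andbT /valid parts_partition /=.
apply/andP; split; apply/forall_inP => X /shape[->|[u [[-> _]|[-> e]]]].
- by apply/connected_inP => a b; rewrite !inE => /eqP -> /eqP ->; apply: connect0.
- exact: cg.
- by rewrite e.
- by rewrite cards1.
- exact: bg.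
by apply: leq_trans (bg _ (blk u)); apply/subset_leq_card/subsetDl.
Qed.

(* Compare the state with a nearest contiguous partition. If some mismatched
   vertex is not a singleton, isolate it. Otherwise isolate a non-cut vertex of a
   class of that partition; by minimality this vertex is not mismatched. *)
Lemma singleton_progress (f : lab) : f \in LK -> alone (parts f) != [set: G] ->
  exists2 v, v \notin alone (parts f) &
    forall c, (forall u, f u != c) -> upd f v c \in LK.
Proof.
move=> fL nall.
pose near m := [exists h : lab, exists g : lab, exists W : {set G},
  [&& #|W| == m, parts h == parts f, parts g \in Omega G q B & [forall v, (v \notin W) ==> (h v == g v)]]].
have ex : exists m, near m && (m <= K)%N.
  move: fL; rewrite !in_set => /andP[_ /existsP[w /andP[wO /existsP[W /andP[sW]]]]].
  move=> /existsP[h /existsP[g /and3P[lh lg hg]]]; exists #|W|; rewrite sW andbT.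
  apply/existsP; exists h; apply/existsP; exists g; apply/existsP; exists W.
  have lg' : parts g = w := eqP lg; have lh' : parts h = parts f := eqP lh.
  by rewrite lh' lg' !eqxx wO hg.
case: (ex_minnP ex) => m /andP[/existsP[h /existsP[g /existsP[W /and4P[/eqP sW /eqP hf gO /forall_inP hg]]]] mK] min.
have hgE v : v \notin W -> h v = g v by move=> /hg /eqP.
have done v c' : v \notin alone (parts f) -> (forall u, h u != c') -> upd h v c' \in LK ->
    exists2 v, v \notin alone (parts f) & forall c, (forall u, f u != c) -> upd f v c \in LK.
  move=> va hc' hL; exists v => // c hc; move: hL; rewrite !mem_LK.
  suff -> : parts (upd h v c') = parts (upd f v c) by [].
  apply/eqP/parts_eqP => a b.
  have /parts_eqP e : parts h == parts f by rewrite hf.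
  rewrite !ffunE; case: (a == v); case: (b == v) => //; rewrite ?eqxx //.
  - by rewrite (eq_sym c') (eq_sym c) (negbTE (hc' b)) (negbTE (hc b)).
  - by rewrite (negbTE (hc' a)) (negbTE (hc a)).
case: (boolP [exists v in W, v \notin alone (parts f)]) => [/exists_inP[v vW va]|].
  have [c [hc _]] := unused_label h h.
  apply: done va hc _; apply: (in_OmegaK (W := W) gO); first by rewrite sW.
  by move=> u uW; rewrite ffunE ifN ?hgE //; apply: contraNneq uW => ->.
rewrite negb_exists_in => /forall_inP allW.
have Wal v : v \in W -> v \in alone (parts h) by rewrite hf => /allW; rewrite negbK.
have [u0 _ u0a] : exists2 u0, u0 \in [set: G] & u0 \notin alone (parts h).
  by apply/subsetPn; rewrite subTset hf.
have u0W : u0 \notin W by apply: contra u0a; apply: Wal.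
have [w /andP[/eqP hw wu0]] : exists w, (h w == h u0) && (w != u0).
  apply/existsP; apply: contraR u0a => /existsPn hn; apply/aloneP => w e.
  by apply/eqP; have := hn w; rewrite e eqxx /= negbK.
have wW : w \notin W.
  by apply/negP => /Wal/aloneP/(_ u0 (esym hw)) e; rewrite e eqxx in wu0.
have [w0 gw] : w \in fibre g (g u0) /\ u0 \in fibre g (g u0).
  by rewrite !inE -!hgE // hw eqxx.
have vg : valid B (parts g) by move: gO; rewrite OmegaE => /andP[].
have cA : connected_in (fibre g (g u0)).
  by case/and3P: vg => _ /forall_inP h1 _; apply: h1; apply/partsP; exists u0.
have [|v vA cv] := non_cut_vertex cA.
  by apply/card_gt1P; exists w, u0.
have gv : g v = g u0 by apply/eqP; move: vA; rewrite inE.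
have [c [hc gc]] := unused_label h g.
have gO' : parts (upd g v c) \in Omega G q B by apply: split_vertex => //; rewrite gv.
have agree u : u \notin W :\ v -> upd h v c u = upd g v c u.
  by rewrite !inE !ffunE negb_and negbK; case: eqP => //= _; apply: hgE.
(* If [v] were mismatched, it would be a singleton in [h]. Giving it a fresh label in both [h] and
   [g] would then keep the partition of [h], keep [g] contiguous and remove one mismatch, against
   the choice of [m]. *)
case vW : (v \in W).
  have va := Wal v vW; exfalso.
  have : near #|W :\ v| && (#|W :\ v| <= K)%N.
    have le : (#|W :\ v| <= #|W|)%N by apply/subset_leq_card/subsetDl.
    rewrite (leq_trans le) ?sW // andbT.
    apply/existsP; exists (upd h v c); apply/existsP; exists (upd g v c).
    apply/existsP; exists (W :\ v); rewrite eqxx gO' /=; apply/andP; split; last first.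
      by apply/forall_inP => u uW; rewrite agree.
    rewrite -hf; apply/parts_eqP => a b; rewrite !ffunE.
    have vx z : z != v -> (h z == h v) = false.
      by move=> zv; apply/negbTE; apply: contra zv => /eqP /(aloneP _ _ va) ->.
    case: (eqVneq a v) => [->|av]; case: (eqVneq b v) => [->|bv]; rewrite ?eqxx //.
    - by rewrite (eq_sym c) (eq_sym (h v)) (vx b bv) (negbTE (hc b)).
    - by rewrite (vx a av) (negbTE (hc a)).
  by move/min; rewrite -sW (cardsD1 v W) vW add1n ltnn.
apply: (done v c) => //; last first.
  apply: (in_OmegaK (W := W) gO') => [|u uW]; first by rewrite sW.
  by apply: agree; rewrite inE negb_and uW orbT.
rewrite -hf; apply/aloneP => va.
have hv : h v = h u0 by rewrite hgE ?vW // gv hgE.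
have e1 := va w (etrans hw (esym hv)); have e2 := va u0 (esym hv).
by rewrite e1 e2 eqxx in wu0.
Qed.
End LargeQ.

(** * Contraction towards the partition into singletons *)

Section Drift.
Variables (R : realType) (G : sgraph) (q B K : nat).
Notation lab := {ffun G -> 'I_q}.
Notation n := #|G|.
Notation LK := (LK G B q K).
Notation P := (@glauber R G q B K).
Notation st := (state G q B K).
Hypothesis n_gt0 : (0 < n)%N.
Hypothesis B_gt0 : (0 < B)%N.
Hypothesis q_large : (8 * n ^ 4 <= q)%N.

Let nq := card_large n_gt0 q_large.
Let q_gt0 : (0 < q)%N.
Proof. by apply: leq_trans nq; rewrite muln_gt0. Qed.

Definition crowd (w : {set {set G}}) : R := #|~: alone w|%:R.

Let P0 (x y : st) : 0 <= P x y.
Proof. exact: glauber_ge0. Qed.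
Let P1 (x : st) : \sum_y P x y = 1.
Proof. exact: glauber_total. Qed.

Let N : R := n%:R.
Let N1 : 1 <= N. Proof. by rewrite ler1n. Qed.
Let a : R := (2 * N ^+ 2)^-1.

Let crowd_le w : crowd w <= N.
Proof. by rewrite ler_nat max_card. Qed.

Let target_bound (f : lab) (v c : _) : f \in LK -> (forall u, f u != c) ->
  crowd (target B K f (v, c)) <= crowd (parts f).
Proof.
move=> fL hc; rewrite /target /=; case: ifP => // _; rewrite ler_nat.
apply/subset_leq_card; rewrite setCS; apply: subset_trans (alone_upd v hc).
exact: subsetUr.
Qed.

Let target_drop (f : lab) (v c : _) : (forall u, f u != c) ->
  v \notin alone (parts f) -> upd f v c \in LK ->
  crowd (target B K f (v, c)) <= crowd (parts f) - 1.
Proof.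
move=> hc va uL; rewrite /target /= uL lerBrDr natr1 ler_nat.
have : ~: alone (parts (upd f v c)) \subset (~: alone (parts f)) :\ v.
  apply/subsetP => u; rewrite !in_setD1 !in_setC => h.
  have := contra (subsetP (alone_upd v hc) u) h.
  by rewrite in_setU1 negb_or.
by move/subset_leq_card; rewrite [in X in _ -> X](cardsD1 v (~: alone (parts f))) in_setC va.
Qed.

Let drop_sum (f : lab) : f \in LK ->
  \sum_(p : G * 'I_q) crowd (target B K f p) <=
    N * q%:R * crowd (parts f) - (q%:R - N) * (crowd (parts f) / N) + N ^+ 3.
Proof.
move=> fL; pose U := f @: G; have cU : (#|U| <= n)%N by apply: leq_imset_card.
have uU c : c \notin U -> forall u, f u != c.
  by move=> h u; apply: contraNneq h => <-; apply: imset_f.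
have [v0 hv0] : exists v0, forall c, c \notin U ->
    crowd (target B K f (v0, c)) <= crowd (parts f) - crowd (parts f) / N.
  have N0 : 0 < N by apply: lt_le_trans N1.
  case: (eqVneq (alone (parts f)) setT) => [e|ne].
    have [v _] := card_gt0P n_gt0; exists v => c /uU hc.
    have z : crowd (parts f) = 0 by rewrite /crowd e setCT cards0.
    by have := target_bound v fL hc; rewrite z mul0r subr0.
  have [v va hv] := singleton_progress n_gt0 B_gt0 q_large fL ne.
  exists v => c /uU hc; apply: le_trans (target_drop hc va (hv c hc)) _.
  by rewrite lerD2l lerN2 ler_pdivrMr // mul1r.
rewrite -(pair_bigA _ (fun v c => crowd (target B K f (v, c)))) /=.
apply: le_trans (_ : \sum_(v : G) \sum_(c : 'I_q)
  (crowd (parts f) + N * (c \in U)%:R - ((v == v0) && (c \notin U))%:R * (crowd (parts f) / N)) <= _).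
  apply: ler_sum => v _; apply: ler_sum => c _; case cUU : (c \in U).
    by rewrite andbF mulr1 mul0r subr0 (le_trans (crowd_le _)) // lerDr ler0n.
  rewrite mulr0 addr0 andbT; case: eqP => [->|_]; last first.
    by rewrite mul0r subr0; apply: target_bound => //; apply/uU/negbT.
  by rewrite mul1r; apply/hv0/negbT.
have sU : \sum_(c : 'I_q) (c \in U)%:R = #|U|%:R :> R.
  by rewrite -sum1_card natr_sum [RHS]big_mkcond /=; apply: eq_bigr => c _; case: (c \in U).
have sC : \sum_(c : 'I_q) (c \notin U)%:R = q%:R - #|U|%:R :> R.
  rewrite -sU -[in q%:R](card_ord q) -sum1_card natr_sum -sumrB; apply: eq_bigr => c _.
  by case: (c \in U); rewrite ?subrr ?subr0.
have e : \sum_(v : G) \sum_(c : 'I_q)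
  (crowd (parts f) + N * (c \in U)%:R - ((v == v0) && (c \notin U))%:R * (crowd (parts f) / N)) =
  N * q%:R * crowd (parts f) + N * (N * #|U|%:R) - (q%:R - #|U|%:R) * (crowd (parts f) / N).
  rewrite (eq_bigr (fun v => q%:R * crowd (parts f) + N * #|U|%:R -
    (v == v0)%:R * ((q%:R - #|U|%:R) * (crowd (parts f) / N)))).
    rewrite sumrB sumr_const -mulr_suml (bigD1 v0) //= eqxx big1 ?addr0 ?mul1r.
      by congr (_ - _); rewrite -[_ *+ #|_|]mulr_natl -/N; ring.
    by move=> v /negbTE ->.
  move=> v _; rewrite sumrB big_split /= sumr_const -mulr_sumr sU card_ord -[_ *+ q]mulr_natl.
  congr (_ - _); case: (v == v0) => /=; rewrite -mulr_suml ?sC ?mul1r //.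
  by rewrite big1 // ?mul0r.
rewrite e; have le1 : (#|U|%:R : R) <= N by rewrite ler_nat.
have c0 : 0 <= crowd (parts f) / N by rewrite divr_ge0 // ler0n.
have := ler_wpM2r c0 le1; have N0 : 0 <= N by rewrite ler0n.
have : N * (N * #|U|%:R) <= N * (N * N) by apply: ler_wpM2l => //; apply: ler_wpM2l.
rewrite !exprS expr0 mulr1 !mulrBl; lra.
Qed.

Let drift (x : st) : \sum_y P x y * crowd (val y) <= (1 - a) * crowd (val x) + a / 4.
Proof.
have [f e] := OmegaK_label (valP x).
have fL : f \in LK by rewrite mem_LK e (valP x).
rewrite (glauber_mean (h' := crowd) e) //.
have := drop_sum fL; rewrite e; set S := \sum_p _; set H := crowd _ => le.
have q0 : 0 < q%:R :> R by rewrite ltr0n.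
have N0 : 0 < N by apply: lt_le_trans N1.
have qN : 8 * N ^+ 4 <= q%:R by rewrite -natrX -natrM ler_nat.
rewrite ler_pdivrMl; last by rewrite ltr0n muln_gt0 n_gt0.
apply: le_trans le _; rewrite natrM -/N.
have H0 : 0 <= H by rewrite ler0n.
have e1 : N * q%:R * ((1 - a) * H + a / 4) =
   N * q%:R * H - q%:R / 2 * (H / N) + q%:R / (8 * N).
  by rewrite /a; field; rewrite gt_eqF.
rewrite e1.
(* Here [8 * n ^ 4 <= q] is spent: the error from labels in use must fit into the term [a / 4]. *)
have h1 : N ^+ 3 <= q%:R / (8 * N).
  by rewrite ler_pdivlMr ?mulr_gt0 //; apply: le_trans qN; rewrite !exprS expr0; lra.
have h2 : q%:R / 2 * (H / N) <= (q%:R - N) * (H / N).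
  apply: ler_wpM2r; first by rewrite divr_ge0 // ltW.
  have : 8 * N <= q%:R by rewrite -natrM ler_nat.
  lra.
lra.
Qed.

Let expect (x : st) t := \sum_y dist_after P x t y * crowd (val y).

Let expect_le x t : expect x t <= (1 - a) ^+ t * N + 1 / 4.
Proof.
have a0 : 0 <= 1 - a.
  rewrite subr_ge0 /a invf_le1 ?mulr_gt0 ?exprn_gt0 ?(lt_le_trans _ N1) //.
  by have := exprn_ege1 2 N1; lra.
elim: t => [|t IH].
  rewrite /expect (bigD1 x) //= /dist_after /= eqxx big1 ?addr0.
    by rewrite expr0 !mul1r; apply: le_trans (crowd_le _) _; rewrite lerDl invr_ge0.
  by move=> y /negbTE ->; rewrite mul0r.
have -> : expect x t.+1 = \sum_z dist_after P x t z * \sum_y P z y * crowd (val y).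
  rewrite /expect; under eq_bigr do rewrite dist_afterS mulr_suml.
  rewrite exchange_big; apply: eq_bigr => z _; rewrite mulr_sumr; apply: eq_bigr => y _.
  by rewrite mulrA.
apply: le_trans (_ : \sum_z dist_after P x t z * ((1 - a) * crowd (val z) + a / 4) <= _).
  by apply: ler_sum => z _; apply: ler_wpM2l; [apply: dist_after_ge0 | apply: drift].
rewrite (eq_bigr (fun z => (1 - a) * (dist_after P x t z * crowd (val z)) +
  dist_after P x t z * (a / 4))); last by move=> z _; ring.
rewrite big_split /= -mulr_sumr -mulr_suml dist_after_sum // mul1r -/(expect x t) exprS.
have := ler_wpM2l a0 IH; move: ((1 - a) ^+ t) => X; lra.
Qed.

Definition singletons : {set {set G}} := [set [set v] | v : G].

Lemma singletons_Omega : singletons \in Omega G q B.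
Proof.
have e : singletons = preim_partition id [set: G].
  apply/setP => X; apply/imsetP/imsetP => -[v _ ->]; exists v => //; apply/setP => u;
    by rewrite !inE eq_sym.
have c : (#|singletons| <= q)%N.
  apply: leq_trans (leq_imset_card _ _) _; apply: leq_trans nq; exact: leq_pmull.
rewrite inE /is_qpartition c andbT e preim_partitionP -e /=.
apply/andP; split; apply/forall_inP => X /imsetP[v _ ->]; last by rewrite cards1.
by apply/connected_inP => u w; rewrite !inE => /eqP -> /eqP ->; apply: connect0.
Qed.

Lemma Omega_sub_OmegaK w : w \in Omega G q B -> w \in OmegaK G q B K.
Proof.
move=> wO; have [f e] : exists f : lab, parts f = w.
  by apply: exists_label; move: wO; rewrite in_set => /and3P[].
by rewrite -e -mem_LK; apply: (subsetP (L0_sub _ _ _ _)); rewrite in_set e.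
Qed.

Lemma hit_singletons : exists s : st, forall x, 2^-1 <= dist_after P x (8 * n ^ 3) s.
Proof.
exists (Sub singletons (Omega_sub_OmegaK singletons_Omega)) => x.
set s := Sub _ _; set T := (8 * n ^ 3)%N.
have far y : y != s -> 1 <= crowd (val y).
  move=> ne; rewrite ler1n card_gt0; apply: contra ne => /eqP h0.
  have al : alone (val y) = [set: G] by rewrite -[LHS]setCK h0 setC0.
  apply/eqP/val_inj; rewrite SubK.
  have [f e] := OmegaK_label (valP y).
  apply/setP => X; rewrite -e; apply/partsP/imsetP => [[u ->]|[v _ ->]].
    exists u => //; have : u \in alone (parts f) by rewrite e al inE.
    move/aloneP => hu; apply/setP => w; rewrite !inE; apply/eqP/eqP => [/hu //|->//].
  have : v \in alone (val y) by rewrite al inE.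
  by rewrite inE -e => /partsP.
have ex : expect x T <= 1 / 2.
  apply: le_trans (expect_le x T) _.
  have N0 : 0 < N by apply: lt_le_trans N1.
  have a1 : 0 <= 1 - a.
    rewrite subr_ge0 /a invf_le1 ?mulr_gt0 ?exprn_gt0 //.
    by have := exprn_ege1 2 N1; lra.
  (* The number of steps [T] is chosen so that [a * T = 4 * N]; the initial [crowd], at most [N],
     then shrinks to at most 1/4. *)
  have h1 : (1 - a) ^+ T <= expR (- (4 * N)).
    have -> : - (4 * N) = (- a) * T%:R.
      by rewrite /T /a natrM natrX -/N; field; rewrite gt_eqF.
    by rewrite expRM_natr; apply: lerXn2r; rewrite ?nnegrE ?expR_ge0 //; exact: expR_ge1Dx.
  have h2 : expR (- (4 * N)) <= (4 * N)^-1.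
    rewrite expRN lef_pV2 ?posrE ?expR_gt0 ?mulr_gt0 //.
    by apply: le_trans (expR_ge1Dx _); lra.
  have : (1 - a) ^+ T * N <= (4 * N)^-1 * N.
    by apply: ler_wpM2r; [apply: ltW | apply: le_trans h1 h2].
  have -> : (4 * N)^-1 * N = 1 / 4 by field; rewrite gt_eqF.
  lra.
(* Markov's inequality: every other state has [crowd] at least 1, so together they carry at most the
   expectation, which is at most 1/2. *)
have := dist_after_sum P1 x T; rewrite (bigD1 s) //= => tot.
have : \sum_(y | y != s) dist_after P x T y <= expect x T.
  rewrite /expect [leRHS](bigD1 s) //= -[leLHS]add0r; apply: lerD.
    by rewrite mulr_ge0 ?ler0n ?dist_after_ge0.
  apply: ler_sum => y /far h; rewrite -[leLHS]mulr1; apply: ler_wpM2l => //.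
  exact: dist_after_ge0.
move: tot ex; lra.
Qed.
End Drift.

(** * Mixing time *)

Lemma ln2_ge (R : realType) : 2^-1 <= ln 2 :> R.
Proof.
rewrite -[leLHS]expRK ler_ln ?posrE ?expR_gt0 //.
have h : 2^-1 <= expR (- 2^-1) :> R by apply: le_trans (expR_ge1Dx _); lra.
rewrite -[X in expR X]opprK expRN -[leRHS]invrK lef_pV2 // posrE ?expR_gt0 //.
by rewrite invr_gt0.
Qed.

Section Assembly.
Variables (R : realType) (G : sgraph) (B q K : nat).
Notation n := #|G|.
Notation b := (bandwidth G).
Notation P := (@glauber R G q B K).
Notation pi := (@glauber_pi R G q B K).
Hypothesis n_gt0 : (0 < n)%N.
Hypothesis q_gt0 : (0 < q)%N.
Hypothesis B_gt0 : (0 < B)%N.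
Hypothesis Omega_neq0 : Omega G q B != set0.

Let P0 x y : 0 <= P x y.
Proof. exact: glauber_ge0. Qed.
Let P1 x : \sum_y P x y = 1.
Proof. exact: glauber_total. Qed.
Let pi0 x : 0 < pi x.
Proof. exact: glauber_pi_gt0. Qed.
Let s1 : \sum_x pi x = 1.
Proof. exact: glauber_pi_total. Qed.
Let rev x y : pi x * P x y = pi y * P y x.
Proof. exact: glauber_reversible. Qed.

Lemma glauber_conclusion (X : R) :
  (forall delta : R, 0 < delta -> delta <= 2^-1 ->
     exists2 t, mixed P pi delta t & t%:R <= X * ln (1 / delta)) ->
  stationary P pi /\ (forall mu, stationary P mu -> mu =1 pi) /\
  forall delta : R, 0 < delta -> delta <= 2^-1 ->
  exists t, is_mixing_time P pi delta t /\ t%:R <= X * ln (1 / delta).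
Proof.
move=> h.
split; first exact: reversible_stationary.
split=> [mu st|delta d0 d1].
  apply: (stationary_unique _ st) => delta d0.
  have m0 : 0 < Num.min delta 2^-1 by rewrite lt_min d0 invr_gt0 /=.
  have [|t ht _] := h _ m0; first by rewrite ge_min lexx orbT.
  by exists t => x; apply: le_trans (ht x) _; rewrite ge_min lexx.
have [t ht le] := h _ d0 d1; have [s [hs st]] := mixing_time_exists ht.
by exists s; split=> //; apply: le_trans le; rewrite ler_nat.
Qed.

Lemma ln_inv_ge (delta : R) : 0 < delta -> delta <= 2^-1 -> 2^-1 <= ln (1 / delta).
Proof.
move=> d0 d1; apply: le_trans (ln2_ge R) _.
rewrite ler_ln ?posrE // ?divr_gt0 // div1r -[leLHS]invrK lef_pV2 ?posrE //.
by rewrite invr_gt0.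
Qed.

Lemma large_q_mixing (delta : R) : (8 * n ^ 4 <= q)%N -> 0 < delta -> delta <= 2^-1 ->
  exists2 t, mixed P pi delta t & t%:R <= 32 * n%:R ^+ 3 * ln (1 / delta).
Proof.
move=> qn d0 d1; set L := ln (1 / delta); have L2 : 2^-1 <= L by apply: ln_inv_ge.
have [s hs] := hit_singletons R K n_gt0 B_gt0 qn.
(* As [ln 2] is at least 1/2, [2 * L] halvings bring the distance below [delta]; as [L] is at least
   1/2, rounding up stays within [4 * L]. *)
pose m := (Num.truncn (2 * L)).+1.
have [m1 m2] : 2 * L <= m%:R /\ m%:R <= 2 * L + 1.
  have L0 : 0 <= 2 * L by lra.
  have /andP[h1 h2] := truncn_itv L0; rewrite /m; split; first exact: ltW.
  by rewrite -natr1 lerD2r.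
exists (m * (8 * n ^ 3))%N; last first.
  rewrite natrM [(8 * _)%:R]natrM natrX.
  have : m%:R <= 4 * L by lra.
  have n0 : 0 <= n%:R ^+ 3 :> R by rewrite exprn_ge0.
  nra.
have c1 : 2^-1 <= 1 :> R by lra.
apply: (doeblin_mixed P0 P1 pi0 s1 rev c1 hs).
have -> : 1 - 2^-1 = 2^-1 :> R by field.
have -> : 2^-1 = expR (- ln 2) :> R by rewrite expRN lnK // posrE.
have -> : delta = expR (- L).
  by rewrite /L div1r lnV ?posrE // opprK lnK ?posrE.
rewrite -expRM_natr ler_expR mulNr lerN2.
have l2 := ln2_ge R; have m0 : 0 <= m%:R :> R by [].
have := ler_wpM2r m0 l2; lra.
Qed.

Variable A : R.
Hypothesis A_ge1 : 2 <= A.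
Hypothesis poincare : forall psi : {set {set G}} -> R,
  \sum_(f in LK G B q K) \sum_(g in LK G B q K) (psi (parts f) - psi (parts g)) ^+ 2 <=
  #|LK G B q K|%:R * A * label_form (LK G B q K) (psi \o @parts G q).

Lemma gap_mixing (delta : R) : 0 < delta -> delta <= 2^-1 ->
  exists2 t, mixed P pi delta t &
    t%:R <= ((n * q).+1%:R * (q%:R * (A * (n * q)%:R)) + 2) * ln (1 / delta).
Proof.
move=> d0 d1; set L := ln (1 / delta); have L2 : 2^-1 <= L by apply: ln_inv_ge.
have A2 := A_ge1; have A0 : 0 <= A by apply: le_trans A2.
have gp := glauber_poincare n_gt0 q_gt0 Omega_neq0 poincare.
have lz x : q%:R^-1 <= P x x by apply: glauber_lazy.
set k : R := (n * q)%:R in gp *.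
have k1 : 1 <= k by rewrite ler1n muln_gt0 n_gt0.
have q1 : 1 <= q%:R :> R by rewrite ler1n.
have th0 : 0 < q%:R^-1 :> R by rewrite invr_gt0 ltr0n.
have th1 : q%:R^-1 <= 1 :> R by rewrite invf_le1 // ltr0n.
have large : 2 * q%:R^-1 <= A * k.
  have : A * 1 <= A * k by apply: ler_wpM2l.
  lra.
pose W := q%:R * (A * k).
have W0 : 0 < W.
  rewrite mulr_gt0 ?ltr0n // mulr_gt0 //; first by apply: lt_le_trans A2.
  by apply: lt_le_trans k1.
(* This solves [2 / W * z = k + 2 * L], where [2 / W] is the rate of decay in [gap_mixed] and
   [k = n * q] bounds the logarithm of [q ^ n]. *)
pose z := (k + 2 * L) * W / 2.
have z0 : 0 <= z.
  rewrite divr_ge0 // mulr_ge0 //; last exact: ltW.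
  by rewrite addr_ge0 //; lra.
exists (Num.truncn z).+1.
  have gm := @gap_mixed _ _ _ _ P0 P1 pi0 s1 rev _ _ th0 lz large gp (q ^ n)%:R _ (Num.truncn z).+1 d0.
  apply: gm => [|x|].
  - by rewrite ltr0n expn_gt0 q_gt0.
  - exact: glauber_pi_lower.
  have /andP[_ /ltW h] := truncn_itv z0.
  have -> : 2 * q%:R^-1 / (A * k) = 2 / W.
    by rewrite -mulrA -invfM.
  apply: le_trans (_ : 2 / W * z <= _); last first.
    by apply: ler_wpM2l h; rewrite divr_ge0 // ltW.
  have -> : 2 / W * z = k + 2 * L by rewrite /z; field; rewrite gt_eqF.
  rewrite lerD2r natrX lnXn ?ltr0n // -[ln _ *+ _]mulr_natl /k natrM.
  by apply: ler_wpM2l => //; apply/ltW/ln_sublinear; rewrite ltr0n.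
have /andP[h _] := truncn_itv z0.
rewrite -natr1; apply: le_trans (_ : z + 1 <= _); first by rewrite lerD2r.
rewrite /z -[(n * q).+1%:R]natr1 -/k -/W.
have h1 : k * W <= k * W * (2 * L).
  by apply: ler_peMr; [rewrite mulr_ge0 // ltW | lra].
nra.
Qed.
End Assembly.

Section Bound.
Variables (R : realType) (K : nat) (c : R).
Hypothesis c_ge0 : 0 <= c.

(** The bound of [gap_mixing] for [x = n] and [y = q], with the constants of [label_poincare] and
    [spread_le] inserted; [E] stands for the factor exponential in the bandwidth. *)
Definition gap_bound (x y E : R) : R :=
  (x * y + 1) * (y * ((6 + 3 * ((x * y) ^+ K * (x * y) ^+ K) *
     (2 * (8 * x + 1) ^+ 9 * (y + 1) * c * E)) * (4 * (x * y)) ^+ K * (x * y))) + 2.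

Lemma gap_bound_le x y z E : 0 <= x -> 0 <= y -> y <= z -> 1 <= E ->
  gap_bound x y E <= gap_bound x z 1 * E.
Proof.
move=> x0 y0 yz E1; have z0 := le_trans y0 yz.
have E0 : 0 <= E by apply: le_trans E1.
have le1 : x * y <= x * z by apply: ler_wpM2l.
have xy0 : 0 <= x * y by apply: mulr_ge0.
have xz0 : 0 <= x * z by apply: mulr_ge0.
have lek : (x * y) ^+ K <= (x * z) ^+ K by apply: lerXn2r.
have le4 : (4 * (x * y)) ^+ K <= (4 * (x * z)) ^+ K.
  by apply: lerXn2r; rewrite ?nnegrE ?mulr_ge0 // ler_wpM2l.
have k0 : 0 <= (x * y) ^+ K by apply: exprn_ge0.
have k40 : 0 <= (4 * (x * y)) ^+ K by rewrite exprn_ge0 // mulr_ge0.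
have w0 : 0 <= 2 * (8 * x + 1) ^+ 9.
  by rewrite mulr_ge0 // exprn_ge0 // addr_ge0 // mulr_ge0.
have lew : 2 * (8 * x + 1) ^+ 9 * (y + 1) * c <= 2 * (8 * x + 1) ^+ 9 * (z + 1) * c.
  by apply: ler_wpM2r => //; apply: ler_wpM2l => //; rewrite lerD2r.
have wy0 : 0 <= 2 * (8 * x + 1) ^+ 9 * (y + 1) * c.
  by rewrite mulr_ge0 // mulr_ge0 // addr_ge0.
rewrite /gap_bound mulr1 [leRHS]mulrDl.
set wy := 2 * _ * (y + 1) * c in lew wy0 *; set wz := 2 * _ * (z + 1) * c in lew *.
apply: lerD; last by rewrite ler_peMr.
have kk0 : 0 <= (x * y) ^+ K * (x * y) ^+ K by apply: mulr_ge0.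
have kk : (x * y) ^+ K * (x * y) ^+ K <= (x * z) ^+ K * (x * z) ^+ K by apply: ler_pM.
have inner : 6 + 3 * ((x * y) ^+ K * (x * y) ^+ K) * (wy * E) <=
    (6 + 3 * ((x * z) ^+ K * (x * z) ^+ K) * wz) * E.
  rewrite [leRHS]mulrDl; apply: lerD; first by rewrite ler_peMr.
  rewrite [leLHS](mulrA _ wy E); apply: ler_wpM2r => //.
  apply: ler_pM => //; first by rewrite mulr_ge0.
  exact: ler_wpM2l.
have in0 : 0 <= 6 + 3 * ((x * y) ^+ K * (x * y) ^+ K) * (wy * E).
  by rewrite addr_ge0 // mulr_ge0 // mulr_ge0.
rewrite -[leRHS]mulrA; apply: ler_pM; rewrite ?addr_ge0 ?lerD2r //.
  by rewrite mulr_ge0 // mulr_ge0 // mulr_ge0.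
rewrite -[leRHS]mulrA; apply: ler_pM => //; first by rewrite mulr_ge0 // mulr_ge0.
rewrite [leRHS]mulrAC; apply: ler_pM => //; first by rewrite mulr_ge0.
by rewrite [leRHS]mulrAC; apply: ler_pM.
Qed.

(** [gap_bound] at [y = 8 * x ^ 4], the largest [q] left to the spectral gap; this removes [q] from
    the final bound. *)
Definition gap_poly : {poly R} :=
  let z := 8%:R%:P * 'X ^+ 4 in
  ('X * z + 1) * (z * ((6%:R%:P + 3%:R%:P * (('X * z) ^+ K * ('X * z) ^+ K) *
     (2%:R%:P * (8%:R%:P * 'X + 1) ^+ 9 * (z + 1) * c%:P)) *
     (4%:R%:P * ('X * z)) ^+ K * ('X * z))) + 2%:R%:P.

Lemma gap_polyE x : gap_poly.[x] = gap_bound x (8 * x ^+ 4) 1.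
Proof.
by rewrite /gap_poly /gap_bound !(hornerD, hornerM, horner_exp, hornerX, hornerC) mulr1.
Qed.
End Bound.

Lemma powR_exp2 (R : realType) (base : R) (b : nat) : 0 < base ->
  2 `^ (ln base / ln 2 * b%:R) = base ^+ b.
Proof.
move=> b0; have l2 : ln 2 != 0 :> R by rewrite gt_eqF // (lt_le_trans _ (ln2_ge R)) ?invr_gt0.
rewrite /powR pnatr_eq0 /= mulrAC divfK // mulr_natr.
by rewrite -lnXn // lnK // posrE exprn_gt0.
Qed.

(** The output of the machine on any one presentation is a member; it makes the state space
    nonempty. *)
Lemma finds_partition_Omega (M : machine) (d : nat) (G : sgraph) (q B : nat) :
  finds_partition M d G q B -> Omega G q B != set0.
Proof.
move=> h; have sb : bijective (fun i : 'I_#|G| => enum_val i : G).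
  by exists enum_rank; [exact: enum_valK | exact: enum_rankK].
by have [f fO _] := h _ sb; apply/set0Pn; exists (preim_partition f [set: G]).
Qed.

Lemma bandwidth_factor_le (R : realType) (a q D b : nat) (c : R) : 0 <= c ->
  (2 * a ^ 9 * q.+1 * 2 ^ (16 * b * D))%:R * c ^+ (1 + 8 * b) <=
  2 * a%:R ^+ 9 * (q%:R + 1) * (1 + c) * (2 ^+ (16 * D) * (1 + c) ^+ 8) ^+ b.
Proof.
move=> c0; have e1 : (2 ^ (16 * b * D))%:R = (2 ^+ (16 * D)) ^+ b :> R.
  by rewrite natrX -exprM mulnAC.
have e2 : (a ^ 9)%:R = a%:R ^+ 9 :> R by rewrite natrX.
have a0 : 0 <= a%:R ^+ 9 :> R by rewrite exprn_ge0.
move: e1 e2 a0; move: (2 ^ _)%N (a ^ 9)%N (a%:R ^+ 9) => w u v e1 e2 v0.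
have d0 : 0 <= (2 ^+ (16 * D)) ^+ b :> R by rewrite !exprn_ge0.
rewrite exprMn 3!natrM e1 e2 -[q.+1%:R]natr1; move: (_ ^+ b) d0 => z z0.
rewrite -!mulrA; apply: ler_wpM2l => //; apply: ler_wpM2l => //; apply: ler_wpM2l; first by rewrite addr_ge0.
rewrite [leRHS]mulrCA; apply: ler_wpM2l => //.
rewrite exprD expr1 exprM; apply: ler_pM => //; rewrite ?exprn_ge0 // ?lerDr //.
by do 2!(apply: lerXn2r; rewrite ?nnegrE ?exprn_ge0 ?addr_ge0 //); rewrite lerDr.
Qed.

Section Scale.
Variables (R : realType) (B D K0 : nat) (d0 : R).
Hypothesis d0_gt0 : 0 < d0.
Hypothesis B_gt0 : (0 < B)%N.
Let rho := (K0 + B)%N.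
Let K := (D.+1 ^ rho)%N.
Let c : R := mass_factor D rho d0 * descent_factor D rho d0.

(** Each unit of bandwidth adds [8 * D] cut edges, recorded for two partitions, and eight levels of
    descent at cost [c] each. *)
Definition bandwidth_base : R := 2 ^+ (16 * D) * (1 + c) ^+ 8.

Let c_ge0 : 0 <= c.
Proof.
have h : 0 <= (2 ^ (2 ^ K))%:R / d0 by rewrite divr_ge0 // ltW.
apply: mulr_ge0; first by rewrite addr_ge0 // mulr_ge0.
rewrite /descent_factor /= -/K; move: h; set e := _ / d0 => h.
by rewrite addr_ge0 // mulr_ge0 // mulr_ge0 // mulr_ge0 ?addr_ge0 // mulr_ge0.
Qed.

Let base_ge1 : 1 <= bandwidth_base.
Proof.
rewrite -[leLHS]mulr1; apply: ler_pM => //; first by rewrite exprn_ege1 // ler1n.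
by rewrite exprn_ege1 // lerDl.
Qed.

Lemma bandwidth_base_gt0 : 0 < bandwidth_base.
Proof. by apply: lt_le_trans base_ge1. Qed.

Lemma mixing_bound (G : sgraph) (q : nat) :
  max_degree_le G D -> (0 < #|G|)%N -> (0 < q)%N -> Omega G q B != set0 ->
  (4 * (K * K * 2 ^ (2 ^ K)))%N%:R <= d0 * #|G|%:R ->
  (forall r x, (q <= r)%N -> x \in Omega G r.+1 B -> #|x| = r.+1 ->
     d0 * #|G|%:R <= #|reductions r.+1 B K0 x|%:R) ->
  forall delta : R, 0 < delta -> delta <= 2^-1 ->
  exists2 t, mixed (@glauber R G q B K) (@glauber_pi R G q B K) delta t &
    t%:R <= (gap_poly K (1 + c) + 32%:R%:P * 'X ^+ 3).[#|G|%:R] *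
      bandwidth_base ^+ bandwidth G * ln (1 / delta).
Proof.
move=> hD n0 q0 Om0 nl hred delta dl0 dl1.
set n := #|G|; set b := bandwidth G; set E := bandwidth_base ^+ b.
have E1 : 1 <= E by apply: exprn_ege1.
have L0 : 0 <= ln (1 / delta) by apply: le_trans (ln_inv_ge dl0 dl1); rewrite invr_ge0.
have N0 : 0 <= n%:R :> R by [].
have c10 : 0 <= 1 + c by rewrite addr_ge0.
have G0 : 0 <= gap_bound K (1 + c) n%:R (8 * n%:R ^+ 4) 1.
  apply: le_trans (_ : gap_bound K (1 + c) n%:R 0 1 <= _).
    by rewrite /gap_bound mulr0 mul0r mulr0 add0r.
  have := @gap_bound_le R K (1 + c) c10 n%:R 0 (8 * n%:R ^+ 4) 1 N0 (lexx _).
  by rewrite mulr1; apply=> //; rewrite mulr_ge0 // exprn_ge0.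
rewrite hornerD gap_polyE !(hornerM, horner_exp, hornerX, hornerC).
have [large|small] := leqP (8 * n ^ 4) q.
  have [t ht le] := large_q_mixing K n0 q0 B_gt0 Om0 large dl0 dl1.
  exists t => //; apply: le_trans le _; apply: ler_wpM2r => //.
  rewrite -[leLHS]mulr1; apply: ler_pM => //; last by rewrite lerDr.
  by rewrite mulr_ge0 // exprn_ge0.
pose k : R := (n * q)%:R.
have red_large r x : (q <= r)%N -> x \in top G B r -> d0 * n%:R <= #|red B rho r x|%:R.
  move=> qr xt; have /andP[xO /eqP xr] : (x \in Omega G r.+1 B) && (#|x| == r.+1).
    by move: xt; rewrite in_set.
  apply: le_trans (hred r x qr xO xr) _; rewrite ler_nat.
  by apply/subset_leq_card; apply: reductions_sub_red.
have sp := spread_le hD n0 (leq_addl K0 B) d0_gt0 red_large nl.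
set A0 := (_ * _) in sp.
have A00 : 0 <= A0 by rewrite mulr_ge0 // exprn_ge0.
pose A1 : R := (6 + 3 * (k ^+ K * k ^+ K) * A0) * (4 * k) ^+ K.
have k1 : 1 <= k by rewrite ler1n muln_gt0 n0.
have kK : 0 <= k ^+ K by apply: exprn_ge0; apply: le_trans k1.
have A1_ge : 2 <= A1.
  rewrite -[leLHS]mulr1; apply: ler_pM => //.
    have : 0 <= 3 * (k ^+ K * k ^+ K) * A0 by rewrite mulr_ge0 // mulr_ge0 // mulr_ge0.
    lra.
  by apply: exprn_ege1; lra.
have poin psi : \sum_(f in LK G B q K) \sum_(g in LK G B q K) (psi (parts f) - psi (parts g)) ^+ 2 <=
    #|LK G B q K|%:R * A1 * label_form (LK G B q K) (psi \o @parts G q).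
  apply: le_trans (label_poincare hD n0 q0 (leqnn K) A00 sp psi) _.
  by rewrite /A1 !mulrA.
have [t ht le] := gap_mixing n0 q0 Om0 A1_ge poin dl0 dl1.
exists t => //; apply: le_trans le _; apply: ler_wpM2r => //.
apply: le_trans (_ : gap_bound K (1 + c) n%:R q%:R E <= _); last first.
  apply: le_trans (_ : gap_bound K (1 + c) n%:R (8 * n%:R ^+ 4) 1 * E <= _).
    by apply: gap_bound_le => //; rewrite -natrX -natrM ler_nat ltnW.
  apply: ler_wpM2r; first by apply: le_trans E1.
  have n3 : 0 <= n%:R ^+ 3 :> R by apply: exprn_ge0.
  by rewrite lerDl; apply: mulr_ge0.
have hA0 : A0 <= 2 * (8 * n%:R + 1) ^+ 9 * (q%:R + 1) * (1 + c) * E.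
  have -> : 8 * n%:R + 1 = (8 * n).+1%:R :> R by rewrite -[(8 * n).+1%:R]natr1 natrM.
  exact: bandwidth_factor_le.
rewrite /gap_bound -natr1 -natrM -/k; apply: lerD => //.
have k0 : 0 <= k by apply: le_trans k1.
apply: ler_wpM2l; first by rewrite addr_ge0.
apply: ler_wpM2l => //; apply: ler_wpM2r => //.
apply: ler_wpM2r; first by rewrite exprn_ge0 // mulr_ge0.
by rewrite lerD2l; apply: ler_wpM2l => //; rewrite mulr_ge0 // mulr_ge0.
Qed.
End Scale.

Theorem theorem5 (R : realType) (B : nat) (hB : (1 <= B)%N)
    (alpha eps : R) (halpha : 0 < alpha) (heps : 0 < eps)
    (F : sgraph -> Prop) (hF : partitionable F B alpha)
    (hdeg : exists D : nat, forall G : sgraph, F G -> max_degree_le G D) :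
  exists (K : nat) (p : {poly R}) (C : R) (N : nat),
  forall G : sgraph, F G -> connected_graph G -> (N <= #|G|)%N ->
  forall q : nat, (1 + eps) * (#|G|%:R / (alpha * B%:R)) <= q%:R ->
    stationary (@glauber R G q B K) (@glauber_pi R G q B K) /\
    (forall mu, stationary (@glauber R G q B K) mu ->
                mu =1 @glauber_pi R G q B K) /\
    forall delta : R, 0 < delta -> delta <= 2^-1 ->
    exists t : nat,
      is_mixing_time (@glauber R G q B K) (@glauber_pi R G q B K) delta t /\
      t%:R <= p.[#|G|%:R] * 2 `^ (C * (bandwidth G)%:R) * ln (1 / delta).
Proof.
(* [partitionable] asks for a strict inequality on [q]; with half of [eps] it follows from the weak
   one, for [q] and for every larger number of classes. *)
have eps2 : 0 < eps / 2 by rewrite divr_gt0.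
have [K0 [d0 [d0_gt0 [M [d [N0 hG]]]]]] := hF _ eps2.
have [D hD] := hdeg.
pose K := (D.+1 ^ (K0 + B))%N; pose base := bandwidth_base B D K0 d0.
pose c := mass_factor D (K0 + B) d0 * descent_factor D (K0 + B) d0.
pose L : nat := (4 * (K * K * 2 ^ (2 ^ K)))%N.
exists K, (gap_poly K (1 + c) + 32%:R%:P * 'X ^+ 3), (ln base / ln 2).
(* Beyond [L / d0] vertices, reductions outnumber those that can interfere with two given local
   changes by the margin [n_large]. *)
exists (maxn (maxn 1 N0) (Num.bound (L%:R / d0))) => G FG _.
rewrite !geq_max => /andP[/andP[n0 nN0] nL] q hq.
have x0 : 0 < #|G|%:R / (alpha * B%:R) :> R.
  by rewrite divr_gt0 ?ltr0n // mulr_gt0 ?ltr0n.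
have big r : (q <= r)%N -> (1 + eps / 2) * (#|G|%:R / (alpha * B%:R)) < r%:R.
  move=> qr; apply: lt_le_trans (_ : q%:R <= _); last by rewrite ler_nat.
  by apply: lt_le_trans hq; rewrite ltr_pM2r // ltrD2l ltr_pdivrMr // mulr_natr ltrDl.
have q0 : (0 < q)%N.
  by rewrite -(ltr_nat R); apply: le_lt_trans (big q (leqnn q)); rewrite mulr_ge0 ?addr_ge0 ?ltW.
have [/finds_partition_Omega Om0 _] := hG G FG nN0 q (big q (leqnn q)).
apply: glauber_conclusion => // delta dl0 dl1.
rewrite powR_exp2; last exact: bandwidth_base_gt0.
apply: mixing_bound => //; first exact: hD.
- rewrite mulrC -ler_pdivrMr //; apply: le_trans (ltW (archi_boundP _)) _.
    by rewrite divr_ge0 // ltW.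
  by rewrite ler_nat.
- by move=> r x qr xO xr; apply: (hG G FG nN0 r.+1 (big _ (leqW qr))).2.
Qed.
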